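(* Fix $1\le p<2$ and a constant $0<\varepsilon<1$. There exist constants $c,C>0$ (depending only on $p,\varepsilon$) such that for all integers $d\ge2$ and $n\ge1$ there is a distribution over $r\times n$ real matrices $\Pi$ with $r\le Cd^2$, such that every matrix in the support has at most two non-zero entries in each column, the expected number of non-zero entries in each column is at most $1+\varepsilon$, and for every fixed $A\in\mathbb{R}^{n\times d}$, with probability at least $0.99$, simultaneously for all $x\in\mathbb{R}^d$, $$c\|Ax\|_p\le\|\Pi Ax\|_p\le C(d\log d)^{1/p}\|Ax\|_p.$$
   Context: $\|y\|_p=(\sum_i|y_i|^p)^{1/p}$. The distribution depends only on $n,d,p,\varepsilon$, not on $A$. *)

(* Defs.v *)
From Stdlib Require Import Reals Lra.
Open Scope R_scope.

Record prob_space (Omega : Type) := {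
  measurable : (Omega -> Prop) -> Prop;
  prob : (Omega -> Prop) -> R;
  meas_full : measurable (fun _ => True);
  meas_compl : forall E, measurable E -> measurable (fun w => ~ E w);
  meas_cunion : forall F : nat -> Omega -> Prop,
      (forall k, measurable (F k)) -> measurable (fun w => exists k, F k w);
  prob_nonneg : forall E, measurable E -> 0 <= prob E;
  prob_full : prob (fun _ => True) = 1;
  prob_sigma_add : forall F : nat -> Omega -> Prop,
      (forall k, measurable (F k)) ->
      (forall k l w, k <> l -> F k w -> F l w -> False) ->
      infinite_sum (fun k => prob (F k)) (prob (fun w => exists k, F k w))
}.
Arguments measurable {Omega} _ _.
Arguments prob {Omega} _ _.

Fixpoint rsum (m : nat) (f : nat -> R) : R :=
  match m with O => 0 | S k => rsum k f + f k end.

(* x^a for x >= 0, with the convention 0^a = 0 (a > 0) *)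
Definition powR (x a : R) : R :=
  if Req_EM_T x 0 then 0 else Rpower x a.

Definition pnorm (p : R) (m : nat) (y : nat -> R) : R :=
  powR (rsum m (fun i => powR (Rabs (y i)) p)) (1 / p).

Definition mxv (k : nat) (M : nat -> nat -> R) (x : nat -> R) : nat -> R :=
  fun i => rsum k (fun j => M i j * x j).

Fixpoint nnz_col (r : nat) (M : nat -> nat -> R) (j : nat) : nat :=
  match r with
  | O => O
  | S k => (nnz_col k M j + (if Req_EM_T (M k j) 0 then 0 else 1))%nat
  end.

(* Expectation of a random variable X with values in {0,..,r}:
   E[X] = sum_{k<r} P(X > k). *)
Definition nat_expect {Omega} (PS : prob_space Omega) (r : nat)
  (X : Omega -> nat) : R :=
  rsum r (fun k => prob PS (fun w => (k < X w)%nat)).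

(* Main.v *)
Require Import Defs.
From Stdlib Require Import Reals.
From mathcomp Require all_boot all_order all_fingroup all_algebra ring lra.
From mathcomp Require mathcomp_extra boolp classical_sets reals sequences exp.
From mathcomp Require Rstruct Rstruct_topology.

(* Write N(y) for the p-th power of the p-norm and K = C0 d log d.  The matrix
   stacks kappa S, where S is a CountSketch with O(d^2) rows and
   kappa^p = K^(1 - p/2), on a sketch T with O(d^2) rows whose columns are active
   with probability at most eps; an active column has one entry +-2^(k/p) in a
   uniform row, where k has probability proportional to 2^-k.

   A Lewis basis U of the column space of A satisfies |z|_2^p <= N(Uz) and
   sum_i |U_i|_2^p <= 9 d, so |y_i|^p <= s_i N(y) with s_i = |U_i|_2^p.

   Upper bound for T: outside an event of small probability the entries of T can be
   truncated at 5400 d / s_i, and the truncated sum_r |(TU)_r|_2^p has expectation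
   O(d log d), each dyadic scale between 1 / (number of rows) and the truncation
   level contributing O(d).  Upper bound for S: coordinates with s_i >= 1/d load
   every row with O(d) entries, and on the others the Euclidean embedding property
   of S suffices.

   Lower bound for N(y) = 1: if the coordinates with |y_i|^p > 1/K carry half of the
   mass, then |y|_2 is at least K^(1/2 - 1/p) up to a constant and S preserves it, as
   S is a Euclidean embedding and the p-norm dominates the Euclidean norm; kappa
   makes up for the loss.  Otherwise y is spread, a constant proportion of about K
   rows of T receives an entry of size K^(-1/p), and random signs keep these rows
   large except with probability exp(-c K), which beats a net of exp(O(d log d))
   points. *)

(** [S] preserves Euclidean norms, which from below control the p-norm of concentrated vectors only;
    on spread vectors the Euclidean norm may be far smaller, and a [kappa] large enough for them
    would spoil the upper bound. The threshold 1/K balances the two: as d <= K, the scaled [S] loses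
    at most a factor of order kappa^p d^(p/2) <= K^(1 - p/2) K^(p/2) = K, of the same order as the
    loss of [T]. The net dictates K: its logarithm is O(d log d) and a single spread vector fails
    with probability about exp(-c K), so K has to be a large multiple of d log d. A net of
    polynomial resolution suffices because passing from a net point to its neighbours uses the upper
    bound for [T] only.

    Bad events are never handled as sets. Each is replaced by a nonnegative function that is at
    least 1 on it; six such functions, each of expectation at most 1/600, are added to a single F,
    and F < 1 is the good event, so Markov's inequality is applied once. The near-maximiser behind
    the Lewis basis comes from a supremum, so no compactness is involved; this costs only the
    constant 9. *)

(* MathComp is imported inside a module only: its notations would otherwise
   change the reading of the final statement, e.g. of [(2 <= d)%nat]. *)
Module SparseEmbedding.

Import all_boot all_order all_fingroup all_algebra ring lra.
Import mathcomp_extra boolp classical_sets reals sequences exp.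
Set Implicit Arguments. Unset Strict Implicit. Unset Printing Implicit Defensive.
Import Order.TTheory GRing.Theory Num.Theory.
Local Open Scope ring_scope.

(** * Concavity inequalities for real powers *)

Section Powers.
Context {R : realType}.
Implicit Types (a x y s t p : R).

(** Stands in for calculus: t^(a-1) is nonincreasing for a <= 1, and with one power factored out
    this gives the subadditivity, slope and affine bounds below. *)
Lemma powRS a x : 0 < a -> a `^ x = a * a `^ (x - 1).
Proof.
move=> a0; rewrite -[X in X * _](powRr1 (ltW a0)) -powRD; last by rewrite (gt_eqF a0) implybT.
by congr (_ `^ _); ring.
Qed.

Lemma powRV t p : 0 <= t -> t^-1 `^ p = (t `^ p)^-1.
Proof. by move=> t0; rewrite -(powR_inv1 t0) -powRrM mulN1r powRN. Qed.

Lemma powR_le_neg a x y : a <= 0 -> 0 < x -> x <= y -> y `^ a <= x `^ a.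
Proof.
move=> a0 x0 xy; have y0 : 0 < y by exact: lt_le_trans xy.
have -> : a = - - a by rewrite opprK.
rewrite !(powRN _ (- a)) lef_pV2 ?posrE ?powR_gt0 //.
by apply: ge0_ler_powR; rewrite ?nnegrE; lra.
Qed.

Lemma powR_subadd_slope a x y : a <= 1 -> 0 < x -> 0 <= y ->
  (x + y) `^ a <= x `^ a + x `^ (a - 1) * y.
Proof.
move=> a1 x0 y0; have xy0 : 0 < x + y by lra.
rewrite (powRS _ xy0) (powRS _ x0) -[X in X <= _]mulrC [x * _]mulrC -mulrDr.
apply: ler_wpM2r; first by lra.
apply: powR_le_neg; lra.
Qed.

Lemma powR_subadd a x y : 0 < a -> a <= 1 -> 0 <= x -> 0 <= y ->
  (x + y) `^ a <= x `^ a + y `^ a.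
Proof.
move=> a0 a1; rewrite le_eqVlt => /predU1P[<-|x0] y0.
  by rewrite add0r lerDr powR_ge0.
rewrite le_eqVlt in y0; case/predU1P: y0 => [<-|y0].
  by rewrite addr0 lerDl powR_ge0.
rewrite (powRS _ (addr_gt0 x0 y0)) (powRS _ x0) (powRS _ y0) mulrDl.
by apply: lerD; apply: ler_wpM2l; try apply: powR_le_neg; lra.
Qed.

Lemma powR_sum_le (I : Type) (r : seq I) (P : pred I) (F : I -> R) a :
  0 < a -> a <= 1 -> (forall i, P i -> 0 <= F i) ->
  (\sum_(i <- r | P i) F i) `^ a <= \sum_(i <- r | P i) F i `^ a.
Proof.
move=> a0 a1 F0.
suff : 0 <= \sum_(i <- r | P i) F i /\
   (\sum_(i <- r | P i) F i) `^ a <= \sum_(i <- r | P i) F i `^ a by case.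
apply: (big_ind2 (fun u v => 0 <= u /\ u `^ a <= v)) => [|x1 x2 y1 y2 [h1 h2] [h3 h4]|i Pi].
- by split=> //; rewrite powR0 // gt_eqF.
- split; first exact: addr_ge0.
  by apply: le_trans (powR_subadd a0 a1 h1 h3) _; exact: lerD.
- by split=> //; exact: F0.
Qed.

Lemma powR_le_affine a s t : 0 < a -> a <= 1 -> 0 < s -> 0 <= t ->
  t `^ a <= s `^ a + s `^ (a - 1) * t.
Proof.
move=> a0 a1 s0 t0; have [ts|st] := leP t s.
  have : t `^ a <= s `^ a.
    by apply: ge0_ler_powR; rewrite ?nnegrE //; lra.
  have := mulr_ge0 (powR_ge0 s (a - 1)) t0; lra.
rewrite (powRS _ (lt_trans s0 st)) mulrC.
have h : t `^ (a - 1) <= s `^ (a - 1) by apply: powR_le_neg; lra.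
have := ler_wpM2r t0 h; have := powR_ge0 s a; lra.
Qed.

(** Young's inequality for u^a and 1, where u = t/s, with conjugate exponents 1/a and 1/(1-a), reads
    u^a <= a u + (1 - a). This is the tangent at 1; scaling by s^a moves it to s. *)
Lemma powR_tangent a s t : 0 < a -> a < 1 -> 0 < s -> 0 <= t ->
  t `^ a <= s `^ a + a * s `^ (a - 1) * (t - s).
Proof.
move=> a0 a1 s0 t0.
have ha : 0 < a^-1 by rewrite invr_gt0.
have hb : 0 < (1 - a)^-1 by rewrite invr_gt0; lra.
have := @conjugate_powR R ((t / s) `^ a) 1 _ _ (powR_ge0 _ _) ler01 ha hb.
rewrite !invrK => /(_ ltac:(ring)).
rewrite -powRrM mulfV ?gt_eqF // powR1 mul1r mulr1.
have ts0 : 0 <= t / s by rewrite divr_ge0 // ltW.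
rewrite powRr1 // => h.
have -> : t = s * (t / s) by field; rewrite gt_eqF.
move: (t / s) ts0 h => u u0 h.
rewrite (powRM _ (ltW s0) u0) [s `^ a](powRS _ s0).
have e := powR_gt0 (a - 1) s0.
have : 0 <= s * s `^ (a - 1) by rewrite mulr_ge0 ?ltW.
move: (s `^ (a - 1)) e => q q0 sq0.
have -> : s * q + a * q * (s * u - s) = s * q * (u * a + (1 - a)) by ring.
exact: ler_wpM2l.
Qed.

Lemma powR_midconcave a s t : 0 < a -> a < 1 -> 0 <= s -> 0 <= t ->
  s `^ a + t `^ a <= 2 * ((s + t) / 2) `^ a.
Proof.
move=> a0 a1 s0 t0; have [e|ne] := eqVneq (s + t) 0.
  have -> : s = 0 by lra.
  have -> : t = 0 by lra.
  rewrite addr0 mul0r powR0 ?gt_eqF //; lra.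
have m0 : 0 < (s + t) / 2 by rewrite lt_neqAle eq_sym; apply/andP; split; [apply/eqP => h; move/eqP: ne; apply; lra|lra].
have := powR_tangent a0 a1 m0 s0; have := powR_tangent a0 a1 m0 t0.
set m := (s + t) / 2 in m0 *; move=> h1 h2.
have : a * m `^ (a - 1) * (t - m) + a * m `^ (a - 1) * (s - m) = 0.
  (have -> : t - m = - (s - m) by rewrite /m; field); ring.
lra.
Qed.

(** The sum is at most twice the maximum, and 4 = 2^2 bounds 2^p uniformly in p <= 2. *)
Lemma powR_normD p x y : 0 < p -> p <= 2 ->
  `|x + y| `^ p <= 4 * (`|x| `^ p + `|y| `^ p).
Proof.
move=> p0 p2; set m := Num.max `|x| `|y|.
have m0 : 0 <= m by rewrite le_max normr_ge0.
have h : `|x + y| <= 2 * m.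
  apply: le_trans (ler_normD _ _) _; have : `|x| <= m by rewrite le_max lexx.
  have : `|y| <= m by rewrite le_max lexx orbT.
  lra.
apply: (@le_trans _ _ ((2 * m) `^ p)).
  by apply: ge0_ler_powR; rewrite ?nnegrE ?normr_ge0 //; lra.
rewrite powRM //; apply: ler_pM; rewrite ?powR_ge0 //.
  have -> : 4 = 2 `^ 2 :> R by rewrite (powR_mulrn 2) //; ring.
  by apply: ler_powR; rewrite ?ler1n.
have := powR_ge0 `|x| p; have := powR_ge0 `|y| p.
rewrite /m; case: (leP `|x| `|y|) => _; lra.
Qed.

Lemma powR_normM p x y : `|x * y| `^ p = `|x| `^ p * `|y| `^ p.
Proof. by rewrite normrM powRM. Qed.

Lemma sqr_powR_half p x : (x ^+ 2) `^ (p / 2) = `|x| `^ p.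
Proof.
rewrite -(real_normK (num_real x)) -powR_mulrn // -powRrM.
by congr (_ `^ _); field.
Qed.

End Powers.

(** Lagrange's identity: the difference of the two sides is half the sum of the squared 2 x 2
    minors. *)
Lemma cauchy_schwarz_sum (R : realFieldType) (I : finType) (P : pred I) (a b : I -> R) :
  (\sum_(i | P i) a i * b i) ^+ 2 <= (\sum_(i | P i) a i ^+ 2) * (\sum_(i | P i) b i ^+ 2).
Proof.
rewrite -subr_ge0.
suff -> : (\sum_(i | P i) a i ^+ 2) * (\sum_(i | P i) b i ^+ 2) - (\sum_(i | P i) a i * b i) ^+ 2 =
  2^-1 * \sum_(i | P i) \sum_(j | P j) (a i * b j - a j * b i) ^+ 2.
  by rewrite mulr_ge0 ?invr_ge0 // sumr_ge0 // => i _; rewrite sumr_ge0 // => j _; exact: sqr_ge0.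
have e : \sum_(i | P i) \sum_(j | P j) (a i * b j - a j * b i) ^+ 2 =
   (\sum_(i | P i) a i ^+ 2) * (\sum_(j | P j) b j ^+ 2) +
   (\sum_(i | P i) b i ^+ 2) * (\sum_(j | P j) a j ^+ 2) -
   2 * ((\sum_(i | P i) a i * b i) * (\sum_(j | P j) a j * b j)).
  rewrite !big_distrlr /= mulr_sumr -!big_split -sumrB /=; apply: eq_bigr => i _.
  rewrite mulr_sumr -!big_split -sumrB /=; apply: eq_bigr => j _; ring.
by rewrite e; field.
Qed.

(** Matrix determinant lemma, from two factorisations of one block matrix into block triangular
    factors. *)
Lemma det_1_add_rank1 (R : comNzRingType) k (u : 'cV[R]_k) (v : 'rV[R]_k) :
  \det (1%:M + u *m v) = 1 + (v *m u) 0 0.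
Proof.
have e : block_mx 1%:M 0 u 1%:M *m block_mx 1%:M (- v) 0 (1%:M + u *m v) =
  block_mx (1%:M + v *m u) (- v) 0 1%:M *m block_mx 1%:M 0 u 1%:M.
  rewrite !mulmx_block !mul1mx !mulmx1 !mul0mx !mulmx0 !addr0 !add0r mulNmx addrK.
  by congr block_mx; rewrite mulmxN addrCA addNr addr0.
move/(congr1 determinant): e.
rewrite !det_mulmx det_lblock !det_ublock !det1 !mul1r !mulr1 => ->.
by rewrite det_mx11 !mxE eqxx.
Qed.

(** * Approximate Lewis bases *)

Section Lewis.
Context {R : realType} (p : R).
Hypotheses (p1 : 1 <= p) (p2 : p <= 2).

Definition row_sq n k (U : 'M[R]_(n, k)) i := \sum_j U i j ^+ 2.
Definition mass n k (U : 'M[R]_(n, k)) := \sum_i row_sq U i `^ (p / 2).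

Lemma row_sq_ge0 n k (U : 'M[R]_(n, k)) i : 0 <= row_sq U i.
Proof. by apply: sumr_ge0 => j _; exact: sqr_ge0. Qed.

Lemma mass_ge0 n k (U : 'M[R]_(n, k)) : 0 <= mass U.
Proof. by apply: sumr_ge0 => j _; exact: powR_ge0. Qed.

Lemma p_gt0 : 0 < p. Proof. exact: lt_le_trans ltr01 p1. Qed.

Lemma entry_le_mass n k (U : 'M[R]_(n, k)) i j : `|U i j| <= mass U `^ p^-1.
Proof.
have q1 := p1; have q2 := p2.
have p0 := p_gt0.
rewrite -[X in X <= _](@powRr1 R) // -[X in _ `^ X](@mulfV _ p) ?gt_eqF // powRrM.
apply: ge0_ler_powR; rewrite ?nnegrE ?powR_ge0 ?mass_ge0 ?invr_ge0 ?(ltW p0) //.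
rewrite -sqr_powR_half; apply: (@le_trans _ _ (row_sq U i `^ (p / 2))).
  apply: ge0_ler_powR; rewrite ?nnegrE ?sqr_ge0 ?row_sq_ge0 //; first lra.
  rewrite /row_sq (bigD1 j) //= lerDl; apply: sumr_ge0 => l _; exact: sqr_ge0.
by rewrite /mass (bigD1 i) //= lerDl; apply: sumr_ge0 => l _; exact: powR_ge0.
Qed.

(** Makes the functional of [lewis_maximizer] bounded: the left inverse B recovers the entries of G
    from A G, and the Leibniz expansion of the determinant has k! terms. *)
Lemma det_le_mass n k (A : 'M[R]_(n, k)) (B : 'M[R]_(k, n)) (G : 'M[R]_k) :
  B *m A = 1%:M ->
  `|\det G| <= (k`!)%:R * (\sum_i \sum_j `|B i j|) ^+ k * (mass (A *m G) `^ p^-1) ^+ k.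
Proof.
move=> BA; set b := \sum_i _; set f := _ `^ _.
have f0 : 0 <= f by exact: powR_ge0.
have G1 i j : `|G i j| <= b * f.
  have -> : G = B *m (A *m G) by rewrite mulmxA BA mul1mx.
  rewrite mxE; apply: le_trans (ler_norm_sum _ _ _) _.
  apply: (@le_trans _ _ (\sum_l `|B i l| * f)).
    by apply: ler_sum => l _; rewrite normrM; apply: ler_wpM2l => //; exact: entry_le_mass.
  rewrite -mulr_suml; apply: ler_wpM2r => //.
  rewrite /b (bigD1 i) //= lerDl; apply: sumr_ge0 => l _; exact: sumr_ge0.
rewrite -mulrA -exprMn /determinant; apply: le_trans (ler_norm_sum _ _ _) _.
have -> : (k`!)%:R = \sum_(s : 'S_k) (1 : R) by rewrite sumr_const card_Sn.
rewrite mulr_suml; apply: ler_sum => s _.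
rewrite mul1r normrM normrX normrN1 expr1n mul1r normr_prod.
have -> : (b * f) ^+ k = \prod_(i < k) (b * f) by rewrite prodr_const card_ord.
by apply: ler_prod => i _; rewrite normr_ge0 G1.
Qed.

(** For a unit vector x this doubles the direction x and fixes its orthogonal complement. *)
Definition stretch k (x : 'cV[R]_k) : 'M[R]_k := 1%:M + x *m x^T.

Lemma det_stretch k (x : 'cV[R]_k) : \sum_j x j 0 ^+ 2 = 1 -> \det (stretch x) = 2.
Proof.
move=> x1; rewrite det_1_add_rank1 mxE.
suff -> : \sum_j x^T 0 j * x j 0 = 1 by ring.
by rewrite -x1; apply: eq_bigr => j _; rewrite mxE expr2.
Qed.

(** The component along x is doubled, so its square increases by 2^2 - 1 = 3 times itself. *)
Lemma row_sq_stretch n k (U : 'M[R]_(n, k)) (x : 'cV[R]_k) i :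
  \sum_j x j 0 ^+ 2 = 1 ->
  row_sq (U *m stretch x) i = row_sq U i + 3 * (U *m x) i 0 ^+ 2.
Proof.
move=> x1; rewrite /row_sq /stretch mulmxDr mulmx1 mulmxA.
set t := (U *m x) i 0.
have e j : (U + U *m x *m x^T) i j = U i j + t * x j 0.
  by rewrite mxE; congr (_ + _); rewrite mxE big_ord1 [x^T _ _]mxE -/t.
under eq_bigr => j _ do rewrite e.
transitivity (\sum_j U i j ^+ 2 + 2 * t * (\sum_j U i j * x j 0) + t ^+ 2 * \sum_j x j 0 ^+ 2).
  by rewrite !mulr_sumr -!big_split /=; apply: eq_bigr => j _; ring.
have -> : \sum_j U i j * x j 0 = t by rewrite /t mxE.
by rewrite x1; ring.
Qed.

(* a zero row contributes nothing, whatever the junk value of its weight *)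
Definition lewis_form n k (U : 'M[R]_(n, k)) (x : 'cV[R]_k) :=
  \sum_i row_sq U i `^ (p / 2 - 1) * (U *m x) i 0 ^+ 2.

Lemma row_dot_sq n k (U : 'M[R]_(n, k)) (x : 'cV[R]_k) i :
  (U *m x) i 0 ^+ 2 <= row_sq U i * \sum_j x j 0 ^+ 2.
Proof. rewrite mxE; exact: cauchy_schwarz_sum. Qed.

Lemma mass_stretch n k (U : 'M[R]_(n, k)) (x : 'cV[R]_k) :
  \sum_j x j 0 ^+ 2 = 1 ->
  mass (U *m stretch x) <= mass U + 3 * lewis_form U x.
Proof.
have q1 := p1; have q2 := p2.
move=> x1; rewrite /mass /lewis_form mulr_sumr -big_split /=.
apply: ler_sum => i _; rewrite row_sq_stretch //.
have := row_dot_sq U x i; rewrite x1 mulr1.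
have := row_sq_ge0 U i; rewrite le_eqVlt => /predU1P[<-|u0] h.
  have -> : (U *m x) i 0 ^+ 2 = 0 by apply/eqP; rewrite eq_le h sqr_ge0.
  by rewrite !mulr0 !addr0.
apply: le_trans (powR_subadd_slope _ u0 _) _; first lra.
  by rewrite mulr_ge0 // sqr_ge0.
by rewrite le_eqVlt; apply/orP; left; apply/eqP; ring.
Qed.

(** Since p/2 - 1 <= 0, replacing the squared row norm by the smaller squared component along x only
    increases the weight, and the term becomes a p-th power. *)
Lemma lewis_form_le n k (U : 'M[R]_(n, k)) (x : 'cV[R]_k) :
  \sum_j x j 0 ^+ 2 = 1 -> lewis_form U x <= \sum_i `|(U *m x) i 0| `^ p.
Proof.
have q1 := p1; have q2 := p2.
move=> x1; apply: ler_sum => i _; rewrite -sqr_powR_half.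
have := row_dot_sq U x i; rewrite x1 mulr1.
have := sqr_ge0 ((U *m x) i 0).
move: ((U *m x) i 0 ^+ 2) => t; rewrite le_eqVlt => /predU1P[<-|t0] h.
  by rewrite mulr0 powR_ge0.
rewrite [t `^ _](powRS _ t0) mulrC; apply: ler_wpM2l; first exact: ltW.
by apply: powR_le_neg => //; lra.
Qed.

Lemma ratio_growth (u a b : R) : 0 <= u -> 0 < a -> 0 < b -> b <= a * (3 / 2) ->
  u / a * (4 / 3) <= u * 2 / b.
Proof.
move=> u0 a0 b0 ab; rewrite ler_pdivlMr //.
have -> : u / a * (4 / 3) * b = u * (4 / 3 / a * b) by ring.
apply: ler_wpM2l => //.
rewrite mulrAC ler_pdivrMr //; lra.
Qed.

(* G nearly maximises |det G| / mass (A G)^(k/p).  If the form were small at some x,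
   the stretch by 2 along x would double the determinant while the mass grows by a
   factor 1 + 1/(3k) only. *)
Lemma lewis_maximizer n k (A : 'M[R]_(n, k.+1)) (B : 'M[R]_(k.+1, n)) :
  B *m A = 1%:M ->
  exists G : 'M[R]_(k.+1), [/\ G \in unitmx, 0 < mass (A *m G) &
    forall x : 'cV[R]_(k.+1), \sum_j x j 0 ^+ 2 = 1 ->
      mass (A *m G) / (9 * k.+1%:R) <= lewis_form (A *m G) x].
Proof.
have q1 := p1; have q2 := p2.
move=> BA; have p0 := p_gt0.
pose phi (G : 'M[R]_(k.+1)) := mass (A *m G) `^ p^-1.
have phi0 G : 0 <= phi G by exact: powR_ge0.
pose psi (G : 'M[R]_(k.+1)) := `|\det G| / phi G ^+ k.+1.
pose c : R := (k.+1`!)%:R * (\sum_i \sum_j `|B i j|) ^+ k.+1.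
have c0 : 0 <= c.
  apply: mulr_ge0; first exact: ler0n.
  by apply: exprn_ge0; apply: sumr_ge0 => i _; apply: sumr_ge0.
have detc G : `|\det G| <= c * phi G ^+ k.+1 by exact: det_le_mass.
have phi_gt0 G : \det G != 0 -> 0 < phi G.
  move=> d0; rewrite lt0r phi0 andbT; apply/eqP => e.
  by move: (detc G); rewrite e expr0n mulr0 normr_le0 (negPf d0).
have psic G : psi G <= c.
  rewrite /psi; have [->|d0] := eqVneq (\det G) 0; first by rewrite normr0 mul0r.
  by rewrite ler_pdivrMr ?exprn_gt0 ?phi_gt0.
pose S := [set psi G | G in [set: 'M[R]_(k.+1)]]%classic.
have psi1 : 0 < psi 1%:M.
  by rewrite /psi det1 normr1 mul1r invr_gt0 exprn_gt0 // phi_gt0 // det1 oner_neq0.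
have supS : has_sup S.
  split; first by exists (psi 1%:M); exists 1%:M.
  by exists c => _ [G _ <-].
have ubS G : psi G <= sup S by apply: sup_upper_bound => //; exists G.
have s0 : 0 < sup S by exact: lt_le_trans psi1 (ubS _).
(* [psi G] exceeds 3/4 of the supremum, so a growth of [psi] by 4/3 is a contradiction. The factor
   4/3 is 2 (growth of the determinant) over 3/2 (bound on the growth of the denominator). *)
have [_ [G _ <-] hG] := sup_adherent (divr_gt0 s0 (ltr0n R 4)) supS.
have psiG : 0 < psi G by move: hG s0; move: (psi G) (sup S) => u v; clear; lra.
have detG : \det G != 0.
  by apply/eqP => e; move: psiG; rewrite /psi e normr0 mul0r ltxx.
have mG : 0 < mass (A *m G).
  by apply: (gt0_powR _ (mass_ge0 _) (phi_gt0 _ detG)); rewrite invr_gt0.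
exists G; split => //; first by rewrite unitmxE unitfE.
move=> x x1; rewrite leNgt; apply/negP => bad.
pose G' := G *m stretch x.
have detG' : \det G' = \det G * 2 by rewrite det_mulmx det_stretch.
have detG'0 : \det G' != 0 by rewrite detG' mulf_neq0 ?pnatr_eq0.
have k0 : 0 < k.+1%:R :> R by rewrite ltr0n.
have [K hK] : exists K : R, K = k.+1%:R by exists k.+1%:R.
rewrite -hK in k0 bad.
(* If the form is below mass / (9K), the stretch multiplies the mass by at most 1 + 3/(9K) = 1 + e,
   and (1 + e)^K <= exp(1/3) <= 3/2. *)
pose e : R := (3 * K)^-1.
have e0 : 0 < e by rewrite invr_gt0 mulr_gt0.
have h1e : 0 <= 1 + e by rewrite addr_ge0 // ltW.
have le1 : mass (A *m G') <= mass (A *m G) * (1 + e).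
  rewrite /G' mulmxA; apply: le_trans (mass_stretch _ x1) _.
  have -> : mass (A *m G) * (1 + e) = mass (A *m G) + 3 * (mass (A *m G) / (9 * K)).
    by rewrite /e; field; rewrite gt_eqF.
  by move: bad; clear; lra.
have le2 : phi G' <= phi G * (1 + e).
  apply: (@le_trans _ _ ((mass (A *m G) * (1 + e)) `^ p^-1)).
    apply: ge0_ler_powR; rewrite ?nnegrE ?mass_ge0 ?invr_ge0 ?(ltW p0) //.
    by rewrite mulr_ge0 ?mass_ge0.
  rewrite powRM ?mass_ge0 //.
  apply: ler_wpM2l; first exact: powR_ge0.
  apply: ler1_powR; first by rewrite lerDl ltW.
  by rewrite invf_le1.
have le3 : (1 + e) ^+ k.+1 <= 3 / 2.
  have h1 : 1 + e <= expR e by exact: expR_ge1Dx.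
  apply: (@le_trans _ _ (expR e ^+ k.+1)).
    by apply: lerXn2r; rewrite ?nnegrE ?expR_ge0 //.
  rewrite -expRM_natl -hK.
  have -> : K * e = 3^-1 by rewrite /e; field; rewrite gt_eqF.
  have := @expR_ge1Dx R (- 3^-1); rewrite expRN => h.
  have E := @expR_gt0 R (3^-1).
  move: h; rewrite -[X in _ <= X -> _]div1r ler_pdivlMr //; clear -E; move: (expR _) E => v v0; lra.
have le4 : phi G' ^+ k.+1 <= phi G ^+ k.+1 * (3 / 2).
  apply: (@le_trans _ _ ((phi G * (1 + e)) ^+ k.+1)).
    by apply: lerXn2r; rewrite ?nnegrE ?phi0 // mulr_ge0.
  by rewrite exprMn; apply: ler_wpM2l => //; apply: exprn_ge0.
have := ubS G'; apply/negP; rewrite -ltNge.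
apply: (@lt_le_trans _ _ (psi G * (4 / 3))).
  by move: hG s0; move: (psi G) (sup S) => u v; clear; lra.
have q0 : 0 < phi G ^+ k.+1 by rewrite exprn_gt0 // phi_gt0.
have q'0 : 0 < phi G' ^+ k.+1 by rewrite exprn_gt0 // phi_gt0.
have -> : psi G' = `|\det G| * 2 / phi G' ^+ k.+1 by rewrite /psi detG' normrM normr_nat.
exact: ratio_growth (normr_ge0 _) q0 q'0 le4.
Qed.

Lemma sum_sq_scale k (x : 'cV[R]_k) l :
  \sum_j (l *: x) j 0 ^+ 2 = l ^+ 2 * \sum_j x j 0 ^+ 2.
Proof. by rewrite mulr_sumr; apply: eq_bigr => j _; rewrite mxE exprMn. Qed.

(** A may be rank deficient, so the near-maximiser is taken for the column factor C of a rank
    factorisation A = C D, which has a left inverse. The basis C G is then scaled by l with l^p = 9k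
    / mass: the lower bound acquires constant 1 and the mass becomes 9k. *)
Lemma lewis_basis n d (A : 'M[R]_(n, d)) :
  exists k (U : 'M[R]_(n, k)), [/\ (k <= d)%N,
    forall x : 'cV[R]_d, exists z : 'cV[R]_k, A *m x = U *m z,
    forall z : 'cV[R]_k, (\sum_j z j 0 ^+ 2) `^ (p / 2) <= \sum_i `|(U *m z) i 0| `^ p &
    \sum_i (\sum_j U i j ^+ 2) `^ (p / 2) <= 9 * k%:R].
Proof.
have q1 := p1; have q2 := p2.
have p0 := p_gt0.
have ph0 : 0 < p / 2 by lra.
have /row_fullP [B BA] := col_base_full A.
suff main k (C : 'M[R]_(n, k)) (D : 'M[R]_(k, d)) (B' : 'M[R]_(k, n)) :
    B' *m C = 1%:M -> C *m D = A -> (k <= d)%N ->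
    exists k (U : 'M[R]_(n, k)), [/\ (k <= d)%N,
    forall x : 'cV[R]_d, exists z : 'cV[R]_k, A *m x = U *m z,
    forall z : 'cV[R]_k, (\sum_j z j 0 ^+ 2) `^ (p / 2) <= \sum_i `|(U *m z) i 0| `^ p &
    \sum_i (\sum_j U i j ^+ 2) `^ (p / 2) <= 9 * k%:R].
  exact: main BA (mulmx_base A) (rank_leq_col A).
case: k C D B' => [|k] C D {BA}B BA eA kd.
  exists 0%N, 0; split => //.
  - by move=> x; exists 0; rewrite -eA (flatmx0 D) mulmx0 !mul0mx.
  - move=> z; rewrite big_ord0 powR0 ?gt_eqF //; apply: sumr_ge0 => i _; exact: powR_ge0.
  - rewrite mulr0 big1 // => i _; rewrite big_ord0 powR0 // gt_eqF //.
have [G [Gu m0 hG]] := lewis_maximizer BA.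
set U := C *m G in m0 hG.
have k0 : 0 < k.+1%:R :> R by rewrite ltr0n.
pose r : R := 9 * k.+1%:R / mass U.
have r0 : 0 < r by rewrite divr_gt0 // mulr_gt0.
pose l := r `^ p^-1; have l0 : 0 < l by exact: powR_gt0.
have lp : l `^ p = r by rewrite -powRrM mulVf ?gt_eqF // powRr1 // ltW.
exists k.+1, (l *: U); split => //.
- move=> x; exists (l^-1 *: (invmx G *m (D *m x))).
  rewrite -scalemxAr -scalemxAl scalerA mulVf ?gt_eqF // scale1r /U.
  by rewrite -mulmxA mulKVmx // mulmxA eA.
- move=> z; have -> : \sum_i `|((l *: U) *m z) i 0| `^ p = r * \sum_i `|(U *m z) i 0| `^ p.
    rewrite mulr_sumr; apply: eq_bigr => i _.
    by rewrite -scalemxAl mxE powR_normM gtr0_norm // lp.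
  set s := \sum_j z j 0 ^+ 2.
  have s0 : 0 <= s by apply: sumr_ge0 => j _; exact: sqr_ge0.
  move: s0; rewrite le_eqVlt => /predU1P[<-|s0].
    rewrite powR0 ?gt_eqF //; apply: mulr_ge0; first exact: ltW.
    by apply: sumr_ge0 => i _; exact: powR_ge0.
  pose t := s `^ 2^-1; have t0 : 0 < t by exact: powR_gt0.
  have t2 : t ^+ 2 = s.
    by rewrite -powR_mulrn ?ltW // /t -powRrM mulVf ?pnatr_eq0 // powRr1 // ltW.
  have u1 : \sum_j (t^-1 *: z) j 0 ^+ 2 = 1.
    by rewrite sum_sq_scale -/s -t2 -exprMn mulVf ?gt_eqF // expr1n.
  have := le_trans (hG _ u1) (lewis_form_le _ u1).
  have -> : \sum_i `|(U *m (t^-1 *: z)) i 0| `^ p = (t `^ p)^-1 * \sum_i `|(U *m z) i 0| `^ p.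
    rewrite mulr_sumr; apply: eq_bigr => i _.
    by rewrite -scalemxAr mxE powR_normM normfV gtr0_norm // (powRV _ (ltW t0)).
  have <- : t `^ p = s `^ (p / 2) by rewrite -powRrM; congr (_ `^ _); ring.
  have tp0 : 0 < t `^ p by exact: powR_gt0.
  rewrite ler_pdivlMl // => h; rewrite /r.
  rewrite mulrAC ler_pdivlMr // [leRHS]mulrC.
  by rewrite -ler_pdivrMr ?mulr_gt0 // -mulrA.
- rewrite -[9 * _](@mulfVK _ (mass U)) ?gt_eqF // -/r /mass mulr_sumr.
  apply: ler_sum => i _; rewrite /row_sq.
  have -> : \sum_j (l *: U) i j ^+ 2 = l ^+ 2 * \sum_j U i j ^+ 2.
    by rewrite mulr_sumr; apply: eq_bigr => j _; rewrite mxE exprMn.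
  rewrite powRM ?sqr_ge0 ?row_sq_ge0 // sqr_powR_half gtr0_norm // lp //.
Qed.

End Lewis.

(** * Expectation over independent columns *)

Definition upd (O : Type) (w : nat -> O) n o := fun i => if i == n then o else w i.

Lemma sum_upd (V : nmodType) (O : Type) (F : nat -> O -> V) n w o :
  \sum_(i < n.+1) F i (upd w n o i) = \sum_(i < n) F i (w i) + F n o.
Proof.
rewrite big_ord_recr /= {2}/upd eqxx; congr (_ + _); apply: eq_bigr => i _.
by rewrite /upd ltn_eqF.
Qed.

Section Expectation.
Context {R : realType} {O : finType} (o0 : O) (pr : O -> R).

Implicit Types (n : nat) (F G : (nat -> O) -> R) (a : R).

(* only the coordinates below n of a sample are random *)
Fixpoint Ex n (F : (nat -> O) -> R) : R :=
  if n is m.+1 then \sum_o pr o * Ex m (fun w => F (upd w m o)) else F (fun=> o0).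

Lemma ExD n F G : Ex n (fun w => F w + G w) = Ex n F + Ex n G.
Proof.
elim: n F G => [|n IH] F G //=; rewrite -big_split /=; apply: eq_bigr => o _.
by rewrite IH mulrDr.
Qed.

Lemma ExZ n a F : Ex n (fun w => a * F w) = a * Ex n F.
Proof.
elim: n F => [|n IH] F //=; rewrite mulr_sumr; apply: eq_bigr => o _.
by rewrite IH mulrCA.
Qed.

Lemma eq_Ex n F G : F =1 G -> Ex n F = Ex n G.
Proof. by move=> /funext ->. Qed.

Lemma Ex0 n : Ex n (fun=> 0) = 0.
Proof. by rewrite -[RHS](mul0r (Ex n (fun=> 0))) -ExZ; apply: eq_Ex => w; rewrite mul0r. Qed.

Lemma Ex_sum n (I : Type) (r : seq I) (P : pred I) (F : I -> (nat -> O) -> R) :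
  Ex n (fun w => \sum_(i <- r | P i) F i w) = \sum_(i <- r | P i) Ex n (F i).
Proof.
elim: r => [|i r IH]; first by rewrite big_nil -{2}(Ex0 n); apply: eq_Ex => w; rewrite big_nil.
rewrite big_cons; case: ifP => Pi.
  by rewrite -IH -ExD; apply: eq_Ex => w; rewrite big_cons Pi.
by rewrite -IH; apply: eq_Ex => w; rewrite big_cons Pi.
Qed.

(** The last coordinate is averaged first, that is, conditionally on the earlier ones; the
    second-moment and potential inductions need this order. *)
Lemma ExS n F : Ex n.+1 F = Ex n (fun w => \sum_o pr o * F (upd w n o)).
Proof. by rewrite Ex_sum /=; apply: eq_bigr => o _; rewrite ExZ. Qed.

Hypothesis pr0 : forall o, 0 <= pr o.
Hypothesis pr1 : \sum_o pr o = 1.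

Lemma Ex_cst n a : Ex n (fun=> a) = a.
Proof. by elim: n => [//|n IH] /=; rewrite -mulr_suml pr1 mul1r. Qed.

Lemma le_Ex n F G : (forall w, F w <= G w) -> Ex n F <= Ex n G.
Proof.
elim: n F G => [|n IH] F G h //=; apply: ler_sum => o _.
by apply: ler_wpM2l => //; exact: IH.
Qed.

Lemma Ex_ge0 n F : (forall w, 0 <= F w) -> 0 <= Ex n F.
Proof. by move=> h; rewrite -(Ex0 n); exact: le_Ex. Qed.

Lemma Ex_coord n j (f : O -> R) : (j < n)%N -> Ex n (fun w => f (w j)) = \sum_o pr o * f o.
Proof.
elim: n => [//|n IH]; rewrite ltnS leq_eqVlt => /predU1P[->|jn].
  by rewrite ExS -[RHS](Ex_cst n); apply: eq_Ex => w; apply: eq_bigr => o _; rewrite /upd eqxx.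
rewrite ExS -(IH jn); apply: eq_Ex => w.
rewrite -[RHS]mul1r -pr1 mulr_suml; apply: eq_bigr => o _.
by rewrite /upd ltn_eqF.
Qed.

End Expectation.

(** * Sketches with one random entry per column, and the Gram error of CountSketch *)

Definition sgn {R : pzRingType} (b : bool) : R := if b then 1 else -1.

Section Sketch.
Context {R : realType} {O : finType} (o0 : O) (pr : O -> R).
Hypothesis pr0 : forall o, 0 <= pr o.
Hypothesis pr1 : \sum_o pr o = 1.
Context {B L : finType} (q : L -> R) (b : O -> B) (s : O -> bool) (l : O -> L).
Local Notation E := (Ex o0 pr).

(* the row b o, the sign s o and the level l o of a random column are independent,
   the first two being uniform *)
Definition sketch_law := forall f : B -> bool -> L -> R,
  \sum_o pr o * f (b o) (s o) (l o) =
  #|B|%:R^-1 * \sum_r \sum_t q t * ((f r true t + f r false t) / 2).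

Hypothesis law : sketch_law.

Definition ent (th : L -> R) o r : R := if b o == r then sgn (s o) * th (l o) else 0.

(** The entry value [th] may depend on the column, so that sketches truncated at a column-dependent
    level have the same form. *)
Definition sk n (th : nat -> L -> R) (w : nat -> O) (y : nat -> R) (r : B) : R :=
  \sum_(i < n) ent (th i) (w i) r * y i.

Lemma sk_upd n th w o y r :
  sk n.+1 th (upd w n o) y r = sk n th w y r + ent (th n) o r * y n.
Proof. exact: (sum_upd (fun i o => ent (th i) o r * y i)). Qed.

Lemma skD n th w y z r : sk n th w (fun i => y i + z i) r = sk n th w y r + sk n th w z r.
Proof. by rewrite /sk -big_split /=; apply: eq_bigr => i _; rewrite mulrDr. Qed.

Lemma skZ n th w a y r : sk n th w (fun i => a * y i) r = a * sk n th w y r.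
Proof. by rewrite /sk mulr_sumr; apply: eq_bigr => i _; rewrite mulrCA. Qed.

Lemma eq_sk n th w y z r : (forall i, (i < n)%N -> y i = z i) ->
  sk n th w y r = sk n th w z r.
Proof. by move=> h; apply: eq_bigr => i _; rewrite h. Qed.

Lemma sum_pick (g : B -> R) x : \sum_r (if x == r then g r else 0) = g x.
Proof.
rewrite -big_mkcond /= (big_pred1 x) // => r; exact: eq_sym.
Qed.

Lemma sgn_sq t : sgn t * sgn t = 1 :> R.
Proof. by case: t => /=; rewrite /sgn ?mulr1 // mulrNN mulr1. Qed.

Section EuclideanEmbedding.
Hypotheses (Lunit : #|L| = 1%N) (q1 : forall t, q t = 1).
Context {J : finType} (V : nat -> J -> R).

Let one : nat -> L -> R := fun _ _ => 1.
Let X n w r j := sk n one w (V^~ j) r.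
Let D n w j k := \sum_r X n w r j * X n w r k - \sum_(i < n) V i j * V i k.
Definition rsq (v : J -> R) := \sum_j v j ^+ 2.

Lemma rsq_ge0 v : 0 <= rsq v.
Proof. by apply: sumr_ge0 => j _; exact: sqr_ge0. Qed.

Lemma Xupd n w o r j : X n.+1 (upd w n o) r j = X n w r j + (if b o == r then sgn (s o) * V n j else 0).
Proof. by rewrite /X sk_upd /ent; case: eqP => _; rewrite ?mul0r // mulr1. Qed.

Lemma law1 (f : B -> bool -> R) :
  \sum_o pr o * f (b o) (s o) = #|B|%:R^-1 * \sum_r (f r true + f r false) / 2.
Proof.
rewrite (law (fun r t _ => f r t)); congr (_ * _); apply: eq_bigr => r _.
rewrite (eq_bigr (fun=> (f r true + f r false) / 2)); last by move=> t _; rewrite q1 mul1r.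
by rewrite sumr_const Lunit.
Qed.

Lemma sum_sq_row n w o :
  \sum_r rsq (X n.+1 (upd w n o) r) =
  \sum_r rsq (X n w r) + (2 * sgn (s o) * (\sum_j X n w (b o) j * V n j) + rsq (V n)).
Proof.
transitivity (\sum_r (rsq (X n w r) + (if b o == r then
  2 * sgn (s o) * (\sum_j X n w r j * V n j) + rsq (V n) else 0))).
  apply: eq_bigr => r _; rewrite /rsq; case: eqP => br; last first.
    by rewrite addr0; apply: eq_bigr => j _; rewrite Xupd; move/eqP/negPf: br => ->; rewrite addr0.
  rewrite mulr_sumr -!big_split /=; apply: eq_bigr => j _; rewrite Xupd br eqxx.
  by rewrite sqrrD exprMn [sgn _ ^+ 2]expr2 sgn_sq; ring.
by rewrite big_split /= (sum_pick (fun r => _ * (\sum_j X n w r j * V n j) + _)).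
Qed.

Lemma D_upd n w o j k :
  D n.+1 (upd w n o) j k = D n w j k + sgn (s o) * (X n w (b o) j * V n k + V n j * X n w (b o) k).
Proof.
rewrite /D big_ord_recr /=.
have -> : \sum_r X n.+1 (upd w n o) r j * X n.+1 (upd w n o) r k =
  \sum_r X n w r j * X n w r k +
  (sgn (s o) * (X n w (b o) j * V n k + V n j * X n w (b o) k) + V n j * V n k).
  rewrite -(sum_pick (fun r => sgn (s o) * (X n w r j * V n k + V n j * X n w r k) + V n j * V n k)).
  rewrite -big_split /=; apply: eq_bigr => r _; rewrite !Xupd; case: eqP => _; last by rewrite !addr0.
  have := sgn_sq (s o); move: (sgn (s o)) => e ee.
  have -> : (X n w r j + e * V n j) * (X n w r k + e * V n k) =
    X n w r j * X n w r k + (e * (X n w r j * V n k + V n j * X n w r k) + e * e * (V n j * V n k)) by ring.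
  by rewrite ee mul1r.
ring.
Qed.

Lemma card_B_neq0 : #|B|%:R != 0 :> R.
Proof.
rewrite pnatr_eq0 -lt0n; apply/card_gt0P; by exists (b o0).
Qed.

Lemma Ex_sum_sq_row n : E n (fun w => \sum_r rsq (X n w r)) = \sum_(i < n) rsq (V i).
Proof.
elim: n => [|n IH].
  rewrite big_ord0 /= big1 // => r _; rewrite /rsq big1 // => j _.
  by rewrite /X /sk big_ord0 expr0n.
rewrite ExS big_ord_recr /= -IH -[rsq (V n)](Ex_cst o0 pr1 n) -ExD.
apply: eq_Ex => w.
under eq_bigr => o _ do rewrite sum_sq_row mulrDr mulrDr.
rewrite !big_split /= -!mulr_suml pr1 !mul1r; congr (_ + _).
rewrite (law1 (fun r t => 2 * sgn t * (\sum_j X n w r j * V n j))).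
rewrite big1 ?mulr0 ?add0r // => r _; rewrite /sgn; ring.
Qed.

(* a new column changes D by sgn * (x v^T + v x^T), whose conditional mean is 0, so the
   squared Frobenius norms of the increments add up *)
Lemma Ex_gram_error n :
  E n (fun w => \sum_j \sum_k D n w j k ^+ 2) <=
  4 / #|B|%:R * (\sum_(i < n) rsq (V i)) ^+ 2.
Proof.
elim: n => [|n IH].
  rewrite big_ord0 expr0n mulr0 /= big1 // => j _; rewrite big1 // => k _.
  rewrite /D big_ord0 big1 ?subr0 ?expr0n // => r _.
  by rewrite /X /sk big_ord0 mul0r.
have B0 : 0 < #|B|%:R :> R by rewrite lt0r card_B_neq0 ler0n.
rewrite ExS big_ord_recr /=.
have step w : \sum_o pr o * (\sum_j \sum_k D n.+1 (upd w n o) j k ^+ 2) <=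
  \sum_j \sum_k D n w j k ^+ 2 + 4 / #|B|%:R * rsq (V n) * \sum_r rsq (X n w r).
  pose f r t := \sum_j \sum_k (D n w j k + sgn t * (X n w r j * V n k + V n j * X n w r k)) ^+ 2.
  have -> : \sum_o pr o * (\sum_j \sum_k D n.+1 (upd w n o) j k ^+ 2) = \sum_o pr o * f (b o) (s o).
    apply: eq_bigr => o _; congr (_ * _); apply: eq_bigr => j _; apply: eq_bigr => k _.
    by rewrite D_upd.
  rewrite law1.
  (* Averaging over the sign removes the part linear in D; the rest is (xv + uy)^2 <= 2 x^2 v^2 + 2
     u^2 y^2, whose sum over j and k is 4 |V n|^2 |X_r|^2. *)
  have hf r : (f r true + f r false) / 2 <= \sum_j \sum_k D n w j k ^+ 2 + 4 * rsq (V n) * rsq (X n w r).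
    have -> : 4 * rsq (V n) * rsq (X n w r) =
      \sum_j \sum_k (2 * (X n w r j ^+ 2 * V n k ^+ 2) + 2 * (V n j ^+ 2 * X n w r k ^+ 2)).
      under eq_bigr => j _ do rewrite big_split /= -!mulr_sumr.
      rewrite big_split /= -!mulr_sumr -!mulr_suml -/(rsq _) -/(rsq _); ring.
    rewrite /f -!big_split /= mulr_suml; apply: ler_sum => j _.
    rewrite -!big_split /= mulr_suml; apply: ler_sum => k _.
    rewrite /sgn; move: (D n w j k) (X n w r j) (X n w r k) (V n j) (V n k) => d x y u v.
    rewrite -subr_ge0; have -> : d ^+ 2 + (2 * (x ^+ 2 * v ^+ 2) + 2 * (u ^+ 2 * y ^+ 2)) -
      ((d + 1 * (x * v + u * y)) ^+ 2 + (d + -1 * (x * v + u * y)) ^+ 2) / 2 = (x * v - u * y) ^+ 2 by field.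
    exact: sqr_ge0.
  apply: (@le_trans _ _ (#|B|%:R^-1 * \sum_r (\sum_j \sum_k D n w j k ^+ 2 + 4 * rsq (V n) * rsq (X n w r)))).
    apply: ler_wpM2l; first by rewrite invr_ge0 ltW.
    exact: ler_sum.
  rewrite big_split /= sumr_const -mulr_sumr le_eqVlt; apply/orP; left; apply/eqP.
  by move: (\sum_j _) (\sum_r _) => u v; rewrite -mulr_natl; field; exact: card_B_neq0.
apply: le_trans (le_Ex _ _ _ step) _ => //.
rewrite ExD ExZ Ex_sum_sq_row.
have S0 : 0 <= \sum_(i < n) rsq (V i) by apply: sumr_ge0 => i _; exact: rsq_ge0.
have v0 := rsq_ge0 (V n).
move: IH; move: (E n _) (\sum_(i < n) _) (rsq (V n)) S0 v0 => e S v S0 v0 IH.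
have a0 : 0 <= 4 / #|B|%:R :> R by rewrite divr_ge0 // ltW.
move: (4 / _) a0 IH => a a0 IH.
have : 0 <= a * (S * v) by rewrite mulr_ge0 // mulr_ge0.
have : 0 <= a * (v * v) by rewrite mulr_ge0 // mulr_ge0.
have -> : a * (S + v) ^+ 2 = a * S ^+ 2 + 2 * (a * (S * v)) + a * (v * v) by ring.
have -> : a * v * S = a * (S * v) by ring.
move=> h1 h2; lra.
Qed.

End EuclideanEmbedding.
End Sketch.

(** * Row loads, a concave potential, and anticoncentration by random signs *)

Section HeavySketch.
Context {R : realType} {O : finType} (o0 : O) (pr : O -> R).
Hypothesis pr0 : forall o, 0 <= pr o.
Hypothesis pr1 : \sum_o pr o = 1.
Context {B L : finType} (q : L -> R) (b : O -> B) (s : O -> bool) (l : O -> L).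
Hypothesis law : sketch_law pr q b s l.
Hypotheses (q0 : forall t, 0 <= q t) (qs : \sum_t q t = 1).
Local Notation E := (Ex o0 pr).
Local Notation T := (sk b s l).

Lemma invB_gt0 : 0 < #|B|%:R^-1 :> R.
Proof. by rewrite invr_gt0 lt0r (card_B_neq0 o0 b) ler0n. Qed.

Lemma sum_invB (x : R) : #|B|%:R^-1 * (\sum_(r : B) x) = x.
Proof. by rewrite sumr_const -(mulr_natl x) mulrA mulVf ?mul1r // (card_B_neq0 o0 b). Qed.

Lemma sum_q_cst x : \sum_t q t * x = x.
Proof. by rewrite -mulr_suml qs mul1r. Qed.

Lemma law_le (f : B -> bool -> L -> R) (g : B -> L -> R) :
  (forall r t, (f r true t + f r false t) / 2 <= g r t) ->
  \sum_o pr o * f (b o) (s o) (l o) <= #|B|%:R^-1 * \sum_r \sum_t q t * g r t.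
Proof.
move=> h; rewrite law; apply: ler_wpM2l; first exact: ltW invB_gt0.
by apply: ler_sum => r _; apply: ler_sum => t _; apply: ler_wpM2l.
Qed.

Definition load n (h : nat -> R) (w : nat -> O) r := \sum_(i < n) if b (w i) == r then h i else 0.

(** The diagonal contributes the sum of h^2 <= h, and two different columns share a row with
    probability 1/|B|. *)
Lemma Ex_load n (h : nat -> R) : (forall i, 0 <= h i <= 1) ->
  E n (fun w => \sum_r load n h w r ^+ 2) <=
  \sum_(i < n) h i + 2 / #|B|%:R * (\sum_(i < n) h i) ^+ 2.
Proof.
move=> h01; have hB := invB_gt0; elim: n => [|n IH].
  rewrite big_ord0 expr0n mulr0 addr0 /= big1 // => r _.
  by rewrite /load big_ord0 expr0n.
rewrite ExS big_ord_recr /=.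
have tot w : \sum_r load n h w r = \sum_(i < n) h i.
  rewrite /load exchange_big /=; apply: eq_bigr => i _; exact: (sum_pick (fun=> h i)).
have step w : \sum_o pr o * (\sum_r load n.+1 h (upd w n o) r ^+ 2) <=
    \sum_r load n h w r ^+ 2 + (2 / #|B|%:R * h n * (\sum_(i < n) h i) + h n).
  have e o : \sum_r load n.+1 h (upd w n o) r ^+ 2 =
      \sum_r load n h w r ^+ 2 + (2 * h n * load n h w (b o) + h n ^+ 2).
    rewrite -(sum_pick (fun r => 2 * h n * load n h w r + h n ^+ 2)) -big_split /=.
    apply: eq_bigr => r _.
    rewrite /load (sum_upd (fun i o => if b o == r then h i else 0)).
    by case: eqP => _; rewrite ?addr0 //; ring.
  under eq_bigr => o _ do rewrite e.
  set A := \sum_r load n h w r ^+ 2.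
  apply: le_trans (@law_le (fun r _ _ => A + (2 * h n * load n h w r + h n ^+ 2))
    (fun r _ => A + (2 * h n * load n h w r + h n)) _) _.
    move=> r _; have /andP[h0 h1] := h01 n; have : h n * h n <= 1 * h n by apply: ler_wpM2r.
    by rewrite expr2; lra.
  under eq_bigr => r _ do rewrite sum_q_cst.
  rewrite big_split /= mulrDr sum_invB lerD2l big_split /= -mulr_sumr tot mulrDr sum_invB lerD2r.
  by rewrite le_eqVlt; apply/orP; left; apply/eqP; ring.
apply: le_trans (le_Ex o0 pr0 n step) _; rewrite ExD Ex_cst //.
have S0 : 0 <= \sum_(i < n) h i by apply: sumr_ge0 => i _; case/andP: (h01 i).
have /andP[v0 _] := h01 n.
move: IH; move: (E n _) (\sum_(i < n) _) (h n) S0 v0 => e S v S0 v0 IH.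
have := ltW hB; move: (#|B|%:R^-1) IH => c IH c0.
have : 0 <= c * (S * v) by rewrite mulr_ge0 // mulr_ge0.
have : 0 <= c * (v * v) by rewrite mulr_ge0 // mulr_ge0.
have -> : 2 * c * (S + v) ^+ 2 = 2 * c * S ^+ 2 + 4 * (c * (S * v)) + 2 * (c * (v * v)) by ring.
have -> : 2 * c * v * S = 2 * (c * (S * v)) by ring.
move=> h1 h2; lra.
Qed.

Section Potential.
Context {J : finType} (V : nat -> J -> R) (th : nat -> L -> R) (a m2 : R).
Hypotheses (a0 : 0 < a) (a1 : a < 1) (m20 : 0 < m2).

Let X n w r j := T n th w (V^~ j) r.
(** Two bounds for the increase of u^a, u >= m2, under an increment d: subadditivity is better for
    large d, the slope at m2 for small d. *)
Definition gain (d : R) := Num.min (d `^ a) (m2 `^ (a - 1) * d).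

Lemma powR_gain u d : m2 <= u -> 0 <= d -> (u + d) `^ a <= u `^ a + gain d.
Proof.
move=> mu d0; rewrite -lerBlDl /gain le_min !lerBlDl.
have hm := m20; have u0 : 0 < u := lt_le_trans m20 mu.
have ha := a1; apply/andP; split; first by apply: powR_subadd => //; exact: ltW.
apply: le_trans (powR_subadd_slope (ltW a1) u0 d0) _.
rewrite lerD2l; apply: ler_wpM2r => //; apply: powR_le_neg => //; lra.
Qed.

(** Averaged over the sign of the new entry, concavity and the parallelogram law bound the changed
    row by (m2 + |x|^2 + |v|^2)^a: the cross term is gone, and the increase is at most a [gain] that
    does not depend on the past. *)
Lemma Ex_potential n :
  E n (fun w => \sum_r (m2 + rsq (X n w r)) `^ a) <=
  #|B|%:R * m2 `^ a + \sum_(i < n) \sum_t q t * gain (th i t ^+ 2 * rsq (V i)).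
Proof.
elim: n => [|n IH].
  rewrite big_ord0 addr0 /= (eq_bigr (fun=> m2 `^ a)) ?sumr_const ?mulr_natl // => r _.
  rewrite /rsq big1 ?addr0 // => j _; by rewrite /X /sk big_ord0 expr0n.
rewrite ExS big_ord_recr /= addrA.
have step w : \sum_o pr o * (\sum_r (m2 + rsq (X n.+1 (upd w n o) r)) `^ a) <=
    \sum_r (m2 + rsq (X n w r)) `^ a + \sum_t q t * gain (th n t ^+ 2 * rsq (V n)).
  pose P := \sum_r (m2 + rsq (X n w r)) `^ a.
  pose f r e t := P + ((m2 + rsq (fun j => X n w r j + sgn e * th n t * V n j)) `^ a -
                       (m2 + rsq (X n w r)) `^ a).
  have e o : \sum_r (m2 + rsq (X n.+1 (upd w n o) r)) `^ a = f (b o) (s o) (l o).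
    rewrite /f /P -(sum_pick (fun r => (m2 + rsq (fun j => X n w r j + sgn (s o) * th n (l o) * V n j)) `^ a -
                       (m2 + rsq (X n w r)) `^ a)) -big_split /=.
    apply: eq_bigr => r _.
    have -> : X n.+1 (upd w n o) r = fun j => X n w r j + (if b o == r then sgn (s o) * th n (l o) else 0) * V n j.
      by apply/funext => j; rewrite /X sk_upd /ent.
    case: eqP => _; first by rewrite addrCA subrr addr0.
    rewrite addr0; congr ((_ + rsq _) `^ _); apply/funext => j; by rewrite mul0r addr0.
  under eq_bigr => o _ do rewrite e.
  apply: le_trans (law_le (g := fun r t => P + gain (th n t ^+ 2 * rsq (V n))) _) _; last first.
    rewrite (eq_bigr (fun=> P + \sum_t q t * gain (th n t ^+ 2 * rsq (V n)))) ?sum_invB // => r _.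
    by under eq_bigr => t _ do rewrite mulrDr; rewrite big_split /= sum_q_cst.
  move=> r t; rewrite /f.
  have xr := rsq_ge0 (X n w r).
  have hm := m20.
  have d0 : 0 <= th n t ^+ 2 * rsq (V n) by rewrite mulr_ge0 ?sqr_ge0 ?rsq_ge0.
  have h1 := @powR_gain (m2 + rsq (X n w r)) _ _ d0.
  have {h1} : (m2 + rsq (X n w r) + th n t ^+ 2 * rsq (V n)) `^ a <=
     (m2 + rsq (X n w r)) `^ a + gain (th n t ^+ 2 * rsq (V n)) by apply: h1; lra.
  set xp := rsq (fun j => X n w r j + sgn true * _ * _).
  set xm := rsq (fun j => X n w r j + sgn false * _ * _).
  have xp0 : 0 <= xp by exact: rsq_ge0.
  have xm0 : 0 <= xm by exact: rsq_ge0.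
  have := @powR_midconcave _ a (m2 + xp) (m2 + xm) a0 a1.
  have -> : (m2 + xp + (m2 + xm)) / 2 = m2 + rsq (X n w r) + th n t ^+ 2 * rsq (V n).
    suff : xp + xm = 2 * (rsq (X n w r) + th n t ^+ 2 * rsq (V n)) by move=> h; lra.
    rewrite /xp /xm /rsq -big_split /= mulrDr !mulr_sumr -big_split /=.
    apply: eq_bigr => j _; rewrite /sgn; ring.
  move=> /(_ ltac:(lra) ltac:(lra)); lra.
apply: le_trans (le_Ex o0 pr0 n step) _; rewrite ExD Ex_cst // lerD2r; exact: IH.
Qed.

End Potential.

Section Anticoncentration.
Variables (y : nat -> R) (th : L -> R) (a : R) (m : nat).
Hypotheses (cardB : #|B| = (2 * m)%N).

(** The product over the rows is 2^(- number of rows of modulus at least a); its expectation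
    replaces a tail bound for that number. *)
Definition small (z : R) : R := if `|z| < a then 1 else 2^-1.
Definition hit i := \sum_t q t * (a <= `|th t * y i|)%R%:R.

Lemma small01 z : 0 <= small z <= 1.
Proof. by rewrite /small; case: ifP => _; rewrite ?ler01 ?lexx // invr_ge0 ler0n invf_le1 ?ler1n. Qed.

Lemma hit01 i : 0 <= hit i <= 1.
Proof.
apply/andP; split; first by apply: sumr_ge0 => t _; rewrite mulr_ge0 // ler0n.
rewrite -qs; apply: ler_sum => t _; rewrite -[leRHS]mulr1; apply: ler_wpM2l => //.
by rewrite lern1 leq_b1.
Qed.

(** The points z + e and z - e are at distance at least 2a, so at most one of them lies in the open
    interval (-a, a), and the other contributes 1/2. *)
Lemma small_avg z e : a <= `|e| -> (small (z + e) + small (z - e)) / 2 <= 3 / 4.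
Proof.
move=> ae; rewrite /small; case: ifP => h1; case: ifP => h2; try lra.
suff : `|e| < a by lra.
have -> : e = ((z + e) - (z - e)) / 2 by field.
rewrite normrM normfV normr_nat ltr_pdivrMr //; apply: le_lt_trans (ler_normB _ _) _; lra.
Qed.

Lemma prod_small01 (U : {set B}) Z : 0 <= \prod_(r in U) small (Z r) <= 1.
Proof.
apply/andP; split; first by apply: prodr_ge0 => r _; case/andP: (small01 (Z r)).
by apply: prodr_ile1 => r _; exact: small01.
Qed.

(* the bound is uniform in the offset Z, hence survives the removal of a column; a column
   that hits a row of U makes it large for one of its two signs, and the row is then
   dropped from U *)
Lemma Ex_prod_small n (U : {set B}) Z :
  E n (fun w => \prod_(r in U) small (Z r + T n (fun=> th) w y r)) <=
  \prod_(i < n) (1 - hit i / 8) + (3 / 4) ^+ #|U| * (4 / 3) ^+ m.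
Proof.
have P0 k : 0 <= \prod_(i < k) (1 - hit i / 8).
  apply: prodr_ge0 => i _; have := hit01 i; lra.
elim: n U Z => [|n IH] U Z.
  rewrite big_ord0 /=; have := (@prod_small01 U (fun r => Z r + T 0 (fun=> th) (fun=> o0) y r)).
  have : 0 <= (3 / 4) ^+ #|U| * (4 / 3) ^+ m :> R by rewrite mulr_ge0 ?exprn_ge0 //; lra.
  move=> h /andP[_ h']; lra.
(* For |U| <= m the second term of the bound is already at least 1. Otherwise U contains more than
   half of the rows and is hit with probability at least 1/2. *)
have [Um|mU] := leqP #|U| m.
  apply: (@le_trans _ _ 1).
    rewrite -[leRHS](Ex_cst o0 pr1 n.+1 1); apply: le_Ex => // w.
    by have /andP[_] := @prod_small01 U (fun r => Z r + T n.+1 (fun=> th) w y r).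
  apply: ler_wpDl; first exact: P0.
  rewrite -(subnKC Um) exprD mulrA -exprMn.
  have -> : 3 / 4 * (4 / 3) = 1 :> R by field.
  by rewrite expr1n mul1r; apply: exprn_ege1; lra.
set c := _ ^+ #|U| * _; rewrite [E n.+1 _]/= big_ord_recr /=.
set P := \prod_(i < n) _ in P0 *; have {}P0 : 0 <= P := P0 n.
pose f r e t := E n (fun w => \prod_(r' in U)
  small (Z r' + (if r == r' then sgn e * th t else 0) * y n + T n (fun=> th) w y r')).
have -> : \sum_o pr o * E n (fun w => \prod_(r in U) small (Z r + T n.+1 (fun=> th) (upd w n o) y r)) =
  \sum_o pr o * f (b o) (s o) (l o).
  apply: eq_bigr => o _; congr (_ * _); apply: eq_Ex => w; apply: eq_bigr => r _.
  by rewrite sk_upd /ent addrAC addrA.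
have fU r e t : f r e t <= P + c by exact: IH.
apply: le_trans (law_le (g := fun r t => P + c - P / 4 * ((r \in U)%:R * (a <= `|th t * y n|)%R%:R)) _) _.
  move=> r t; have h1 := fU r true t; have h2 := fU r false t.
  have [rU|rU] := boolP (r \in U); last by rewrite mul0r mulr0 subr0; lra.
  have [ah|ah] := boolP (a <= `|th t * y n|); last by rewrite mulr0 mulr0 subr0; lra.
  rewrite !mulr1; pose g w := \prod_(r' in U :\ r) small (Z r' + T n (fun=> th) w y r').
  (* Dropping r from U multiplies c by 4/3, which the factor 3/4 of [small_avg] cancels: 3/4 (P +
     4/3 c) = P + c - P/4. *)
  have hg : E n g <= P + c * (4 / 3).
    apply: le_trans (IH _ _) _; rewrite lerD2l le_eqVlt; apply/orP; left; apply/eqP.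
    by rewrite /c (cardsD1 r U) rU exprS; field.
  apply: (@le_trans _ _ (3 / 4 * E n g)); last lra.
  rewrite mulrC /f -ExD -!ExZ; apply: le_Ex => // w.
  have e e : \prod_(r' in U) small (Z r' + (if r == r' then sgn e * th t else 0) * y n + T n (fun=> th) w y r') =
    small ((Z r + T n (fun=> th) w y r) + sgn e * (th t * y n)) * g w.
    rewrite (big_setD1 r) //= eqxx; congr (_ * _).
      by congr small; ring.
    apply: eq_bigr => r'; rewrite !inE => /andP[nr _].
    by rewrite eq_sym (negPf nr) mul0r addr0.
  rewrite !e /sgn mul1r mulN1r -mulrDl mulrA; apply: ler_wpM2r.
    by have /andP[] := @prod_small01 (U :\ r) (fun r => Z r + T n (fun=> th) w y r).
  by rewrite mulrC; exact: small_avg.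
rewrite (eq_bigr (fun r => P + c - (r \in U)%:R * (P / 4 * hit n))); last first.
  move=> r _; under eq_bigr => t _ do rewrite mulrBr.
  rewrite sumrB sum_q_cst; congr (_ - _); rewrite /hit !mulr_sumr; apply: eq_bigr => t _; ring.
have cU : \sum_r (r \in U)%:R = #|U|%:R :> R.
  rewrite -sum1_card natr_sum [RHS]big_mkcond; apply: eq_bigr => r _; by case: (r \in U).
rewrite sumrB mulrBr sum_invB -mulr_suml cU mulrA.
(* A saving of P/4 with probability at least hit/2 gives the factor 1 - hit/8. *)
have hv : 2^-1 <= #|B|%:R^-1 * #|U|%:R :> R.
  have cB : 0 < #|B|%:R :> R by rewrite -invr_gt0 invB_gt0.
  rewrite ler_pdivlMl // cardB natrM mulrAC mulfV ?pnatr_eq0 // mul1r ler_nat; exact: ltnW.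
have := hit01 n; move: (_^-1 * _) hv (hit n) => v hv h /andP[h0 _].
have : 0 <= P * h * (v - 2^-1) by rewrite !mulr_ge0 // subr_ge0.
have -> : P * h * (v - 2^-1) = v * (P / 4 * h) * 4 - P * h / 2 by field.
move=> k; have -> : P * (1 - h / 8) = P - P * h / 8 by ring.
lra.
Qed.

End Anticoncentration.

End HeavySketch.

(** * Dyadic level sums and the law of the entries of the second sketch *)

Section Levels.
Context {R : realType}.
Implicit Types (v s T V be : R).

Lemma sum_half N : \sum_(k < N) (2 ^+ k.+1)^-1 = 1 - (2 ^+ N)^-1 :> R.
Proof.
elim: N => [|N IH]; first by rewrite big_ord0 expr0 invr1 subrr.
by rewrite big_ord_recr /= IH exprS invfM; move: (2 ^+ N)^-1 => x; field.
Qed.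

Lemma sum_half_le1 N : \sum_(k < N) (2 ^+ k.+1)^-1 <= 1 :> R.
Proof. by rewrite sum_half gerBl invr_ge0 exprn_ge0. Qed.

Lemma sum_half_pred_recl N (P : pred R) s :
  \sum_(k < N.+1) (2 ^+ k.+1)^-1 * (P (2 ^+ k * s))%:R =
  2^-1 * (P s)%:R + 2^-1 * \sum_(k < N) (2 ^+ k.+1)^-1 * (P (2 ^+ k * (2 * s)))%:R :> R.
Proof.
rewrite big_ord_recl /= expr0 mul1r expr1; congr (_ + _).
rewrite mulr_sumr; apply: eq_bigr => k _; rewrite /bump leq0n add1n.
have -> : 2 ^+ k.+1 * s = 2 ^+ k * (2 * s) by rewrite exprS; ring.
by rewrite [2 ^+ k.+2]exprS invfM -mulrA.
Qed.

Lemma level_tail N s T : 0 <= s -> 0 < T ->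
  \sum_(k < N) (2 ^+ k.+1)^-1 * (T < 2 ^+ k * s)%R%:R <= s / T.
Proof.
move=> s0 T0; elim: N s s0 => [|N IH] s s0; first by rewrite big_ord0 divr_ge0 // ltW.
have [h|h] := ltP T s.
  apply: (@le_trans _ _ 1); last by rewrite ler_pdivlMr // mul1r ltW.
  apply: le_trans (sum_half_le1 N.+1); apply: ler_sum => k _.
  by rewrite -[leRHS]mulr1; apply: ler_wpM2l; rewrite ?invr_ge0 ?exprn_ge0 // lern1 leq_b1.
rewrite (sum_half_pred_recl N (fun x => T < x)) ltNge h mulr0 add0r.
have s20 : 0 <= 2 * s by lra.
have := IH _ s20; rewrite -(mulrA 2); move: (s / T) (\sum_(k < N) _) => x y h2; lra.
Qed.

(** The levels k with 2^k >= 1/v have total weight of order v; the lower bound on v ensures that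
    level M is one of them. The cap 1/2 is the weight of level 0. *)
Lemma level_hit M v : (2 ^+ M)^-1 <= v ->
  Num.min (v / 4) 2^-1 <= \sum_(k < M.+1) (2 ^+ k.+1)^-1 * (1 <= 2 ^+ k * v)%R%:R.
Proof.
elim: M v => [|M IH] v hv.
  move: hv; rewrite expr0 invr1 big_ord_recl big_ord0 expr0 mul1r expr1 addr0 => ->.
  by rewrite mulr1 ge_min lexx orbT.
rewrite (sum_half_pred_recl M.+1 (fun x => 1 <= x)).
have [h|h] := leP 1 v.
  rewrite ge_min mulr1; apply/orP; right; rewrite lerDl; apply: mulr_ge0; first by rewrite invr_ge0.
  by apply: sumr_ge0 => k _; rewrite mulr_ge0 ?invr_ge0 ?exprn_ge0.
have hv2 : (2 ^+ M)^-1 <= 2 * v.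
  by move: hv; rewrite exprS invfM ler_pdivrMl.
have := IH _ hv2; rewrite mulr0 add0r; move: (\sum_(k < M.+1) _) => S.
rewrite /Num.min; case: ifP => h1; case: ifP => h2; lra.
Qed.

(** A geometric series of ratio Q = 2^be is at most its next term over Q - 1. The minimum with Q
    keeps the bound inductive once the levels exceed 1 and terms stop being added. *)
Lemma sum_levels_low N v be : 0 < v -> 0 < be ->
  \sum_(k < N) (if 2 ^+ k * v <= 1 then (2 ^+ k * v) `^ be else 0) <=
  (2 `^ be - 1)^-1 * Num.min (2 `^ be) ((2 ^+ N * v) `^ be).
Proof.
move=> v0 be0; set Q := 2 `^ be.
have Q1 : 1 < Q.
  by rewrite -(powRr0 2); rewrite /Q /powR pnatr_eq0 /= ltr_expR mul0r mulr_gt0 ?ln_gt0 ?ltr1n.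
have Q10 : 0 < (Q - 1)^-1 by rewrite invr_gt0 subr_gt0.
elim: N => [|N IH].
  by rewrite big_ord0 mulr_ge0 // ?ltW // lt_min !powR_gt0 // mulr_gt0 ?exprn_gt0.
have x0 : 0 < 2 ^+ N * v by rewrite mulr_gt0 // exprn_gt0.
have eN : (2 ^+ N.+1 * v) `^ be = Q * (2 ^+ N * v) `^ be.
  by rewrite exprS -mulrA powRM // ltW.
rewrite big_ord_recr /= eN; move: (\sum_(k < N) _) IH => S; case: ifP => h IH.
  have y1 : (2 ^+ N * v) `^ be <= 1.
    have o : 1 `^ be = 1 :> R by rewrite powR1.
    by rewrite -[leRHS]o; apply: ge0_ler_powR; rewrite ?nnegrE // ltW.
  move: ((2 ^+ N * v) `^ be) y1 IH (powR_ge0 (2 ^+ N * v) be) => y y1 IH y0.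
  have -> : Num.min Q (Q * y) = Q * y.
    by apply/min_idPr; rewrite ler_piMr // ltW // (lt_trans ltr01).
  apply: (@le_trans _ _ ((Q - 1)^-1 * y + y)).
    rewrite lerD2r; apply: le_trans IH _; apply: ler_wpM2l; first exact: ltW.
    by rewrite ge_min lexx orbT.
  by rewrite le_eqVlt; apply/orP; left; apply/eqP; field; rewrite gt_eqF // subr_gt0.
rewrite addr0; apply: le_trans IH _; apply: ler_wpM2l; first exact: ltW.
have y0 := powR_ge0 (2 ^+ N * v) be.
rewrite le_min !ge_min lexx /=; apply/orP; right; rewrite ler_peMl // ltW //.
Qed.

(** Every counted level doubles the clamped quantity inside the logarithm, which never exceeds
    2V. *)
Lemma sum_levels_high N v V : 0 < v -> 1 <= V ->
  (\sum_(k < N) ((1 < 2 ^+ k * v) && (2 ^+ k * v <= V))%R%:R) * ln 2 <=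
  ln (Num.min (Num.max (2 ^+ N * v) 1) (2 * V)) :> R.
Proof.
move=> v0 V1; have c1 x : 1 <= Num.min (Num.max x 1) (2 * V).
  by rewrite le_min le_max lexx orbT /=; lra.
elim: N => [|N IH]; first by rewrite big_ord0 mul0r ln_ge0.
rewrite big_ord_recr /= mulrDl exprS -mulrA.
set x := 2 ^+ N * v in IH *; have x0 : 0 < x by rewrite mulr_gt0 // exprn_gt0.
have c0 y : 0 < Num.min (Num.max y 1) (2 * V) by exact: lt_le_trans ltr01 (c1 _).
case: andP => [[h1 h2]|_] /=; last first.
  rewrite mul0r addr0; apply: le_trans IH _; rewrite ler_ln ?posrE //.
  rewrite le_min !ge_min lexx orbT andbT ge_max !le_max lexx orbT.
  by have -> : x <= 2 * x by lra.
rewrite mul1r.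
have e1 : Num.min (Num.max (2 * x) 1) (2 * V) = 2 * x.
  by rewrite max_l ?min_l //; lra.
have e2 : Num.min (Num.max x 1) (2 * V) = x.
  by rewrite max_l ?min_l //; lra.
rewrite e1 lnM ?posrE // addrC lerD2l.
by move: IH; rewrite e2.
Qed.

Lemma sum_levels N v V be : 0 < v -> 1 <= V -> 0 < be ->
  \sum_(k < N) (2 ^+ k * v <= V)%R%:R * Num.min 1 ((2 ^+ k * v) `^ be) <=
  2 `^ be / (2 `^ be - 1) + ln (2 * V) / ln 2.
Proof.
move=> v0 V1 be0.
have l2 : 0 < ln 2 :> R by rewrite ln_gt0 // ltr1n.
have Q1 : 1 < 2 `^ be :> R.
  by rewrite /powR pnatr_eq0 /= expR_gt1 mulr_gt0.
apply: (@le_trans _ _ (\sum_(k < N) ((if 2 ^+ k * v <= 1 then (2 ^+ k * v) `^ be else 0) +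
   ((1 < 2 ^+ k * v) && (2 ^+ k * v <= V))%R%:R))).
  apply: ler_sum => k _; have [h|h] := leP (2 ^+ k * v) 1.
    rewrite addr0 -[leRHS]mul1r; apply: ler_pM => //.
    - by rewrite le_min ler01 powR_ge0.
    - by rewrite lern1 leq_b1.
    - by rewrite ge_min lexx orbT.
  rewrite add0r /= -[leRHS]mulr1; apply: ler_wpM2l => //.
  by rewrite ge_min lexx.
rewrite big_split /=; apply: lerD.
  apply: le_trans (sum_levels_low N v0 be0) _; rewrite mulrC; apply: ler_wpM2r.
    by rewrite invr_ge0 subr_ge0 ltW.
  by rewrite ge_min lexx.
rewrite ler_pdivlMr //; apply: le_trans (sum_levels_high N v0 V1) _.
rewrite ler_ln ?posrE; first by rewrite ge_min lexx orbT.
  by rewrite lt_min lt_max ltr01 orbT /=; lra.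
lra.
Qed.

Section Distribution.
Context (p eps : R) (N : nat).
Hypotheses (p1 : 1 <= p) (p2 : p < 2) (e0 : 0 < eps) (e1 : eps <= 1).

Definition level := option 'I_N.
(** The geometric law is cut after N levels, and the missing mass eps 2^-N is given to the inactive
    column [None]. *)
Definition levelp (t : level) : R :=
  if t is Some k then eps * (2 ^+ k.+1)^-1 else 1 - eps * (1 - (2 ^+ N)^-1).
Definition levelv (t : level) : R := if t is Some k then (2 ^+ k) `^ p^-1 else 0.

Lemma sum_level (F : level -> R) : \sum_t F t = F None + \sum_k F (Some k).
Proof.
rewrite (bigD1 None) //=; congr (_ + _).
rewrite (reindex_omap Some id) /=; last by case.
by apply: eq_bigl => k; rewrite eqxx.
Qed.

Lemma sum_levelp : \sum_t levelp t = 1.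
Proof. by rewrite sum_level /= -mulr_sumr sum_half subrK. Qed.

Lemma levelp_ge0 t : 0 <= levelp t.
Proof.
case: t => [k|] /=; first by rewrite mulr_ge0 ?ltW // invr_gt0 exprn_gt0.
rewrite subr_ge0 -[leRHS]mulr1; apply: ler_pM => //; first exact: ltW.
  by rewrite subr_ge0 invf_le1 ?exprn_gt0 // exprn_ege1 // ler1n.
by rewrite gerBl invr_ge0 exprn_ge0.
Qed.

Lemma levelp_active : \sum_k levelp (Some k) <= eps.
Proof.
rewrite /= -mulr_sumr -[leRHS]mulr1; apply: ler_wpM2l; [exact: ltW|exact: sum_half_le1].
Qed.

Lemma levelv_ge0 t : 0 <= levelv t.
Proof. by case: t => [k|] //=; exact: powR_ge0. Qed.

Lemma levelv_gt0 k : 0 < levelv (Some k).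
Proof. by apply: powR_gt0; rewrite exprn_gt0. Qed.

Let p0 : 0 < p. Proof. exact: lt_le_trans ltr01 p1. Qed.

Lemma levelvp k : levelv (Some k) `^ p = 2 ^+ k.
Proof. by rewrite /= -powRrM mulVf ?gt_eqF // powRr1 // exprn_ge0. Qed.

Lemma levelv0p : levelv None `^ p = 0.
Proof. by rewrite /= powR0 // gt_eqF. Qed.

Lemma levelp_tail s T : 0 <= s -> 0 < T ->
  \sum_t levelp t * (T < levelv t `^ p * s)%R%:R <= s / T.
Proof.
move=> s0 T0; rewrite sum_level levelv0p mul0r ltNge (ltW T0) mulr0 add0r.
apply: le_trans (level_tail N s0 T0); apply: ler_sum => k _; rewrite levelvp.
apply: ler_wpM2r => //; rewrite -[leRHS]mul1r; apply: ler_wpM2r => //.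
by rewrite invr_ge0 exprn_ge0.
Qed.

Lemma levelp_hit K a y : (0 < N)%N -> 0 < K -> 0 <= a -> a `^ p = K^-1 ->
  (2 ^+ N.-1)^-1 <= K * `|y| `^ p <= 1 ->
  eps / 4 * (K * `|y| `^ p) <= \sum_t levelp t * (a <= `|levelv t * y|)%R%:R.
Proof.
move=> N0 K0 a0 aK /andP[h1 h2]; rewrite sum_level.
apply: (@le_trans _ _ (\sum_k levelp (Some k) * (a <= `|levelv (Some k) * y|)%R%:R)); last first.
  by rewrite lerDr mulr_ge0 // levelp_ge0.
have e k : (a <= `|levelv (Some k) * y|) = (1 <= 2 ^+ k * (K * `|y| `^ p)).
  have -> : 2 ^+ k * (K * `|y| `^ p) = `|levelv (Some k) * y| `^ p / (a `^ p).
    by rewrite aK invrK powR_normM (ger0_norm (levelv_ge0 _)) levelvp; ring.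
  rewrite ler_pdivlMr; last by rewrite aK invr_gt0.
  rewrite mul1r; apply/idP/idP => h.
    by apply: ge0_ler_powR; rewrite ?nnegrE // ltW.
  rewrite leNgt; apply/negP => h'.
  have := gt0_ltr_powR p0; move=> /(_ `|levelv (Some k) * y| a).
  by rewrite !nnegrE normr_ge0 a0 => /(_ isT isT h'); rewrite ltNge h.
have := level_hit h1; rewrite prednK // min_l; last by move: (K * _) h2 => u; lra.
move=> h; have := ler_wpM2l (ltW e0) h; rewrite mulr_sumr.
have -> : eps * (K * `|y| `^ p / 4) = eps / 4 * (K * `|y| `^ p) by ring.
move=> {}h; apply: le_trans h _; rewrite le_eqVlt; apply/orP; left; apply/eqP.
by apply: eq_bigr => k _; rewrite e -mulrA.
Qed.

(* expected increment, in the potential of scale m, caused by a column of p-mass s *)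
Lemma levelp_gain m V x : 0 < m -> 1 <= V -> 0 <= x ->
  \sum_t levelp t * gain (p / 2) (m `^ (2 / p))
     ((if levelv t `^ p * x `^ (p / 2) <= m * V then levelv t else 0) ^+ 2 * x) <=
  x `^ (p / 2) * (2 `^ (2 / p - 1) / (2 `^ (2 / p - 1) - 1) + ln (2 * V) / ln 2).
Proof.
move=> m0 V1 x0; set be := 2 / p - 1; set C := _ + _.
have hp := p0; have hp2 := p2.
have ph : 0 < p / 2 by rewrite divr_gt0.
have be0 : 0 < be by rewrite subr_gt0 ltr_pdivlMr // mul1r.
have g0 : gain (p / 2) (m `^ (2 / p)) (0 : R) = 0.
  by rewrite /gain mulr0 powR0 ?minxx // gt_eqF.
move: x0; rewrite le_eqVlt => /predU1P[<-|x0].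
  by rewrite big1 => [|t _]; rewrite ?mulr0 ?g0 ?mulr0 // powR0 ?mul0r // gt_eqF.
set s := x `^ (p / 2); have s0 : 0 < s by exact: powR_gt0.
rewrite sum_level {1}/levelv if_same expr0n mul0r g0 mulr0 add0r.
(* With u = 2^k s / m the gain is m u min(1, u^be). The weight of the level cancels the 2^k in u, so
   each level costs at most s min(1, u^be), where m has disappeared from the prefactor. *)
apply: (@le_trans _ _ (\sum_(k < N) s * ((2 ^+ k * (s / m) <= V)%R%:R * Num.min 1 ((2 ^+ k * (s / m)) `^ be)))); last first.
  rewrite -mulr_sumr; apply: ler_wpM2l; first exact: ltW.
  by apply: sum_levels => //; rewrite divr_gt0.
apply: ler_sum => k _; rewrite levelvp.
have -> : (2 ^+ k * s <= m * V) = (2 ^+ k * (s / m) <= V) by rewrite mulrA ler_pdivrMr // [m * V]mulrC.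
case: ifP => h; last by rewrite expr0n mul0r g0 mulr0 mul0r mulr0.
rewrite mul1r; set u := 2 ^+ k * (s / m).
have k0 : 0 < 2 ^+ k :> R by rewrite exprn_gt0.
have u0 : 0 < u by rewrite mulr_gt0 // divr_gt0.
have lv0 := levelv_gt0 k.
have ed : (levelv (Some k) ^+ 2 * x) `^ (p / 2) = m * u.
  rewrite powRM ?sqr_ge0 ?ltW // sqr_powR_half gtr0_norm // levelvp -/s /u.
  by rewrite mulrCA; congr (_ * _); rewrite mulrC divfK // gt_eqF.
have ed2 : levelv (Some k) ^+ 2 * x = (m * u) `^ (2 / p).
  rewrite -ed -powRrM -[p / 2 * _]/(p / 2 * (2 / p)).
  have -> : p / 2 * (2 / p) = 1 by field; rewrite gt_eqF.
  by rewrite powRr1 // mulr_ge0 ?sqr_ge0 // ltW.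
have -> : gain (p / 2) (m `^ (2 / p)) (levelv (Some k) ^+ 2 * x) = m * u * Num.min 1 (u `^ be).
  rewrite /gain ed ed2 minr_pMr ?mulr1; last by rewrite mulr_ge0 ?ltW.
  congr Num.min; rewrite -powRrM powRM ?ltW // mulrA -powRD; last by rewrite (gt_eqF m0) implybT.
  have -> : 2 / p * (p / 2 - 1) + 2 / p = 1 by field; rewrite gt_eqF.
  rewrite powRr1 ?ltW // -mulrA; congr (_ * _).
  by rewrite (powRS _ u0).
have -> : s * Num.min 1 (u `^ be) = (2 ^+ k)^-1 * (m * u * Num.min 1 (u `^ be)).
  by rewrite mulrA; congr (_ * _); rewrite /u; field; rewrite !gt_eqF.
apply: ler_wpM2r.
  by rewrite mulr_ge0 ?le_min ?ler01 ?powR_ge0 // mulr_ge0 ?ltW.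
rewrite /= exprS invfM mulrA -[leRHS]mul1r; apply: ler_wpM2r; first by rewrite invr_ge0 ltW.
have := e1; have := e0; lra.
Qed.

End Distribution.
End Levels.

(** * Combinations of basis columns; comparison of p-mass with Euclidean mass *)

Section Combination.
Context {R : realType}.

Definition lin {J : finType} (U : nat -> J -> R) (z : J -> R) i := \sum_j z j * U i j.

Definition pmass p n (y : nat -> R) := \sum_(i < n) `|y i| `^ p.

Lemma pmass_ge0 p n y : 0 <= pmass p n y.
Proof. by apply: sumr_ge0 => i _; exact: powR_ge0. Qed.

Lemma lewis_combination (p : R) n d (A : nat -> nat -> R) : 1 <= p -> p <= 2 ->
  exists k (U : nat -> 'I_k -> R), [/\ (k <= d)%N,
    forall x : nat -> R, exists z, forall i, (i < n)%N -> \sum_(j < d) A i j * x j = lin U z i,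
    forall z, rsq z `^ (p / 2) <= pmass p n (lin U z) &
    \sum_(i < n) rsq (U i) `^ (p / 2) <= 9 * d%:R].
Proof.
move=> p1 p2; have [k [U [kd hA hz hU]]] := lewis_basis p1 p2 (\matrix_(i < n, j < d) A i j).
pose U' (i : nat) (j : 'I_k) : R := if insub i is Some i' then U i' j else 0.
have eU (i : 'I_n) : U' i = U i by apply/funext => j; rewrite /U' valK.
exists k, U'; split => //.
- move=> x; have [z hx] := hA (\col_j x j).
  exists (fun j => z j 0) => i hi.
  move/matrixP: hx => /(_ (Ordinal hi) 0); rewrite !mxE => e.
  transitivity (\sum_j (\matrix_(i < n, j < d) A i j) (Ordinal hi) j * (\col_j x j) j 0).
    by apply: eq_bigr => j _; rewrite !mxE.
  rewrite e; apply: eq_bigr => j _; rewrite mulrC; congr (_ * _).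
  by rewrite -(eU (Ordinal hi)).
- move=> z; have := hz (\col_j z j).
  have -> : \sum_j (\col_j z j) j 0 ^+ 2 = rsq z by apply: eq_bigr => j _; rewrite mxE.
  move=> h; apply: le_trans h _; rewrite le_eqVlt; apply/orP; left; apply/eqP.
  apply: eq_bigr => i _; congr (`| _ | `^ _); rewrite mxE; apply: eq_bigr => j _.
  by rewrite mxE mulrC -eU.
- apply: (@le_trans _ _ (9 * k%:R)); last by apply: ler_wpM2l => //; rewrite ler_nat.
  apply: le_trans _ hU; rewrite le_eqVlt; apply/orP; left; apply/eqP.
  by apply: eq_bigr => i _; rewrite eU.
Qed.

Lemma lin_sq_le {J : finType} (U : nat -> J -> R) z i : lin U z i ^+ 2 <= rsq z * rsq (U i).
Proof. exact: cauchy_schwarz_sum. Qed.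

Lemma lin_powR_le {J : finType} p (U : nat -> J -> R) z i : 0 <= p ->
  `|lin U z i| `^ p <= rsq z `^ (p / 2) * rsq (U i) `^ (p / 2).
Proof.
move=> p0; rewrite -powRM ?rsq_ge0 // -sqr_powR_half; apply: ge0_ler_powR.
- lra.
- by rewrite nnegrE sqr_ge0.
- by rewrite nnegrE mulr_ge0 ?rsq_ge0.
- exact: lin_sq_le.
Qed.

Lemma sqr_powRK p (x : R) : 0 < p -> x ^+ 2 = (`|x| `^ p) `^ (2 / p).
Proof.
move=> p0; rewrite -powRrM mulrC divfK ?gt_eqF //.
by rewrite (powR_mulrn 2) // real_normK // num_real.
Qed.

(** Since 2/p - 1 >= 0 the second factor is monotone in |x|; a threshold on |x|^p thus compares
    squares with p-th powers in either direction. *)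
Lemma sqr_powR_split p (x : R) : 0 < p ->
  x ^+ 2 = `|x| `^ p * (`|x| `^ p) `^ (2 / p - 1).
Proof.
move=> p0; have [->|x0] := eqVneq x 0.
  by rewrite normr0 powR0 ?gt_eqF // mul0r expr0n.
by rewrite (sqr_powRK x p0) -powRS // powR_gt0 // normr_gt0.
Qed.

Lemma sum_sq_le_pmass p n (P : pred nat) (y : nat -> R) c : 0 < p -> p <= 2 -> 0 <= c ->
  (forall i, (i < n)%N -> P i -> `|y i| `^ p <= c) ->
  \sum_(i < n | P i) y i ^+ 2 <= c `^ (2 / p - 1) * pmass p n y.
Proof.
move=> p0 p2 c0 h; have be0 : 0 <= 2 / p - 1 by rewrite subr_ge0 ler_pdivlMr // mul1r.
rewrite /pmass mulr_sumr big_mkcond; apply: ler_sum => i _; case: ifP => Pi.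
  rewrite (sqr_powR_split _ p0) mulrC; apply: ler_wpM2r; first exact: powR_ge0.
  by apply: ge0_ler_powR; rewrite ?nnegrE ?powR_ge0 // h.
by rewrite mulr_ge0 ?powR_ge0.
Qed.

Lemma sum_sq_ge_pmass p n (y : nat -> R) c : 0 < p -> p <= 2 -> 0 <= c ->
  c `^ (2 / p - 1) * (\sum_(i < n | c < `|y i| `^ p) `|y i| `^ p) <= \sum_(i < n) y i ^+ 2.
Proof.
move=> p0 p2 c0; have be0 : 0 <= 2 / p - 1 by rewrite subr_ge0 ler_pdivlMr // mul1r.
rewrite mulr_sumr [leLHS]big_mkcond; apply: ler_sum => i _; case: ifP => Pi; last exact: sqr_ge0.
rewrite (sqr_powR_split _ p0) mulrC; apply: ler_wpM2l; first exact: powR_ge0.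
by apply: ge0_ler_powR; rewrite ?nnegrE ?powR_ge0 // ltW.
Qed.

End Combination.

(** * Deterministic estimates for one outcome of a sketch *)

Section CountSketch.
Context {R : realType} {O B L : finType} (b : O -> B) (s : O -> bool) (l : O -> L).
Local Notation one := (fun (_ : nat) (_ : L) => 1 : R).

Definition gram_err {J : finType} n (V : nat -> J -> R) (w : nat -> O) : R :=
  \sum_j \sum_k (\sum_r sk b s l n one w (V^~ j) r * sk b s l n one w (V^~ k) r
     - \sum_(i < n) V i j * V i k) ^+ 2.

Lemma sk_lin {J : finType} n th w (U : nat -> J -> R) z r :
  sk b s l n th w (lin U z) r = \sum_j z j * sk b s l n th w (U^~ j) r.
Proof.
rewrite /sk; under [RHS]eq_bigr => j _ do rewrite mulr_sumr.
rewrite exchange_big /=; apply: eq_bigr => i _; rewrite /lin mulr_sumr.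
by apply: eq_bigr => j _; rewrite mulrCA.
Qed.

Lemma sum_lin_sq {J I : finType} (U : I -> J -> R) z :
  \sum_i (\sum_j z j * U i j) ^+ 2 = \sum_j \sum_k z j * z k * \sum_i U i j * U i k.
Proof.
transitivity (\sum_i \sum_j \sum_k z j * z k * (U i j * U i k)).
  apply: eq_bigr => i _; rewrite expr2 big_distrlr /=.
  by apply: eq_bigr => j _; apply: eq_bigr => k _; ring.
rewrite exchange_big; apply: eq_bigr => j _; rewrite exchange_big; apply: eq_bigr => k _.
by rewrite mulr_sumr.
Qed.

(** The error is the quadratic form of the Gram error matrix D at z, at most |z|^2 times the
    Frobenius norm of D, and |z|^2 is at most the Euclidean mass of V z. *)
Lemma euclidean_embedding {J : finType} n (V : nat -> J -> R) w z :
  gram_err n V w <= 2^-1 ^+ 2 -> rsq z <= \sum_(i < n) lin V z i ^+ 2 ->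
  `|\sum_r sk b s l n one w (lin V z) r ^+ 2 - \sum_(i < n) lin V z i ^+ 2| <=
  2^-1 * \sum_(i < n) lin V z i ^+ 2.
Proof.
move=> ge zV.
pose D j k := \sum_r sk b s l n one w (V^~ j) r * sk b s l n one w (V^~ k) r
     - \sum_(i < n) V i j * V i k.
have -> : \sum_r sk b s l n one w (lin V z) r ^+ 2 - \sum_(i < n) lin V z i ^+ 2 =
  \sum_(jk : J * J) (z jk.1 * z jk.2) * D jk.1 jk.2.
  under eq_bigr => r _ do rewrite sk_lin.
  rewrite sum_lin_sq (sum_lin_sq (fun (i : 'I_n) j => V i j)).
  rewrite -(pair_bigA _ (fun j k => z j * z k * D j k)) /=.
  rewrite -sumrB; apply: eq_bigr => j _; rewrite -sumrB; apply: eq_bigr => k _.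
  by rewrite mulrBr.
set X := \sum_(jk : J * J) _.
have h : X ^+ 2 <= (rsq z * 2^-1) ^+ 2.
  apply: le_trans (cauchy_schwarz_sum _ _ _) _; rewrite exprMn.
  rewrite -(pair_bigA _ (fun j k => (z j * z k) ^+ 2)) -(pair_bigA _ (fun j k => D j k ^+ 2)) /=.
  apply: ler_pM => //.
  - by apply: sumr_ge0 => j _; apply: sumr_ge0 => k _; exact: sqr_ge0.
  - by apply: sumr_ge0 => j _; apply: sumr_ge0 => k _; exact: sqr_ge0.
  rewrite expr2 /rsq big_distrlr /=.
  rewrite le_eqVlt; apply/orP; left; apply/eqP.
  by apply: eq_bigr => j _; apply: eq_bigr => k _; rewrite exprMn.
apply: (@le_trans _ _ (rsq z * 2^-1)).
  by rewrite -ler_sqr ?nnegrE // ?mulr_ge0 ?rsq_ge0 ?invr_ge0 // real_normK ?num_real.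
by rewrite mulrC; apply: ler_wpM2l => //; rewrite invr_ge0.
Qed.

Lemma sk_mask_sq n (h : nat -> bool) w y r :
  sk b s l n one w (fun i => if h i then y i else 0) r ^+ 2 <=
  load b n (fun i => (h i)%:R) w r * \sum_(i < n) (if b (w i) == r then y i ^+ 2 else 0).
Proof.
apply: le_trans (_ : _ <= (\sum_(i < n) (if b (w i) == r then (h i)%:R else 0) ^+ 2) *
   (\sum_(i < n) (if b (w i) == r then sgn (s (w i)) * y i else 0) ^+ 2)) _.
  apply: le_trans _ (cauchy_schwarz_sum _ _ _); rewrite le_eqVlt; apply/orP; left; apply/eqP.
  congr (_ ^+ 2); apply: eq_bigr => i _; rewrite /ent; case: ifP => _; rewrite ?mul0r // mulr1.
  by case: (h i); rewrite ?mul1r // mulr0 mul0r.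
rewrite le_eqVlt; apply/orP; left; apply/eqP; congr (_ * _); apply: eq_bigr => i _.
  by case: ifP => _; rewrite ?expr0n //; case: (h i); rewrite ?expr1n ?expr0n.
by case: ifP => _; rewrite ?expr0n // exprMn expr2 sgn_sq mul1r.
Qed.

Section Bounds.
Context (p : R) (n : nat).
Hypotheses (p1 : 1 <= p) (p2 : p < 2).

Definition rmass (f : B -> R) := \sum_r `|f r| `^ p.

Lemma rmassD f g : rmass (fun r => f r + g r) <= 4 * (rmass f + rmass g).
Proof.
have h1 := p1; have h2 := p2.
by rewrite /rmass -big_split mulr_sumr; apply: ler_sum => r _; apply: powR_normD; lra.
Qed.

Lemma rmass_sqE f : rmass f = \sum_r (f r ^+ 2) `^ (p / 2).
Proof. by apply: eq_bigr => r _; rewrite sqr_powR_half. Qed.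

(** Cauchy-Schwarz in a row loses the number of selected coordinates there, at most Q; subadditivity
    of t^(p/2) then distributes the remaining sum of squares. *)
Lemma rmass_heavy (h : nat -> bool) w y Q : 0 <= Q ->
  (forall r, load b n (fun i => (h i)%:R) w r <= Q) ->
  rmass (sk b s l n one w (fun i => if h i then y i else 0)) <= Q `^ (p / 2) * pmass p n y.
Proof.
have h1 := p1; have h2 := p2; move=> Q0 hQ.
have a0 : 0 < p / 2 by lra.
rewrite rmass_sqE.
apply: (@le_trans _ _ (\sum_r Q `^ (p / 2) * \sum_(i < n) (if b (w i) == r then `|y i| `^ p else 0))).
  apply: ler_sum => r _.
  have S0 : 0 <= \sum_(i < n) (if b (w i) == r then y i ^+ 2 else 0).
    by apply: sumr_ge0 => i _; case: ifP => _; rewrite ?sqr_ge0.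
  apply: (@le_trans _ _ ((Q * \sum_(i < n) (if b (w i) == r then y i ^+ 2 else 0)) `^ (p / 2))).
    apply: ge0_ler_powR; [exact: ltW|by rewrite nnegrE sqr_ge0|by rewrite nnegrE mulr_ge0|].
    by apply: le_trans (sk_mask_sq _ _ _ _ _) _; apply: ler_wpM2r.
  rewrite powRM //; apply: ler_wpM2l; first exact: powR_ge0.
  apply: le_trans (@powR_sum_le R _ (index_enum _) xpredT
    (fun i : 'I_n => if b (w i) == r then y i ^+ 2 else 0) (p / 2) a0 _ _) _.
  - lra.
  - by move=> i _; case: ifP => _; rewrite ?sqr_ge0.
  apply: ler_sum => i _; case: ifP => _; first by rewrite sqr_powR_half.
  by rewrite powR0 // gt_eqF.
rewrite -mulr_sumr exchange_big /=; apply: ler_wpM2l; first exact: powR_ge0.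
rewrite le_eqVlt; apply/orP; left; apply/eqP; apply: eq_bigr => i _.
exact: (sum_pick (fun=> `|y i| `^ p)).
Qed.

Lemma rmass_light (f : B -> R) c M : 0 < c -> 0 <= M -> (0 < #|B|)%N ->
  \sum_r f r ^+ 2 <= 3 / 2 * (c `^ (2 / p - 1) * M `^ (2 / p)) ->
  rmass f <= 5 / 2 * ((#|B|%:R * c) `^ (1 - p / 2) * M).
Proof.
have h1 := p1; have h2 := p2; have p0 : 0 < p by lra.
move=> c0 M0 B0 hf; have a0 : 0 < p / 2 by lra.
have b0 : 0 < #|B|%:R :> R by rewrite ltr0n.
move: M0; rewrite le_eqVlt => /predU1P[M0|M0].
  have f0 r : f r = 0.
    apply/eqP; rewrite -sqrf_eq0 eq_le sqr_ge0 andbT.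
    have : \sum_r f r ^+ 2 <= 0.
      by apply: le_trans hf _; rewrite -M0 [0 `^ _]powR0 ?mulr0 // mulf_neq0 // ?invr_neq0 ?gt_eqF.
    apply: le_trans; rewrite (bigD1 r) //= lerDl; apply: sumr_ge0 => i _; exact: sqr_ge0.
  rewrite -M0 !mulr0 /rmass big1 // => r _; rewrite f0 normr0 powR0 // gt_eqF //.
(* Up to the factor 3/2, t bounds the mean square of a row; the affine bound at t replaces Hoelder's
   inequality, with 5/2 = 1 + 3/2. The case M = 0 is treated apart because the bound needs t > 0. *)
pose t := c `^ (2 / p - 1) * M `^ (2 / p) / #|B|%:R.
have t0 : 0 < t by rewrite divr_gt0 // mulr_gt0 // powR_gt0.
have ta : #|B|%:R * t `^ (p / 2) = (#|B|%:R * c) `^ (1 - p / 2) * M.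
  rewrite /t powRM ?mulr_ge0 ?powR_ge0 ?invr_ge0 ?ltW // powRM ?powR_ge0 // -!powRrM.
  have -> : 2 / p * (p / 2) = 1 by field; rewrite gt_eqF.
  have -> : (2 / p - 1) * (p / 2) = 1 - p / 2 by field; rewrite gt_eqF.
  rewrite powRr1 ?ltW // powRV ?ltW // powRM ?ltW //.
  rewrite [X in _ = X * _ * _]powRB ?(gt_eqF b0) ?implybT // powRr1 ?ltW //.
  by ring.
rewrite rmass_sqE -ta.
apply: (@le_trans _ _ (\sum_r (t `^ (p / 2) + t `^ (p / 2 - 1) * f r ^+ 2))).
  by apply: ler_sum => r _; apply: powR_le_affine; rewrite ?sqr_ge0 //; lra.
rewrite big_split /= sumr_const -mulr_sumr -(mulr_natl (t `^ _)).
have : t `^ (p / 2 - 1) * (\sum_r f r ^+ 2) <= 3 / 2 * (#|B|%:R * t `^ (p / 2)).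
  apply: (@le_trans _ _ (t `^ (p / 2 - 1) * (3 / 2 * (#|B|%:R * t)))).
    apply: ler_wpM2l; first exact: powR_ge0.
    by rewrite [#|B|%:R * t]mulrC /t divfK ?gt_eqF.
  rewrite (powRS (p / 2) t0) le_eqVlt; apply/orP; left; apply/eqP; ring.
move: (_ * (\sum_r _)) (#|B|%:R * _) => u v; lra.
Qed.

Lemma rmass_ge_euclid (f : B -> R) : (\sum_r f r ^+ 2) `^ (p / 2) <= rmass f.
Proof.
have h1 := p1; have h2 := p2.
rewrite rmass_sqE; apply: powR_sum_le => [||r _]; [lra|lra|exact: sqr_ge0].
Qed.

End Bounds.
End CountSketch.

(** * Upper and lower bounds for CountSketch in p-mass *)

Section PartOne.
Context {R : realType} {O B L : finType} (b : O -> B) (s : O -> bool) (l : O -> L).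
Local Notation one := (fun (_ : nat) (_ : L) => 1 : R).
Context (p : R) (n : nat).
Hypotheses (p1 : 1 <= p) (p2 : p < 2).

Lemma pmass_sensitivity {J : finType} (U : nat -> J -> R) z i :
  rsq z `^ (p / 2) <= pmass p n (lin U z) ->
  `|lin U z i| `^ p <= rsq (U i) `^ (p / 2) * pmass p n (lin U z).
Proof.
move=> h; rewrite mulrC; apply: le_trans (lin_powR_le _ _ _ _) _.
  by apply: le_trans p1; exact: ler01.
by apply: ler_wpM2r => //; exact: powR_ge0.
Qed.

Lemma powR_scale_le (M d e f : R) : 1 <= M -> 1 <= d -> e <= 1 -> e <= f ->
  (M * d) `^ e <= M * d `^ f.
Proof.
move=> M1 d1 e1 ef; rewrite powRM; [|lra|lra].
by apply: ler_pM; rewrite ?powR_ge0 //; [exact: ler1_powR|exact: ler_powR].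
Qed.

Lemma part1_upper w y (d : R) (M : R) (h : nat -> R) :
  1 <= d -> 1 <= M -> #|B|%:R = M * d ^+ 2 ->
  (forall i, (i < n)%N -> `|y i| `^ p <= h i * pmass p n y) ->
  \sum_r sk b s l n one w (fun i => if d^-1 <= h i then 0 else y i) r ^+ 2 <=
    3 / 2 * \sum_(i < n) (if d^-1 <= h i then 0 else y i) ^+ 2 ->
  (forall r, load b n (fun i => (d^-1 <= h i)%R%:R) w r <= 80 * d) ->
  rmass p (sk b s l n one w y) <= (320 + 10 * M) * (d `^ (p / 2) * pmass p n y).
Proof.
have h1 := p1; have h2 := p2; move=> d1 M1 cB hy hL hload.
have p0 : 0 < p by lra.
have N0 := pmass_ge0 p n y; set N := pmass p n y in hy N0 *.
have d0 : 0 < d by lra.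
have di0 : 0 < d^-1 by rewrite invr_gt0.
have -> : sk b s l n one w y = fun r =>
  sk b s l n one w (fun i => if d^-1 <= h i then y i else 0) r +
  sk b s l n one w (fun i => if d^-1 <= h i then 0 else y i) r.
  apply/funext => r; rewrite -skD; apply: eq_sk => i _.
  by case: ifP => _; rewrite ?addr0 ?add0r.
apply: le_trans (rmassD _ _ _ _) _ => //.
have d80 : 0 <= 80 * d by lra.
have : rmass p (sk b s l n one w (fun i => if d^-1 <= h i then y i else 0)) <= 80 * (d `^ (p / 2) * N).
  apply: le_trans (rmass_heavy (h := fun i => d^-1 <= h i) s l p1 p2 y d80 hload) _; rewrite -/N mulrA.
  apply: ler_wpM2r => //; apply: powR_scale_le => //; lra.
have B0 : (0 < #|B|)%N by rewrite -(ltr0n R) cB mulr_gt0 ?exprn_gt0 //; lra.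
have {}hL : \sum_r sk b s l n one w (fun i => if d^-1 <= h i then 0 else y i) r ^+ 2 <=
  3 / 2 * (d^-1 `^ (2 / p - 1) * N `^ (2 / p)).
  apply: le_trans hL _; apply: ler_wpM2l; first lra.
  have -> : \sum_(i < n) (if d^-1 <= h i then 0 else y i) ^+ 2 =
    \sum_(i < n | ~~ (d^-1 <= h i)) y i ^+ 2.
    rewrite [RHS]big_mkcond; apply: eq_bigr => i _.
    by case: ifP => _; rewrite ?expr0n.
  apply: le_trans (@sum_sq_le_pmass _ p n (fun i => ~~ (d^-1 <= h i)) y (d^-1 * N) _ _ _ _) _ => //.
  - exact: ltW.
  - by rewrite mulr_ge0 // ltW.
  - move=> i ni; rewrite -ltNge => hi; apply: le_trans (hy _ ni) _.
    by apply: ler_wpM2r => //; exact: ltW.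
  rewrite -/N (powRM _ (ltW di0) N0) -mulrA; apply: ler_wpM2l; first exact: powR_ge0.
  move: N0; rewrite le_eqVlt => /predU1P[<-|N0]; first by rewrite mulr0 powR_ge0.
  by rewrite mulrC -powRS.
have := rmass_light p1 p2 di0 N0 B0 hL.
have -> : #|B|%:R / d = M * d by rewrite cB; field; rewrite gt_eqF.
(* p >= 1 gives 1 - p/2 <= p/2, so the light coordinates obey the same d^(p/2) bound as the heavy
   ones. The constants are 320 = 4 * 80 and 10 = 4 * 5/2, the 4 coming from [rmassD]. *)
have : (M * d) `^ (1 - p / 2) * N <= M * (d `^ (p / 2) * N).
  rewrite mulrA; apply: ler_wpM2r => //; apply: powR_scale_le => //; lra.
have -> : (320 + 10 * M) * (d `^ (p / 2) * N) = 320 * (d `^ (p / 2) * N) + 10 * (M * (d `^ (p / 2) * N)) by ring.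
by move=> ? ? ?; lra.
Qed.

Lemma part1_lower w (y : nat -> R) (K : R) : 0 < K ->
  2^-1 * \sum_(i < n) y i ^+ 2 <= \sum_r sk b s l n one w y r ^+ 2 ->
  2^-1 <= \sum_(i < n | K^-1 < `|y i| `^ p) `|y i| `^ p ->
  4^-1 * K `^ (p / 2 - 1) <= rmass p (sk b s l n one w y).
Proof.
have h1 := p1; have h2 := p2; move=> K0 hS hy.
have p0 : 0 < p by lra.
apply: le_trans (rmass_ge_euclid p1 p2 _).
have Ki0 : 0 < K^-1 by rewrite invr_gt0.
apply: (@le_trans _ _ ((4^-1 * K^-1 `^ (2 / p - 1)) `^ (p / 2))); last first.
  apply: ge0_ler_powR; first lra.
  - by rewrite nnegrE mulr_ge0 ?powR_ge0 ?invr_ge0.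
  - by rewrite nnegrE sumr_ge0 // => r _; exact: sqr_ge0.
  apply: le_trans hS.
  have := @sum_sq_ge_pmass _ p n y K^-1 p0 (ltW p2) (ltW Ki0).
  have := ler_wpM2l (powR_ge0 K^-1 (2 / p - 1)) hy.
  move: (_ `^ (2 / p - 1)) (_ * \sum_(i < n | _) _) (\sum_(i < n) _) => u v x; lra.
rewrite powRM ?powR_ge0 ?invr_ge0 // -powRrM (powRV _ (ltW K0)) -powRN.
have -> : - ((2 / p - 1) * (p / 2)) = p / 2 - 1 by field; rewrite gt_eqF.
apply: ler_wpM2r; first exact: powR_ge0.
apply: ger1_powR; lra.
Qed.

End PartOne.

(** * Bounds for the sketch with random levels *)

Section PartTwo.
Context {R : realType} {O B L : finType} (b : O -> B) (s : O -> bool) (l : O -> L).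
Context (p : R) (n : nat).
Hypotheses (p1 : 1 <= p) (p2 : p < 2).

Definition trunc {J : finType} (th : L -> R) (U : nat -> J -> R) (T : R) i t :=
  if th t `^ p * rsq (U i) `^ (p / 2) <= T then th t else 0.

(** When no entry exceeds the truncation level the sketch equals its truncation. Cauchy-Schwarz then
    separates z from the sketched basis, so a single potential controls all z at once. *)
Lemma part2_upper {J : finType} (th : L -> R) (U : nat -> J -> R) (T m2 La : R) w z :
  0 <= m2 ->
  (forall i, (i < n)%N -> th (l (w i)) `^ p * rsq (U i) `^ (p / 2) <= T) ->
  \sum_r (m2 + rsq (fun j => sk b s l n (trunc th U T) w (U^~ j) r)) `^ (p / 2) <= La ->
  rmass p (sk b s l n (fun=> th) w (lin U z)) <= rsq z `^ (p / 2) * La.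
Proof.
have h1 := p1; move=> m20 hT hLa.
have e y r : sk b s l n (fun=> th) w y r = sk b s l n (trunc th U T) w y r.
  by apply: eq_bigr => i _; rewrite /ent /trunc hT.
apply: (@le_trans _ _ (rsq z `^ (p / 2) *
   \sum_r (m2 + rsq (fun j => sk b s l n (trunc th U T) w (U^~ j) r)) `^ (p / 2))); last first.
  by apply: ler_wpM2l => //; exact: powR_ge0.
rewrite mulr_sumr; apply: ler_sum => r _.
rewrite e -sqr_powR_half -powRM ?rsq_ge0 ?addr_ge0 ?rsq_ge0 //; apply: ge0_ler_powR.
- lra.
- by rewrite nnegrE sqr_ge0.
- by rewrite nnegrE mulr_ge0 ?rsq_ge0 // addr_ge0 ?rsq_ge0.
rewrite sk_lin; apply: le_trans (cauchy_schwarz_sum _ _ _) _.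
by apply: ler_wpM2l; rewrite ?rsq_ge0 // lerDr.
Qed.

Lemma expRN1_le : expR (- 1) <= 2^-1 :> R.
Proof.
rewrite expRN lef_pV2 ?posrE ?expR_gt0 //.
by have := @expR_ge1Dx R 1.
Qed.

Lemma small_ge (K a z : R) : 0 < K -> 0 <= a -> a `^ p = K^-1 ->
  expR (- (K * `|z| `^ p)) <= small a z.
Proof.
have h1 := p1; move=> K0 a0 aK; rewrite /small; case: ltP => h.
  by rewrite -[leRHS]expR0 ler_expR oppr_le0 mulr_ge0 ?powR_ge0 // ltW.
apply: le_trans expRN1_le; rewrite ler_expR lerN2 -ler_pdivrMl // mulr1 -aK.
by apply: ge0_ler_powR; rewrite ?nnegrE //; lra.
Qed.

(** A small p-mass forces a large product, so Markov's inequality for the product bounds the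
    probability of a small p-mass. *)
Lemma prod_small_ge (K a : R) (f : B -> R) : 0 < K -> 0 <= a -> a `^ p = K^-1 ->
  expR (- (K * rmass p f)) <= \prod_(r in [set: B]) small a (f r).
Proof.
move=> K0 a0 aK; rewrite /rmass mulr_sumr -sumrN expR_sum.
rewrite [leRHS](eq_bigl xpredT); last by move=> r; rewrite inE.
by apply: ler_prod => r _; rewrite expR_ge0 small_ge.
Qed.

Lemma ln_prod_bound (h : nat -> R) : (forall i, 0 <= h i <= 1) ->
  \prod_(i < n) (1 - h i / 8) <= expR (- (\sum_(i < n) h i / 8)).
Proof.
move=> h01; rewrite -sumrN expR_sum; apply: ler_prod => i _.
by have := h01 i; have := expR_ge1Dx (- (h i / 8)); move: (expR _) => u ? ?; lra.
Qed.

End PartTwo.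

(** * Lower tail for one spread vector *)

Section SpreadPoint.
Context {R : realType} {O B : finType} (p eps K : R) (n m : nat).
Context (b : O -> B) (s : O -> bool) (l : O -> level (n + 3)).
Context (o0 : O) (pr : O -> R).
Hypotheses (p1 : 1 <= p) (p2 : p < 2).
Hypothesis pr0 : forall o, 0 <= pr o.
Hypothesis pr1 : \sum_o pr o = 1.
Hypotheses (e0 : 0 < eps) (e1 : eps <= 1) (K1 : 1 <= K) (Km : K <= m%:R) (cardB : #|B| = (2 * m)%N).
Hypothesis law : sketch_law pr (levelp eps (N := n + 3)) b s l.

Lemma leq_exp2 k : (k <= 2 ^ k)%N.
Proof. by rewrite ltnW // ltn_expl. Qed.

Lemma spread_point (y : nat -> R) : pmass p n y = 1 ->
  2^-1 <= \sum_(i < n | `|y i| `^ p <= K^-1) `|y i| `^ p ->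
  Ex o0 pr n (fun w => \prod_(r in [set: B]) small (K^-1 `^ p^-1)
     (sk b s l n (fun=> levelv p (N := n + 3)) w y r)) <=
  2 * expR (- (eps * K / 128)).
Proof.
have hK := K1; have he := e0; have hp := p1.
move=> y1 ysp; set a := _ `^ p^-1; have K0 : 0 < K by lra.
have p0 : 0 < p by lra.
have a0 : 0 <= a by exact: powR_ge0.
have aK : a `^ p = K^-1 by rewrite /a -powRrM mulVf ?gt_eqF // powRr1 // invr_ge0 ltW.
pose q := levelp eps (N := n + 3); pose th := levelv p (N := n + 3).
have q0 : forall t, 0 <= q t by exact: levelp_ge0.
have qs : \sum_t q t = 1 by exact: sum_levelp.
have := @Ex_prod_small R O o0 pr pr0 pr1 B _ q b s l law q0 qs y th a m cardB n [set: B] (fun=> 0).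
rewrite cardsT cardB.
under eq_Ex => w do under eq_bigr => r _ do rewrite add0r.
move=> h; apply: le_trans h _.
rewrite [2 * expR _](_ : _ = expR (- (eps * K / 128)) + expR (- (eps * K / 128))); last by ring.
apply: lerD.
  apply: le_trans (ln_prod_bound n (hit01 q0 qs y th a)) _.
  rewrite ler_expR lerN2 -mulr_suml.
  suff : eps * K / 16 <= \sum_(i < n) hit q y th a i by move: (\sum_(i < n) _) => u; lra.
  (* Reason for n + 3 levels: coordinates with K |y_i|^p < 2^-(n+2) are out of reach of the levels,
     but at most n of them lose n / 2^(n+2) <= 1/4 altogether. As K >= 1, K/2 - 1/4 >= K/4
     remains. *)
  have sum1 : \sum_(i < n) (if `|y i| `^ p <= K^-1 then eps / 4 * (K * `|y i| `^ p) - eps / 4 * (2 ^+ n.+2)^-1 else 0)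
      <= \sum_(i < n) hit q y th a i.
    apply: ler_sum => i _; have /andP[hi0 _] := hit01 q0 qs y th a i.
    case: ifP => // yi.
    have [h|h] := leP (2 ^+ n.+2)^-1 (K * `|y i| `^ p).
      apply: (@le_trans _ _ (eps / 4 * (K * `|y i| `^ p))).
        by rewrite gerBl mulr_ge0 ?invr_ge0 ?exprn_ge0 //; lra.
      apply: (@levelp_hit R p eps (n + 3) p1 e0 e1 K a (y i)) => //; first by rewrite addn3.
      rewrite addn3 /= h /= -ler_pdivlMl // mulr1 //.
    apply: le_trans hi0; rewrite subr_le0; apply: ler_wpM2l; [lra|exact: ltW].
  apply: le_trans sum1; rewrite -big_mkcond sumrB -mulr_sumr -mulr_sumr sumr_const.
  have c1 : (2 ^+ n.+2)^-1 *+ #|(fun i : 'I_n => `|y i| `^ p <= K^-1)| <= 4^-1 :> R.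
    rewrite -(mulr_natl (2 ^+ n.+2)^-1) ler_pdivrMr ?exprn_gt0 // !exprS -natrX.
    have -> : 4^-1 * (2 * (2 * (2 ^ n)%:R)) = (2 ^ n)%:R :> R by field.
    rewrite ler_nat; apply: leq_trans (max_card _) _; rewrite card_ord; exact: leq_exp2.
  rewrite -mulrnAr; move: c1; move: (_ *+ _) => c c1.
  have h1 := ler_wpM2l (ltW K0) ysp; move: h1; move: (K * (\sum_(i < n | _) _)) => u h1.
  have : eps * (u - K / 2) >= 0 by apply: mulr_ge0; [exact: ltW|rewrite subr_ge0; lra].
  have : eps * (4^-1 - c) >= 0 by apply: mulr_ge0; [exact: ltW|rewrite subr_ge0].
  have : eps * (K - 1) >= 0 by apply: mulr_ge0; [exact: ltW|rewrite subr_ge0].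
  have -> : eps * (u - K / 2) = eps * u - eps * K / 2 by ring.
  have -> : eps * (4^-1 - c) = eps / 4 - eps * c by ring.
  have -> : eps * (K - 1) = eps * K - eps by ring.
  have -> : eps / 4 * u = eps * u / 4 by ring.
  have -> : eps / 4 * c = eps * c / 4 by ring.
  move: (eps * u) (eps * K) (eps * c) => x1 x2 x3 ? ? ?; lra.
(* With 2m rows the second term is (3/4)^(2m) (4/3)^m = (3/4)^m <= exp(-m/4), and m >= K >= eps
   K. *)
have -> : (2 * m = m + m)%N by rewrite mul2n addnn.
rewrite exprD -mulrA -exprMn.
have -> : 3 / 4 * (4 / 3) = 1 :> R by field.
rewrite expr1n mulr1.
have h34 : 3 / 4 <= expR (- 4^-1) :> R by have := @expR_ge1Dx R (- 4^-1); move: (expR _) => u; lra.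
apply: (@le_trans _ _ (expR (- 4^-1) ^+ m)).
  by apply: lerXn2r; rewrite ?nnegrE ?expR_ge0 //; lra.
rewrite -expRM_natl ler_expR mulrN lerN2.
have : 0 <= (1 - eps) * K by rewrite mulr_ge0 ?subr_ge0 //; lra.
have := Km; rewrite mulrBl mul1r; move: (eps * K) => x; lra.
Qed.

End SpreadPoint.

(** * A net of spread vectors *)

Section Grid.
Context {R : realType} {k : nat}.

(** Cubes of side 1/g in [-1, 1]^k. The coordinate 1 has index 2g, hence 2g + 1 values per
    coordinate. *)
Definition cell g (z : 'I_k -> R) : {ffun 'I_k -> 'I_(g.*2.+1)} :=
  [ffun j => inord (Num.truncn ((z j + 1) * g%:R))].

Lemma cell_close g (z z' : 'I_k -> R) : (0 < g)%N ->
  (forall j, `|z j| <= 1) -> (forall j, `|z' j| <= 1) -> cell g z = cell g z' ->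
  rsq (fun j => z j - z' j) <= k%:R / g%:R ^+ 2.
Proof.
move=> g0 hz hz' e; have gR : 0 < g%:R :> R by rewrite ltr0n.
have bd (x : R) : `|x| <= 1 -> 0 <= (x + 1) * g%:R /\ (Num.truncn ((x + 1) * g%:R)%R < g.*2.+1)%N.
  rewrite ler_norml => /andP[x1 x2].
  have h0 : 0 <= (x + 1) * g%:R by rewrite mulr_ge0 //; lra.
  split => //; rewrite truncn_lt_nat //.
  apply: (@le_lt_trans _ _ (g.*2%:R)); last by rewrite ltr_nat.
  rewrite -mul2n natrM; apply: ler_wpM2r => //; lra.
rewrite /rsq -[X in X%:R](card_ord k) -[leRHS]mulr1.
have -> : #|'I_k|%:R / g%:R ^+ 2 * 1 = \sum_(j < k) (g%:R ^- 2) :> R.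
  by rewrite sumr_const -(mulr_natl (g%:R ^- 2)) mulr1.
apply: ler_sum => j _.
move/ffunP: e => /(_ j); rewrite !ffunE => /(congr1 val) /=.
have [p0 p1] := bd _ (hz j); have [q0 q1] := bd _ (hz' j).
rewrite !inordK // => e.
have /andP[a1 a2] := truncn_itv p0; have /andP[b1 b2] := truncn_itv q0.
rewrite e in a1 a2; rewrite -natr1 in a2; rewrite -natr1 in b2.
have h : `|(z j - z' j) * g%:R| <= 1.
  have -> : (z j - z' j) * g%:R = (z j + 1) * g%:R - (z' j + 1) * g%:R by ring.
  move: (_ * g%:R) (_ * g%:R) (_%:R) a1 a2 b1 b2 => x y t *.
  rewrite ler_norml; apply/andP; split; lra.
rewrite -[leRHS]mul1r ler_pdivlMr ?exprn_gt0 // -exprMn -real_normK ?num_real //.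
by apply: exprn_ile1.
Qed.

End Grid.

Section SpreadNet.
Context {R : realType} {O B : finType} (p eps K : R) (n m : nat).
Context (b : O -> B) (s : O -> bool) (l : O -> level (n + 3)).
Context (o0 : O) (pr : O -> R).
Hypotheses (p1 : 1 <= p) (p2 : p < 2).
Hypothesis pr0 : forall o, 0 <= pr o.
Hypothesis pr1 : \sum_o pr o = 1.
Hypotheses (e0 : 0 < eps) (e1 : eps <= 1) (K1 : 1 <= K) (Km : K <= m%:R) (cardB : #|B| = (2 * m)%N).
Hypothesis law : sketch_law pr (levelp eps (N := n + 3)) b s l.
Local Notation T := (sk b s l n (fun=> levelv p (N := n + 3))).

Definition spread (y : nat -> R) :=
  pmass p n y = 1 /\ 2^-1 <= \sum_(i < n | `|y i| `^ p <= K^-1) `|y i| `^ p.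

(* a net made of spread vectors themselves: one representative per grid cell meeting them *)
Lemma spread_net k (U : nat -> 'I_k -> R) (d g : nat) (La : R) :
  (k <= d)%N -> (0 < d)%N -> 1 <= La -> 8 * d%:R * La <= eps / 256 * g%:R ->
  (forall z, rsq z `^ (p / 2) <= pmass p n (lin U z)) ->
  exists F : (nat -> O) -> R, [/\ forall w, 0 <= F w,
    Ex o0 pr n F <= (g.*2.+1)%:R ^+ k * (2 * expR (- (eps * K / 256))) &
    forall w, F w < 1 ->
      (forall z, rmass p (T w (lin U z)) <= rsq z `^ (p / 2) * La) ->
      forall z, spread (lin U z) -> eps / 2048 <= rmass p (T w (lin U z))].
Proof.
have h1 := p1; have h2 := p2; have he := e0; have he1 := e1; have hK := K1.
move=> kd d0 La1 hg hU.
have p0 : 0 < p by lra.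
have K0 : 0 < K by lra.
have dR : 1 <= d%:R :> R by rewrite ler1n.
have dLa : 1 <= d%:R * La by apply: mulr_ege1.
have g0 : (0 < g)%N.
  rewrite lt0n; apply/eqP => g0; move: hg; rewrite g0 mulr0; move: dLa; rewrite -mulrA; lra.
have gR : 0 < g%:R :> R by rewrite ltr0n.
pose a := K^-1 `^ p^-1.
have a0 : 0 <= a by exact: powR_ge0.
have aK : a `^ p = K^-1 by rewrite /a -powRrM mulVf ?gt_eqF // powRr1 // invr_ge0 ltW.
pose good (c : {ffun 'I_k -> 'I_(g.*2.+1)}) z := spread (lin U z) /\ cell g z = c.
(* The exponential factor makes [pt z w] at least 1 as soon as the sketched mass is at most eps/256;
   it spends half of the exponent eps K / 128 of [spread_point]. *)
pose pt (z : 'I_k -> R) w := expR (eps / 256 * K) * \prod_(r in [set: B]) small a (T w (lin U z) r) : R.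
have pt0 z w : 0 <= pt z w.
  apply: mulr_ge0; first exact: expR_ge0.
  by apply: prodr_ge0 => r _; case/andP: (small01 a (T w (lin U z) r)).
have [rep hrep] : exists rep : {ffun 'I_k -> 'I_(g.*2.+1)} -> option ('I_k -> R),
    forall c, match rep c with Some z => good c z | None => forall z, ~ good c z end.
  have : forall c, exists o : option ('I_k -> R),
      match o with Some z => good c z | None => forall z, ~ good c z end.
    move=> c; have [[z hz]|hn] := pselect (exists z, good c z); first by exists (Some z).
    by exists None => z hz; apply: hn; exists z.
  by move=> /choice[f hf]; exists f.
pose F w := \sum_c (if rep c is Some z then pt z w else 0).
exists F; split.
- by move=> w; apply: sumr_ge0 => c _; case: (rep c).
- rewrite /F Ex_sum.
  have -> : (g.*2.+1)%:R ^+ k * (2 * expR (- (eps * K / 256))) =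
    \sum_(c : {ffun 'I_k -> 'I_(g.*2.+1)}) (2 * expR (- (eps * K / 256))).
    by rewrite sumr_const card_ffun !card_ord -(mulr_natl (2 * expR _)) natrX.
  apply: ler_sum => c _; case: (rep c) (hrep c) => [z [[z1 z2] _]|_]; last first.
    by rewrite Ex0 mulr_ge0 // expR_ge0.
  rewrite ExZ.
  have := spread_point (b := b) (s := s) (l := l) o0 p1 pr0 pr1 e0 e1 K1 Km cardB law z1 z2.
  rewrite -/a => h; have := ler_wpM2l (expR_ge0 (eps / 256 * K)) h.
  rewrite mulrCA -expRD.
  by have -> : eps / 256 * K + - (eps * K / 128) = - (eps * K / 256) by field.
- move=> w Fw hup z zs.
  have hc := hrep (cell g z); move: hc; case e : (rep (cell g z)) => [z'|]; last first.
    by move=> /(_ z) []; split.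
  move=> [z's cz'].
  have lt1 : pt z' w < 1.
    apply: le_lt_trans Fw; rewrite /F (bigD1 (cell g z)) //= e lerDl.
    by apply: sumr_ge0 => c _; case: (rep c).
  have big' : eps / 256 < rmass p (T w (lin U z')).
    have h := prod_small_ge p1 (T w (lin U z')) K0 a0 aK.
    have {lt1}h : expR (eps / 256 * K) * expR (- (K * rmass p (T w (lin U z')))) < 1.
      by apply: le_lt_trans lt1; apply: ler_wpM2l => //; exact: expR_ge0.
    move: h; rewrite -expRD expR_lt1 [eps / 256 * K]mulrC -mulrBr.
    by rewrite pmulr_rlt0 // subr_lt0.
  have le1 x : spread (lin U x) -> forall j, `|x j| <= 1.
    move=> [x1 _] j; have := hU x; rewrite x1 => hx.
    have rx : rsq x <= 1.
      rewrite leNgt; apply/negP => gt1.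
      have := @gt0_ltr_powR R (p / 2) ltac:(lra) 1 (rsq x).
      rewrite !nnegrE ler01 rsq_ge0 => /(_ isT isT gt1); rewrite powR1.
      by rewrite ltNge hx.
    rewrite -(@expr_le1 _ 2) // real_normK ?num_real //; apply: le_trans rx.
    by rewrite /rsq (bigD1 j) //= lerDl; apply: sumr_ge0 => i _; exact: sqr_ge0.
  have close := cell_close g0 (le1 _ z's) (le1 _ zs) cz'.
  set dz := fun j => _ in close.
  (* The cell is so fine that the crude upper bound [La] suffices: eps/256 < 4 (eps/2048 + mass)
     leaves a mass above eps/2048. *)
  have small' : rmass p (T w (lin U dz)) <= eps / 2048.
    apply: le_trans (hup dz) _.
    have dg : d%:R / g%:R <= 1 :> R.
      rewrite ler_pdivrMr // mul1r.
      have : d%:R <= d%:R * La by rewrite ler_peMr // (le_trans ler01).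
      have : 0 <= (1 - eps) * g%:R by rewrite mulr_ge0 //; lra.
      move: hg; rewrite -mulrA mulrBl mul1r mulrAC.
      move: (d%:R * La) (eps * g%:R) => u v; lra.
    have dg0 : 0 <= d%:R / g%:R :> R by rewrite divr_ge0 // ltW.
    have : rsq dz `^ (p / 2) <= d%:R / g%:R.
      apply: (@le_trans _ _ (((d%:R / g%:R) ^+ 2) `^ (p / 2))).
        apply: ge0_ler_powR; rewrite ?nnegrE ?rsq_ge0 ?sqr_ge0 //; first lra.
        apply: le_trans close _; rewrite exprMn -exprVn; apply: ler_wpM2r.
          by rewrite exprn_ge0 // invr_ge0 ltW.
        apply: (@le_trans _ _ d%:R); first by rewrite ler_nat.
        by rewrite expr2 ler_peMr // (le_trans ler01).
      rewrite sqr_powR_half ger0_norm //.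
      move: dg0; rewrite le_eqVlt => /predU1P[<-|dg0]; first by rewrite powR0 // gt_eqF.
      by apply: ge1r_powR => //; rewrite dg0 dg.
    move=> h; apply: (@le_trans _ _ (d%:R / g%:R * La)).
      by apply: ler_wpM2r => //; lra.
    rewrite mulrAC ler_pdivrMr //; move: hg; rewrite -mulrA.
    have -> : eps / 256 * g%:R = 8 * (eps / 2048 * g%:R) by field.
    move: (d%:R * La) (eps / 2048 * g%:R) => u v; lra.
  have split' : rmass p (T w (lin U z')) <= 4 * (rmass p (T w (lin U dz)) + rmass p (T w (lin U z))).
    have -> : T w (lin U z') = fun r => T w (lin U dz) r + T w (lin U z) r.
      apply/funext => r; rewrite -skD; apply: eq_sk => i _.
      rewrite /lin -big_split /=; apply: eq_bigr => j _; rewrite /dz; ring.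
    exact: rmassD.
  lra.
Qed.

End SpreadNet.

(** * The joint law of a column of both sketches *)

Section ProductLaw.
Context {R : realType} {B1 B2 L : finType} (q : L -> R).
Hypotheses (c1 : (0 < #|B1|)%N) (c2 : (0 < #|B2|)%N).
Hypotheses (q0 : forall t, 0 <= q t) (qs : \sum_t q t = 1).

Definition column := ((B1 * bool) * ((B2 * bool) * L))%type.
Definition cpr (o : column) : R := (2 * #|B1|%:R)^-1 * ((2 * #|B2|%:R)^-1 * q o.2.2).

Lemma cpr_ge0 o : 0 <= cpr o.
Proof. by rewrite !mulr_ge0 // invr_ge0 mulr_ge0. Qed.

Lemma sum_prod (I J : finType) (F : I * J -> R) : \sum_o F o = \sum_i \sum_j F (i, j).
Proof. by rewrite pair_bigA; apply: eq_bigr => -[]. Qed.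

Lemma sum_uniform (B : finType) (f : B -> bool -> R) : (0 < #|B|)%N ->
  \sum_(x : B * bool) (2 * #|B|%:R)^-1 * f x.1 x.2 =
  #|B|%:R^-1 * \sum_r (f r true + f r false) / 2.
Proof.
move=> c; rewrite sum_prod /=.
rewrite mulr_sumr; apply: eq_bigr => r _; rewrite big_bool /=; field.
by rewrite pnatr_eq0 -lt0n.
Qed.

Lemma sum_uniform1 (B : finType) : (0 < #|B|)%N -> \sum_(x : B * bool) (2 * #|B|%:R)^-1 = 1 :> R.
Proof.
move=> c; have := sum_uniform (fun _ _ => 1) c.
under eq_bigr => x _ do rewrite mulr1.
move=> ->; rewrite (eq_bigr (fun=> 1)); last by move=> r _; field.
by rewrite sumr_const mulVf // pnatr_eq0 -lt0n.
Qed.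

Lemma weighted_cst (I : finType) (w : I -> R) x : \sum_i w i = 1 -> \sum_i w i * x = x.
Proof. by move=> w1; rewrite -mulr_suml w1 mul1r. Qed.

Lemma sum_column (F : column -> R) :
  \sum_o cpr o * F o =
  \sum_(x : B1 * bool) (2 * #|B1|%:R)^-1 * \sum_(y : B2 * bool) (2 * #|B2|%:R)^-1 *
    \sum_t q t * F (x, (y, t)).
Proof.
rewrite sum_prod; apply: eq_bigr => x _; rewrite sum_prod.
rewrite mulr_sumr; apply: eq_bigr => y _; rewrite !mulr_sumr.
by apply: eq_bigr => t _; rewrite /cpr /= !mulrA.
Qed.

Lemma sum_cpr : \sum_o cpr o = 1.
Proof.
have := sum_column (fun=> 1); under eq_bigr => o _ do rewrite mulr1.
move=> ->; rewrite -[RHS](sum_uniform1 c1); apply: eq_bigr => x _.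
rewrite -[RHS]mulr1; congr (_ * _); rewrite -[RHS](sum_uniform1 c2); apply: eq_bigr => y _.
by rewrite -[RHS]mulr1; congr (_ * _); rewrite -[RHS]qs; apply: eq_bigr => t _; rewrite mulr1.
Qed.

Lemma law_first : sketch_law cpr (fun _ : unit => 1) (fun o => o.1.1) (fun o => o.1.2) (fun=> tt).
Proof.
move=> f; rewrite (sum_column (fun o => f o.1.1 o.1.2 tt)) /=.
under eq_bigr => x _ do under eq_bigr => y _ do rewrite (weighted_cst _ qs).
under eq_bigr => x _ do rewrite (weighted_cst _ (sum_uniform1 c2)).
rewrite (sum_uniform (fun r e => f r e tt)) //; congr (_ * _); apply: eq_bigr => r _.
by rewrite (big_pred1 tt) ?mul1r //; case.
Qed.

Lemma law_second : sketch_law cpr q (fun o => o.2.1.1) (fun o => o.2.1.2) (fun o => o.2.2).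
Proof.
move=> f; rewrite (sum_column (fun o => f o.2.1.1 o.2.1.2 o.2.2)) /=.
rewrite (weighted_cst _ (sum_uniform1 c1)).
rewrite (sum_uniform (fun r e => \sum_t q t * f r e t)) //; congr (_ * _); apply: eq_bigr => r _.
by rewrite -big_split /= mulr_suml; apply: eq_bigr => t _; rewrite -mulrDr mulrA.
Qed.

Lemma sum_cpr_level (f : L -> R) : \sum_o cpr o * f o.2.2 = \sum_t q t * f t.
Proof.
rewrite (sum_column (fun o => f o.2.2)) /= (weighted_cst _ (sum_uniform1 c1)).
exact: (weighted_cst _ (sum_uniform1 c2)).
Qed.

End ProductLaw.
Arguments column : clear implicits.

(** * Euclidean bases, scaling, and elementary inequalities *)

Section Homogeneity.
Context {R : realType}.

(** The case p = 2 of the Lewis basis plays the role of an orthonormal basis of the column space, at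
    the price of the factor 9. *)
Lemma lewis_euclid n d (A : nat -> nat -> R) :
  exists k (V : nat -> 'I_k -> R), [/\
    forall x : nat -> R, exists z, forall i, (i < n)%N -> \sum_(j < d) A i j * x j = lin V z i,
    forall z, rsq z <= \sum_(i < n) lin V z i ^+ 2 &
    \sum_(i < n) rsq (V i) <= 9 * d%:R].
Proof.
have [|//|k [V [_ hA hz hV]]] := @lewis_combination R 2 n d A; first by rewrite ler1n.
have e2 : 2 / 2 = 1 :> R by field.
exists k, V; split => //.
- move=> z; have := hz z; rewrite e2 powRr1 ?rsq_ge0 // => h; apply: le_trans h _.
  rewrite le_eqVlt; apply/orP; left; apply/eqP; apply: eq_bigr => i _.
  by rewrite (powR_mulrn 2) // real_normK // num_real.
- apply: le_trans _ hV; rewrite le_eqVlt; apply/orP; left; apply/eqP; apply: eq_bigr => i _.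
  by rewrite e2 powRr1 // rsq_ge0.
Qed.

Lemma eq_pmass p n (y z : nat -> R) : (forall i, (i < n)%N -> y i = z i) ->
  pmass p n y = pmass p n z.
Proof. by move=> h; apply: eq_bigr => i _; rewrite h. Qed.

Lemma pmassZ p n a (y : nat -> R) : pmass p n (fun i => a * y i) = `|a| `^ p * pmass p n y.
Proof. by rewrite mulr_sumr; apply: eq_bigr => i _; rewrite powR_normM. Qed.

Lemma rmassZ (B : finType) p a (f : B -> R) : rmass p (fun r => a * f r) = `|a| `^ p * rmass p f.
Proof. by rewrite mulr_sumr; apply: eq_bigr => i _; rewrite powR_normM. Qed.

Lemma rmass_ge0 (B : finType) p (f : B -> R) : 0 <= rmass p f.
Proof. by apply: sumr_ge0 => r _; exact: powR_ge0. Qed.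

Lemma six_sixhundredths (x1 x2 x3 x4 x5 x6 : R) :
  x1 <= 600^-1 -> x2 <= 600^-1 -> x3 <= 600^-1 -> x4 <= 600^-1 -> x5 <= 600^-1 ->
  x6 <= 600^-1 -> x1 + (x2 + (x3 + (x4 + (x5 + x6)))) <= 100^-1.
Proof. move=> *; lra. Qed.

Lemma six_summands_lt1 (x1 x2 x3 x4 x5 x6 : R) :
  0 <= x1 -> 0 <= x2 -> 0 <= x3 -> 0 <= x4 -> 0 <= x5 -> 0 <= x6 ->
  x1 + (x2 + (x3 + (x4 + (x5 + x6)))) < 1 ->
  [/\ x1 < 1, x2 < 1, x3 < 1, x4 < 1 & x5 < 1 /\ x6 < 1].
Proof. by move=> *; do !split; lra. Qed.

Lemma lt_quarter (u : R) : 4 * u < 1 -> u <= 2^-1 ^+ 2.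
Proof. rewrite expr2 => h; lra. Qed.

Lemma half_le_of_dist (u v : R) : `|u - v| <= 2^-1 * v -> 2^-1 * v <= u.
Proof. rewrite ler_norml => /andP[h1 h2]; lra. Qed.

Lemma le_three_halves_of_dist (u v : R) : `|u - v| <= 2^-1 * v -> u <= 3 / 2 * v.
Proof. rewrite ler_norml => /andP[h1 h2]; lra. Qed.

Lemma le_of_sqr_ratio (x c u : R) : 0 < c -> x ^+ 2 <= u -> (c ^+ 2)^-1 * u < 1 -> x <= c.
Proof.
move=> c0 xu; rewrite ltr_pdivrMl ?exprn_gt0 // mulr1 => uc.
rewrite leNgt; apply/negP => cx; have := le_lt_trans xu uc.
by rewrite ltNge lerXn2r // ?nnegrE ltW // (lt_trans c0).
Qed.

Lemma quarter_dominates (eps u v : R) :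
  eps <= 1 -> 0 <= v -> 4^-1 <= u -> eps / 2048 <= u + v.
Proof. move=> *; lra. Qed.

Lemma half_of_sum (u v : R) : u < 2^-1 -> u + v = 1 -> 2^-1 <= v.
Proof. move=> h1 h2; lra. Qed.

End Homogeneity.

(** * The good event and both bounds on it *)

Section Assembly.
Context {R : realType} {O B1 B2 : finType} (p eps K La : R) (n d m M g : nat).
Context (o0 : O) (pr : O -> R).
Hypotheses (p1 : 1 <= p) (p2 : p < 2).
Hypothesis pr0 : forall o, 0 <= pr o.
Hypothesis pr1 : \sum_o pr o = 1.
Context (b1 : O -> B1) (s1 : O -> bool) (b2 : O -> B2) (s2 : O -> bool) (l2 : O -> level (n + 3)).
Hypothesis law1 : sketch_law pr (fun _ : unit => 1) b1 s1 (fun=> tt).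
Hypothesis law2 : sketch_law pr (levelp eps (N := n + 3)) b2 s2 l2.
Hypotheses (e0 : 0 < eps) (e1 : eps <= 1) (d1 : (0 < d)%N).
Hypotheses (cardB1 : #|B1| = (M * d ^ 2)%N) (cardB2 : #|B2| = (2 * m)%N) (m0 : (0 < m)%N).
Hypotheses (M900 : 900 * 900 <= M%:R :> R).
Hypotheses (K1 : 1 <= K) (Km : K <= m%:R) (dK : d%:R <= K).
Hypothesis hLa : 600 * (1 + 9 * d%:R *
  (2 `^ (2 / p - 1) / (2 `^ (2 / p - 1) - 1) + ln (2 * (5400 * d%:R * (2 * m)%:R)) / ln 2)) <= La.
Hypothesis hg : 8 * d%:R * La <= eps / 256 * g%:R.
Hypothesis hnet : (g.*2.+1)%:R ^+ d * (2 * expR (- (eps * K / 256))) <= 600^-1.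

Local Notation E := (Ex o0 pr n).
Local Notation one := (fun (_ : nat) (_ : unit) => 1 : R).
Local Notation S := (sk b1 s1 (fun=> tt) n one).
Local Notation th := (levelv p (N := n + 3)).
Local Notation T := (sk b2 s2 l2 n (fun=> th)).

Let dR : 1 <= d%:R :> R. Proof. by rewrite ler1n. Qed.
Let p0 : 0 < p. Proof. exact: lt_le_trans ltr01 p1. Qed.

Lemma cardB1R : #|B1|%:R = M%:R * d%:R ^+ 2 :> R.
Proof. by rewrite cardB1 natrM natrX. Qed.

(** Origin of the bound on M: the expectation is at most 4 * 4 * 81 / M = 1296 / M, and 600 * 1296
    <= 900^2. The leading 4 encodes the demand that the Gram error be below 1/4. *)
Lemma expect_gram k (V : nat -> 'I_k -> R) : \sum_(i < n) rsq (V i) <= 9 * d%:R ->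
  E (fun w => 4 * gram_err b1 s1 (fun=> tt) n V w) <= 600^-1.
Proof.
have hM := M900; have hd := dR; move=> hV; rewrite ExZ.
have := Ex_gram_error o0 pr0 pr1 law1 card_unit (fun=> erefl) V n.
rewrite -/(gram_err b1 s1 (fun=> tt) n V _) cardB1R => h.
apply: (@le_trans _ _ (4 * (4 / (M%:R * d%:R ^+ 2) * (9 * d%:R) ^+ 2))).
  apply: ler_wpM2l => //; apply: le_trans h _; apply: ler_wpM2l.
    by rewrite divr_ge0 // mulr_ge0 // exprn_ge0.
  by apply: lerXn2r; rewrite ?nnegrE ?mulr_ge0 // sumr_ge0 // => i _; exact: rsq_ge0.
have M0 : 0 < M%:R :> R by lra.
have -> : 4 * (4 / (M%:R * d%:R ^+ 2) * (9 * d%:R) ^+ 2) = 1296 / M%:R :> R.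
  by field; rewrite !gt_eqF //; lra.
rewrite ler_pdivrMr // mulrC ler_pdivlMr //; lra.
Qed.

(** At most 9 d^2 coordinates have h >= 1/d, so the expected squared loads sum to at most 10 d^2;
    the constant 80 is chosen so that 80^2 / 600 > 10. *)
Lemma expect_load (h : nat -> R) : (forall i, 0 <= h i) -> \sum_(i < n) h i <= 9 * d%:R ->
  E (fun w => ((80 * d%:R) ^+ 2)^-1 *
     \sum_r load b1 n (fun i => (d%:R^-1 <= h i)%R%:R) w r ^+ 2) <= 600^-1.
Proof.
have hM := M900; have hd := dR; move=> h0 hs; rewrite ExZ.
have h01 i : 0 <= ((d%:R^-1 <= h i)%R%:R : R) <= 1 by rewrite ler0n lern1 leq_b1.
have := Ex_load o0 pr0 pr1 law1 (fun=> ler01) _ n h01.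
have -> : \sum_(t : unit) 1 = 1 :> R by rewrite sumr_const card_unit.
rewrite cardB1R => /(_ erefl).
have M0 : 0 < M%:R :> R by lra.
have d0 : 0 < d%:R :> R by lra.
have cnt : \sum_(i < n) ((d%:R^-1 <= h i)%R%:R : R) <= 9 * d%:R ^+ 2.
  apply: (@le_trans _ _ (\sum_(i < n) d%:R * h i)).
    apply: ler_sum => i _; have [hi|_] := leP _ (h i); last by rewrite mulr_ge0 // ltW.
    by rewrite -ler_pdivrMl // mulr1.
  by rewrite -mulr_sumr expr2 mulrCA; apply: ler_wpM2l => //; exact: ltW.
have cnt0 : 0 <= \sum_(i < n) ((d%:R^-1 <= h i)%R%:R : R) by apply: sumr_ge0.
move: (\sum_(i < n) _) cnt cnt0 => c cnt cnt0 hE.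
rewrite -ler_pdivlMl ?invr_gt0 ?exprn_gt0 ?mulr_gt0 // invrK.
apply: le_trans hE _; apply: (@le_trans _ _ (9 * d%:R ^+ 2 + 2 / (M%:R * d%:R ^+ 2) * (9 * d%:R ^+ 2) ^+ 2)).
  apply: lerD => //; apply: ler_wpM2l; first by rewrite divr_ge0 // mulr_ge0 ?exprn_ge0 // ltW.
  by apply: lerXn2r; rewrite ?nnegrE // mulr_ge0 // exprn_ge0 // ltW.
have -> : 9 * d%:R ^+ 2 + 2 / (M%:R * d%:R ^+ 2) * (9 * d%:R ^+ 2) ^+ 2 = (9 + 162 / M%:R) * d%:R ^+ 2 :> R.
  by field; rewrite !gt_eqF.
have -> : (80 * d%:R) ^+ 2 / 600 = (6400 / 600) * d%:R ^+ 2 :> R by field.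
apply: ler_wpM2r; first by rewrite exprn_ge0 // ltW.
suff : 162 / M%:R <= 1 :> R by move=> ?; lra.
rewrite ler_pdivrMr //; lra.
Qed.

(** A union bound over the columns; 5400 = 9 * 600. *)
Lemma expect_tail (h : nat -> R) : (forall i, 0 <= h i) -> \sum_(i < n) h i <= 9 * d%:R ->
  E (fun w => \sum_(i < n) (5400 * d%:R < th (l2 (w i)) `^ p * h i)%R%:R) <= 600^-1.
Proof.
have hd := dR; move=> h0 hs; rewrite Ex_sum.
have T0 : 0 < 5400 * d%:R :> R by lra.
apply: (@le_trans _ _ (\sum_(i < n) h i / (5400 * d%:R))).
  apply: ler_sum => i _.
  rewrite (Ex_coord o0 pr1 (fun o => (5400 * d%:R < th (l2 o) `^ p * h i)%R%:R)) //.
  have qs := sum_levelp eps (n + 3).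
  have -> : \sum_o pr o * (5400 * d%:R < th (l2 o) `^ p * h i)%R%:R =
    \sum_t levelp eps (N := n + 3) t * (5400 * d%:R < th t `^ p * h i)%R%:R.
    rewrite (law2 (fun _ _ t => (5400 * d%:R < th t `^ p * h i)%R%:R)).
    rewrite (eq_bigr (fun=> \sum_t levelp eps (N := n + 3) t * (5400 * d%:R < th t `^ p * h i)%R%:R)).
      by rewrite (sum_invB o0 b2).
    by move=> r _; apply: eq_bigr => t _; congr (_ * _); move: (_%:R) => u; field.
  exact: levelp_tail.
rewrite -mulr_suml ler_pdivrMr //; apply: le_trans hs _; lra.
Qed.

Lemma trunc_ratio_ge1 : 1 <= 5400 * d%:R * (2 * m)%:R :> R.
Proof.
have hd := dR; apply: mulr_ege1; first lra.
by rewrite ler1n muln_gt0.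
Qed.

Lemma level_const_ge0 : 0 <= 2 `^ (2 / p - 1) / (2 `^ (2 / p - 1) - 1) +
  ln (2 * (5400 * d%:R * (2 * m)%:R)) / ln 2 :> R.
Proof.
have h2 := p2; have V1 := trunc_ratio_ge1; apply: addr_ge0.
  rewrite divr_ge0 ?powR_ge0 // subr_ge0.
  have be0 : 0 <= 2 / p - 1 by rewrite subr_ge0 ler_pdivlMr // mul1r ltW.
  by rewrite -[leLHS](powRr0 2); apply: ler_powR => //; rewrite ler1n.
rewrite divr_ge0 ?ln_ge0 ?ler1n //; lra.
Qed.

Lemma La_ge1 : 1 <= La.
Proof.
have hL := hLa; have Cl0 := level_const_ge0; move: (_ + _) Cl0 hL => Cl Cl0 hL.
have : 0 <= 9 * d%:R * Cl by rewrite mulr_ge0 // mulr_ge0.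
by move: (_ * Cl) hL => u ? ?; lra.
Qed.

(** At scale 1/|B2| the potential starts at |B2| * (1/|B2|) = 1, and the truncation level is 5400 d
    |B2| times the scale. Only the logarithm of this ratio enters, which is the source of log d for
    the second sketch. *)
Lemma expect_potential k (U : nat -> 'I_k -> R) : \sum_(i < n) rsq (U i) `^ (p / 2) <= 9 * d%:R ->
  E (fun w => La^-1 * \sum_r (#|B2|%:R^-1 `^ (2 / p) +
     rsq (fun j => sk b2 s2 l2 n (trunc p th U (5400 * d%:R)) w (U^~ j) r)) `^ (p / 2)) <= 600^-1.
Proof.
have hd := dR; have h1 := p1; have h2 := p2; have hL := hLa; move=> hU; rewrite ExZ.
have b0 : 0 < #|B2|%:R :> R by rewrite cardB2 ltr0n muln_gt0.
have a0 : 0 < p / 2 by rewrite divr_gt0.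
have a1 : p / 2 < 1 by lra.
have m20 : 0 < #|B2|%:R^-1 `^ (2 / p) by apply: powR_gt0; rewrite invr_gt0.
have q0 := levelp_ge0 (N := n + 3) e0 e1.
have := Ex_potential o0 pr0 pr1 law2 q0 (sum_levelp eps (n + 3)) U
  (trunc p th U (5400 * d%:R)) a0 a1 m20 n.
rewrite -powRrM; have -> : 2 / p * (p / 2) = 1 by field; rewrite gt_eqF.
rewrite powRr1 ?invr_ge0 // mulfV ?gt_eqF // => h.
set Cl := (X in 9 * d%:R * X) in hL.
have V1 := trunc_ratio_ge1; have Cl0 : 0 <= Cl := level_const_ge0.
have {}h : E (fun w => \sum_r (#|B2|%:R^-1 `^ (2 / p) +
     rsq (fun j => sk b2 s2 l2 n (trunc p th U (5400 * d%:R)) w (U^~ j) r)) `^ (p / 2)) <=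
  1 + 9 * d%:R * Cl.
  apply: le_trans h _; rewrite lerD2l.
  apply: (@le_trans _ _ (\sum_(i < n) rsq (U i) `^ (p / 2) * Cl)); last first.
    by rewrite -mulr_suml; apply: ler_wpM2r.
  apply: ler_sum => i _.
  have := levelp_gain (n + 3) p1 p2 e0 e1 (m := #|B2|%:R^-1) _ V1 (rsq_ge0 (U i)).
  rewrite invr_gt0 => /(_ b0).
  have -> : #|B2|%:R^-1 * (5400 * d%:R * (2 * m)%:R) = 5400 * d%:R :> R.
    by rewrite -cardB2; field; rewrite gt_eqF.
  by [].
have L0 : 0 < La := lt_le_trans ltr01 La_ge1.
rewrite ler_pdivrMl //; apply: le_trans h _.
by move: (_ * Cl) hL => u ?; lra.
Qed.

Lemma embedding_event (A : nat -> nat -> R) :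
  exists F : (nat -> O) -> R, [/\ forall w, 0 <= F w, E F <= 100^-1 &
    forall w, F w < 1 -> forall x : nat -> R,
      let y i := \sum_(j < d) A i j * x j in
      eps / 2048 * pmass p n y <= K `^ (1 - p / 2) * rmass p (S w y) + rmass p (T w y) /\
      K `^ (1 - p / 2) * rmass p (S w y) + rmass p (T w y) <=
        ((320 + 10 * M%:R) * K + La) * pmass p n y].
Proof.
have h1 := p1; have h2 := p2; have he := e0; have he1 := e1; have hK := K1.
have hd := dR; have L1 := La_ge1; have hM := M900.
have K0 : 0 < K by lra.
have M1 : 1 <= M%:R :> R by lra.
have [k [U [kd hA hz hU]]] := @lewis_combination R p n d A p1 (ltW p2).
pose h i := rsq (U i) `^ (p / 2).
have h0 i : 0 <= h i by exact: powR_ge0.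
(* The light part of every A x lies in the column space of A', which depends on A alone; a Euclidean
   basis of it lets [S] embed all light parts simultaneously. *)
pose A' i j := if d%:R^-1 <= h i then 0 else A i j.
have [k1 [V [hAV hzV hV]]] := lewis_euclid n d A.
have [k2 [W [hAW hzW hW]]] := lewis_euclid n d A'.
have [F6 [F60 F6E F6P]] := spread_net (b := b2) (s := s2) (l := l2) o0 p1 p2 pr0 pr1 e0 e1 K1 Km cardB2 law2 kd d1 L1 hg hz.
pose F1 w := 4 * gram_err b1 s1 (fun=> tt) n V w : R.
pose F2 w := 4 * gram_err b1 s1 (fun=> tt) n W w : R.
pose F3 w := ((80 * d%:R) ^+ 2)^-1 * \sum_r load b1 n (fun i => (d%:R^-1 <= h i)%R%:R) w r ^+ 2 : R.
pose F4 w := \sum_(i < n) (5400 * d%:R < th (l2 (w i)) `^ p * h i)%R%:R : R.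
pose F5 w := La^-1 * \sum_r (#|B2|%:R^-1 `^ (2 / p) +
     rsq (fun j => sk b2 s2 l2 n (trunc p th U (5400 * d%:R)) w (U^~ j) r)) `^ (p / 2) : R.
have L0 : 0 < La := lt_le_trans ltr01 L1.
have gram0 k' (V' : nat -> 'I_k' -> R) w : 0 <= gram_err b1 s1 (fun=> tt) n V' w.
  by apply: sumr_ge0 => i _; apply: sumr_ge0 => j _; exact: sqr_ge0.
have F10 w : 0 <= F1 w by rewrite mulr_ge0.
have F20 w : 0 <= F2 w by rewrite mulr_ge0.
have F30 w : 0 <= F3 w.
  by rewrite mulr_ge0 ?invr_ge0 ?sqr_ge0 // sumr_ge0 // => r _; exact: sqr_ge0.
have F40 w : 0 <= F4 w by apply: sumr_ge0.
have F50 w : 0 <= F5 w.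
  by rewrite mulr_ge0 ?invr_ge0 ?(ltW L0) // sumr_ge0 // => r _; exact: powR_ge0.
exists (fun w => F1 w + (F2 w + (F3 w + (F4 w + (F5 w + F6 w))))); split.
- by move=> w; rewrite !addr_ge0.
- rewrite !ExD.
  have := expect_gram hV; have := expect_gram hW; have := expect_load h0 hU.
  have := expect_tail h0 hU; have := expect_potential hU.
  have : E F6 <= 600^-1.
    apply: le_trans F6E _; apply: le_trans hnet.
    apply: ler_wpM2r; first by rewrite mulr_ge0 // expR_ge0.
    by apply: ler_weXn2l => //; rewrite ler1n.
  rewrite -/F1 -/F2 -/F3 -/F4 -/F5.
  by move=> e6 e5 e4 e3 e2 e1'; exact: six_sixhundredths.
move=> w Fw.
have := F10 w; have := F20 w; have := F30 w; have := F40 w; have := F50 w; have := F60 w.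
move=> f6 f5 f4 f3 f2 f1.
have [lt1 lt2 lt3 lt4 [lt5 lt6]] := six_summands_lt1 f1 f2 f3 f4 f5 f6 Fw.
have quarter (u : R) : 4 * u < 1 -> u <= 2^-1 ^+ 2 by exact: lt_quarter.
have euV z := euclidean_embedding (quarter _ lt1) (hzV z).
have euW z := euclidean_embedding (quarter _ lt2) (hzW z).
have d80 : 0 < 80 * d%:R :> R by rewrite mulr_gt0 // ltr0n.
have load_le r : load b1 n (fun i => (d%:R^-1 <= h i)%R%:R) w r <= 80 * d%:R :> R.
  apply: (le_of_sqr_ratio d80 _ lt3).
  by rewrite (bigD1 r) //= lerDl; apply: sumr_ge0 => r' _; exact: sqr_ge0.
have tail_le i : (i < n)%N -> th (l2 (w i)) `^ p * h i <= 5400 * d%:R.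
  move=> ni; rewrite leNgt; apply/negP => bad; move: lt4; apply/negP; rewrite -leNgt.
  by rewrite /F4 (bigD1 (Ordinal ni)) //= bad lerDl; apply: sumr_ge0.
have pot_le : \sum_r (#|B2|%:R^-1 `^ (2 / p) +
     rsq (fun j => sk b2 s2 l2 n (trunc p th U (5400 * d%:R)) w (U^~ j) r)) `^ (p / 2) <= La.
  by move: lt5; rewrite /F5 ltr_pdivrMl // mulr1 => /ltW.
have up2 z : rmass p (T w (lin U z)) <= rsq z `^ (p / 2) * La.
  by apply: part2_upper tail_le pot_le => //; exact: powR_ge0.
pose Y (x : nat -> R) i := \sum_(j < d) A i j * x j.
have eqS y y' : (forall i, (i < n)%N -> y i = y' i) -> S w y = S w y'.
  by move=> e; apply/funext => r; exact: eq_sk.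
have eqT y y' : (forall i, (i < n)%N -> y i = y' i) -> T w y = T w y'.
  by move=> e; apply/funext => r; exact: eq_sk.
have sens x i : (i < n)%N -> `|Y x i| `^ p <= h i * pmass p n (Y x).
  move=> ni; have [z ez] := hA x; rewrite (eq_pmass _ ez) {1}/Y ez //.
  exact: pmass_sensitivity.
have S_lower x : 2^-1 * \sum_(i < n) Y x i ^+ 2 <= \sum_r S w (Y x) r ^+ 2.
  have [z ez] := hAV x; rewrite (eqS _ _ ez).
  have -> : \sum_(i < n) Y x i ^+ 2 = \sum_(i < n) lin V z i ^+ 2.
    by apply: eq_bigr => i _; rewrite /Y ez.
  by have := euV z; exact: half_le_of_dist.
have S_light x : \sum_r S w (fun i => if d%:R^-1 <= h i then 0 else Y x i) r ^+ 2 <=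
    3 / 2 * \sum_(i < n) (if d%:R^-1 <= h i then 0 else Y x i) ^+ 2.
  have [z ez] := hAW x.
  have e i : (i < n)%N -> (if d%:R^-1 <= h i then 0 else Y x i) = lin W z i.
    move=> ni; rewrite -ez // /A'; case: ifP => // _.
    by rewrite big1 // => j _; rewrite mul0r.
  rewrite (eqS _ _ e).
  have -> : \sum_(i < n) (if d%:R^-1 <= h i then 0 else Y x i) ^+ 2 = \sum_(i < n) lin W z i ^+ 2.
    by apply: eq_bigr => i _; rewrite e.
  by have := euW z; exact: le_three_halves_of_dist.
have Sup x : rmass p (S w (Y x)) <= (320 + 10 * M%:R) * (d%:R `^ (p / 2) * pmass p n (Y x)).
  exact: (part1_upper p1 p2 hd M1 cardB1R (sens x) (S_light x) load_le).
have Tup x : rmass p (T w (Y x)) <= La * pmass p n (Y x).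
  have [z ez] := hA x; rewrite (eqT _ _ ez) (eq_pmass _ ez) [leRHS]mulrC.
  by apply: le_trans (up2 z) _; apply: ler_wpM2r => //; exact: ltW.
have a1 : 0 <= 1 - p / 2 by rewrite subr_ge0 ler_pdivrMr // mul1r ltW.
have kap0 : 0 < K `^ (1 - p / 2) by exact: powR_gt0.
have low1 x : pmass p n (Y x) = 1 ->
    eps / 2048 <= K `^ (1 - p / 2) * rmass p (S w (Y x)) + rmass p (T w (Y x)).
  move=> x1; have [conc|nconc] := leP 2^-1 (\sum_(i < n | K^-1 < `|Y x i| `^ p) `|Y x i| `^ p).
    have := part1_lower p1 p2 K0 (S_lower x) conc => hS.
    have : 4^-1 <= K `^ (1 - p / 2) * rmass p (S w (Y x)).
      have := ler_wpM2l (ltW kap0) hS; rewrite mulrCA -powRD ?(gt_eqF K0) ?implybT //.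
      by rewrite addrA subrK subrr powRr0 mulr1.
    exact: quarter_dominates e1 (rmass_ge0 _ _).
  have [z ez] := hA x; have zs : spread p K n (lin U z).
    split; first by rewrite -(eq_pmass _ ez).
    rewrite (eq_bigl (fun i : 'I_n => ~~ (K^-1 < `|Y x i| `^ p))); last first.
      by move=> i; rewrite -leNgt /Y ez.
    rewrite (eq_bigr (fun i : 'I_n => `|Y x i| `^ p)); last by move=> i _; rewrite /Y ez.
    move: x1; rewrite /pmass (bigID (fun i : 'I_n => K^-1 < `|Y x i| `^ p)) /=.
    by move: (\sum_(i < n | _) _) (\sum_(i < n | ~~ _) _) nconc => u v; exact: half_of_sum.
  have := F6P w lt6 up2 z zs; rewrite -(eqT _ _ ez) => h'; apply: le_trans h' _.
  by rewrite lerDr mulr_ge0 ?rmass_ge0 ?ltW.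
move=> x; rewrite -/(Y x); split; last first.
  rewrite mulrDl; apply: lerD; last exact: Tup.
  apply: le_trans (ler_wpM2l (ltW kap0) (Sup x)) _.
  rewrite mulrCA -!mulrA; apply: ler_wpM2l; first by rewrite addr_ge0 // mulr_ge0.
  rewrite mulrA; apply: ler_wpM2r; first exact: pmass_ge0.
  (* d <= K turns d^(p/2) into K^(p/2), and the two powers multiply to K. *)
  apply: (@le_trans _ _ (K `^ (1 - p / 2) * K `^ (p / 2))).
    apply: ler_wpM2l; first exact: ltW.
    by apply: ge0_ler_powR; rewrite ?nnegrE ?(ltW K0) // divr_ge0 // ltW.
  by rewrite -powRD ?(gt_eqF K0) ?implybT // subrK powRr1 // ltW.
have := pmass_ge0 p n (Y x); rewrite le_eqVlt => /predU1P[<-|N0].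
  by rewrite mulr0 addr_ge0 ?rmass_ge0 // mulr_ge0 ?rmass_ge0 ?ltW.
(* Both sides are homogeneous of degree p in x, which reduces to mass 1. *)
pose N := pmass p n (Y x); pose la := N^-1 `^ p^-1.
have la0 : 0 < la by rewrite powR_gt0 // invr_gt0.
have lap : `|la| `^ p = N^-1.
  by rewrite gtr0_norm // -powRrM mulVf ?gt_eqF // powRr1 // invr_ge0 ltW.
have eY : Y (fun j => la * x j) = fun i => la * Y x i.
  by apply/funext => i; rewrite /Y mulr_sumr; apply: eq_bigr => j _; rewrite mulrCA.
have := low1 (fun j => la * x j); rewrite eY pmassZ lap mulVf ?gt_eqF // => /(_ erefl).
have -> : S w (fun i => la * Y x i) = fun r => la * S w (Y x) r.
  by apply/funext => r; rewrite skZ.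
have -> : T w (fun i => la * Y x i) = fun r => la * T w (Y x) r.
  by apply/funext => r; rewrite skZ.
rewrite !rmassZ lap mulrCA -mulrDr ler_pdivlMl ?invr_gt0 // mulrC.
by rewrite -/N.
Qed.


End Assembly.

(** * Choice of the constants *)

Section Constants.
Context {R : realType}.

Lemma ln2_ge_half : 2^-1 <= ln 2 :> R.
Proof.
rewrite -ler_expR lnK ?posrE // -[leRHS]invrK -[leLHS]invrK -expRN lef_pV2 ?posrE ?invr_gt0 ?expR_gt0 //.
have := @expR_ge1Dx R (- 2^-1); lra.
Qed.

Lemma two_le_expR1 : 2 <= expR 1 :> R.
Proof. have := @expR_ge1Dx R 1; lra. Qed.

(** A square s^2 makes the crude bound ln s <= s sufficient: the left side is then at most (|c| + 4)
    s. *)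
Lemma linear_beats_ln (a c : R) : 0 < a -> exists s : nat, (1 < s)%N /\
  c + 2 * ln (s ^ 2)%:R <= a * (s ^ 2)%:R.
Proof.
move=> a0; pose x := Num.max 0 ((`|c| + 4) / a).
exists (Num.truncn x).+2; split => //; set s := (Num.truncn x).+2.
have sx : x <= s%:R.
  apply: ltW; apply: lt_le_trans (truncnS_gt x) _; rewrite ler_nat; exact: leqnSn.
have s1 : 1 <= s%:R :> R by rewrite ler1n.
have as' : `|c| + 4 <= a * s%:R.
  by rewrite mulrC -ler_pdivrMr //; apply: le_trans sx; rewrite le_max lexx orbT.
have ls : ln s%:R <= s%:R :> R by apply/ltW/ln_sublinear; lra.
rewrite natrX lnXn; last lra.
apply: (@le_trans _ _ (`|c| * s%:R + 4 * s%:R)).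
  apply: lerD; last by move: (ln _) ls => u; rewrite mulr2n; lra.
  by apply: le_trans (ler_norm c) _; rewrite ler_peMr.
by rewrite -mulrDl expr2 mulrA; apply: ler_wpM2r; lra.
Qed.

Lemma net_exponent (x e : R) (d g : nat) : 0 < x -> (g.*2.+1)%:R <= x ->
  d%:R * ln x + 1 + ln 600 <= e -> (g.*2.+1)%:R ^+ d * (2 * expR (- e)) <= 600^-1.
Proof.
move=> x0 gx he.
apply: (@le_trans _ _ (expR (d%:R * ln x) * (expR 1 * expR (- e)))).
  apply: ler_pM; rewrite ?exprn_ge0 ?mulr_ge0 ?expR_ge0 //; last first.
    by apply: ler_wpM2r; [exact: expR_ge0|exact: two_le_expR1].
  rewrite expRM_natl lnK ?posrE //; apply: lerXn2r; rewrite ?nnegrE // ltW //.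
rewrite -!expRD -[leRHS]lnK ?posrE ?invr_gt0 // ler_expR lnV ?posrE //; lra.
Qed.

Lemma level_ratio_ge0 (p : R) : 1 <= p -> p < 2 ->
  0 <= 2 `^ (2 / p - 1) / (2 `^ (2 / p - 1) - 1) :> R.
Proof.
move=> p1 p2; have p0 : 0 < p by lra.
rewrite divr_ge0 ?powR_ge0 // subr_ge0.
have be0 : 0 <= 2 / p - 1 by rewrite subr_ge0 ler_pdivlMr // mul1r ltW.
by rewrite -[leLHS](powRr0 2); apply: ler_powR => //; rewrite ler1n.
Qed.

Lemma ln_nat_bounds (d : nat) : (2 <= d)%N ->
  [/\ 2^-1 <= ln d%:R :> R, ln d%:R <= d%:R :> R & 1 <= d%:R * ln d%:R :> R].
Proof.
move=> d2; have D2 : 2 <= d%:R :> R by rewrite ler_nat.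
have lh : 2^-1 <= ln d%:R :> R.
  by apply: le_trans ln2_ge_half _; rewrite ler_ln ?posrE //; lra.
split => //; first by apply/ltW/ln_sublinear; lra.
apply: (@le_trans _ _ (2 * 2^-1)); first lra.
by apply: ler_pM; rewrite ?invr_ge0.
Qed.

Lemma ln_trunc_ratio (C d : nat) : (0 < C)%N -> (0 < d)%N ->
  ln (2 * (5400 * d%:R * (2 * (C * d ^ 2))%:R)) =
  ln (2 * (5400 * 2)) + ln C%:R + 3 * ln d%:R :> R.
Proof.
move=> C0 d0; have dR : 0 < d%:R :> R by rewrite ltr0n.
have CR : 0 < C%:R :> R by rewrite ltr0n.
have -> : 2 * (5400 * d%:R * (2 * (C * d ^ 2))%:R) = 2 * (5400 * 2) * C%:R * d%:R ^+ 3 :> R.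
  by rewrite !natrM; ring.
have b0 : 0 < 2 * (5400 * 2) :> R by rewrite !mulr_gt0.
rewrite lnM ?posrE ?exprn_gt0 ?(mulr_gt0 b0) // lnM ?posrE // lnXn //.
by rewrite (mulr_natl (ln d%:R)). 
Qed.

(** The logarithm c of C is bounded crudely by C, so that the coefficient of C d l does not itself
    depend on C; this avoids a circular choice in [parameters]. *)
Lemma truncation_growth (Cp b C c d l t : R) : 0 <= Cp -> 0 <= b -> 1 <= C -> 0 <= c -> c <= C ->
  0 <= d -> 2^-1 <= l -> 1 <= d * l -> 2^-1 <= t ->
  600 * (1 + 9 * d * (Cp + (b + c + 3 * l) / t)) <=
  600 * (1 + 9 * (2 * Cp + 4 * b + 10)) * (C * (d * l)).
Proof.
move=> Cp0 b0 C1 c0 cC d0 lh dl th.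
have h1 : (b + c + 3 * l) / t <= (b + C + 3 * l) * 2.
  apply: ler_pM; [lra|rewrite invr_ge0; lra|lra|].
  by rewrite -[leRHS]invrK lef_pV2 ?posrE ?invr_gt0 //; lra.
have Cl1 : 1 <= 2 * (C * l).
  have : 1 * 2^-1 <= C * l by apply: ler_pM => //; lra.
  lra.
have h2 : Cp + (b + c + 3 * l) / t <= C * l * (2 * Cp + 4 * b + 10).
  apply: le_trans (_ : _ <= Cp + (b + C + 3 * l) * 2) _; first by rewrite lerD2l.
  have a1 : Cp * 1 <= Cp * (2 * (C * l)) by apply: ler_wpM2l.
  have a2 : b * 1 <= b * (2 * (C * l)) by apply: ler_wpM2l.
  have a3 : C * 1 <= C * (2 * l) by apply: ler_wpM2l; lra.
  have a4 : 1 * l <= C * l by apply: ler_wpM2r; lra.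
  have -> : C * l * (2 * Cp + 4 * b + 10) =
    Cp * (2 * (C * l)) + 2 * (b * (2 * (C * l))) + 2 * (C * (2 * l)) + 6 * (C * l) by ring.
  lra.
have h3 := ler_wpM2l d0 h2.
have h4 : 1 * 1 <= C * (d * l) by apply: ler_pM.
have -> : 600 * (1 + 9 * (2 * Cp + 4 * b + 10)) * (C * (d * l)) =
  600 * (C * (d * l) + 9 * (d * (C * l * (2 * Cp + 4 * b + 10)))) by ring.
rewrite -(mulrA 9); apply: ler_wpM2l; first lra.
by apply: lerD; [lra|apply: ler_wpM2l; lra].
Qed.

Lemma grid_size (eps d La c4 C : R) : 0 < eps -> 0 <= d -> 0 <= La -> 1 <= C * d ^+ 3 ->
  d * La <= c4 * (C * d ^+ 3) ->
  let g := (Num.truncn (2048 * (d * La) / eps)%R).+1 in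
  8 * d * La <= eps / 256 * g%:R /\
  (g.*2.+1)%:R <= 3 * (2048 * c4 / eps + 1) * (C * d ^+ 3).
Proof.
move=> e0 d0 L0 hC hL g.
have x0 : 0 <= 2048 * (d * La) / eps by rewrite divr_ge0 ?mulr_ge0 // ltW.
have /andP[g1 g2] := truncn_itv x0; split.
  have := ler_wpM2l (ltW e0) (ltW g2); rewrite mulrC divfK ?gt_eqF // -/g => h.
  have -> : eps / 256 * g%:R = eps * g%:R / 256 by ring.
  by rewrite -mulrA; lra.
have g3 : g%:R <= 2048 * (d * La) / eps + 1 by rewrite /g -[leLHS]natr1 lerD2r.
have h : 2048 * (d * La) / eps <= 2048 * c4 / eps * (C * d ^+ 3).
  have -> : 2048 * c4 / eps * (C * d ^+ 3) = 2048 * (c4 * (C * d ^+ 3)) / eps by ring.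
  by apply: ler_wpM2r; [rewrite invr_ge0 ltW|apply: ler_wpM2l].
have g0 : 1 <= g%:R :> R by rewrite ler1n.
rewrite -[leLHS]natr1 -mul2n natrM.
have -> : 3 * (2048 * c4 / eps + 1) * (C * d ^+ 3) =
  3 * (2048 * c4 / eps * (C * d ^+ 3)) + 3 * (C * d ^+ 3) by ring.
lra.
Qed.

Lemma exponent_growth (a c lC l u e6 C : R) : 0 <= c -> 0 <= lC -> 0 <= e6 -> 2^-1 <= l ->
  1 <= u * l -> 0 <= u -> 2 * c + 4 + e6 + 2 * lC <= a * C ->
  u * (c + lC + 3 * l) + 1 + e6 <= a * (C * (u * l)).
Proof.
move=> c0 lC0 e60 lh ul u0 h.
have h1 := ler_wpM2r (le_trans ler01 ul) h.
rewrite -mulrA in h1; apply: le_trans h1.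
have a1 : (c + lC) * u <= (c + lC) * u * (2 * l).
  by rewrite ler_peMr // ?mulr_ge0 ?addr_ge0 //; lra.
have a2 : e6 * 1 <= e6 * (u * l) by apply: ler_wpM2l.
have -> : (2 * c + 4 + e6 + 2 * lC) * (u * l) =
  (c + lC) * u * (2 * l) + 4 * (u * l) + e6 * (u * l) by ring.
have -> : u * (c + lC + 3 * l) = (c + lC) * u + 3 * (u * l) by ring.
lra.
Qed.

(** The difficulty is circular: [La], hence the grid size g, grows with C0, and the logarithm of the
    net size is d times that of a constant times C0 d^3. It closes because C0 enters there only
    through ln C0, while the exponent eps K / 256 is linear in C0. *)
Lemma parameters (p eps : R) : 1 <= p -> p < 2 -> 0 < eps -> eps <= 1 ->
  exists C0 : nat, exists c3 : R, [/\ (0 < C0)%N, 0 < c3 &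
  forall d : nat, (2 <= d)%N ->
  exists (La : R) (g : nat),
  [/\ 600 * (1 + 9 * d%:R *
        (2 `^ (2 / p - 1) / (2 `^ (2 / p - 1) - 1) +
         ln (2 * (5400 * d%:R * (2 * (C0 * d ^ 2))%:R)) / ln 2)) <= La,
      8 * d%:R * La <= eps / 256 * g%:R,
      (g.*2.+1)%:R ^+ d * (2 * expR (- (eps * (C0%:R * (d%:R * ln d%:R)) / 256))) <= 600^-1,
      [/\ 1 <= d%:R * ln d%:R :> R, 1 <= C0%:R * (d%:R * ln d%:R) :> R,
       C0%:R * (d%:R * ln d%:R) <= (C0 * d ^ 2)%:R :> R &
       d%:R <= C0%:R * (d%:R * ln d%:R) :> R] &
      La <= c3 * (d%:R * ln d%:R)]].
Proof.
move=> p1 p2 e0 e1.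
move: (level_ratio_ge0 p1 p2); move: (2 `^ (2 / p - 1) / (2 `^ (2 / p - 1) - 1)) => Cp Cp0.
have [b hb] : exists b : R, b = ln (2 * (5400 * 2)) by eexists.
have b0 : 0 <= b by rewrite hb; apply: ln_ge0; lra.
have [c4 hc4] : exists c4 : R, c4 = 600 * (1 + 9 * (2 * Cp + 4 * b + 10)) by eexists.
have c4g : 1 <= c4 by rewrite hc4; lra.
have [c5 hc5] : exists c5 : R, c5 = 2048 * c4 / eps + 1 by eexists.
have c5g : 1 <= c5.
  by rewrite hc5 lerDr; apply: divr_ge0; [apply: mulr_ge0 => //; exact: le_trans ler01 c4g|exact: ltW].
have l3 : 0 <= ln (3 * c5) by apply: ln_ge0; lra.
have l6 : 0 <= ln 600 :> R by apply: ln_ge0; lra.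
have e256 : 0 < eps / 256 by rewrite divr_gt0.
have [s [s1 hs]] := linear_beats_ln (2 * ln (3 * c5) + 4 + ln 600) e256.
have : (1 < s ^ 2)%N by rewrite -(exp1n 2) ltn_exp2r.
move: (s ^ 2)%N hs => C0 hs C0n.
have C0n0 : (0 < C0)%N := ltnW C0n.
have C2 : 2 <= C0%:R :> R by rewrite ler_nat.
have C00 : 0 < C0%:R :> R by rewrite ltr0n.
have lC00 : 0 <= ln C0%:R :> R by apply: ln_ge0; rewrite ler1n.
have lC0 : ln C0%:R <= C0%:R :> R by apply/ltW/ln_sublinear.
exists C0, (c4 * C0%:R); split => //; first by rewrite mulr_gt0 // (lt_le_trans ltr01).
move=> d d2; have [lh ld dl] := ln_nat_bounds d2.
have d0 : (0 < d)%N by exact: ltnW.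
have dR : 0 < d%:R :> R by rewrite ltr0n.
rewrite ln_trunc_ratio // -hb.
have c53 : 0 < 3 * c5 by rewrite mulr_gt0 // (lt_le_trans ltr01).
have : ln (3 * c5 * (C0%:R * d%:R ^+ 3)) = ln (3 * c5) + ln C0%:R + 3 * ln d%:R.
  have cd : 0 < C0%:R * d%:R ^+ 3 :> R by rewrite mulr_gt0 ?exprn_gt0.
  rewrite lnM ?posrE // [ln (C0%:R * _)]lnM ?posrE ?exprn_gt0 // lnXn //.
  by rewrite (mulr_natl (ln d%:R)) addrA.
move: (ln d%:R) lh ld dl => l lh ld dl hlx.
have l0 : 0 <= l by apply: le_trans lh; rewrite invr_ge0.
have C1 : 1 <= C0%:R :> R by rewrite ler1n.
have La_le := truncation_growth Cp0 b0 C1 lC00 lC0 (ltW dR) lh dl ln2_ge_half.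
rewrite -hc4 in La_le.
have Cl0 : 0 <= Cp + (b + ln C0%:R + 3 * l) / ln 2.
  apply: addr_ge0 => //; apply: divr_ge0; last by apply: le_trans ln2_ge_half; rewrite invr_ge0.
  by rewrite !addr_ge0 // mulr_ge0.
move: (Cp + _) Cl0 La_le => Cl Cl0; set La := 600 * _ => La_le.
have La0 : 0 <= La by rewrite mulr_ge0 // addr_ge0 // !mulr_ge0 // ltW.
have Cd3 : 1 <= C0%:R * d%:R ^+ 3 :> R.
  by apply: mulr_ege1 => //; apply: exprn_ege1; rewrite ler1n.
have dLa : d%:R * La <= c4 * (C0%:R * d%:R ^+ 3).
  apply: le_trans (ler_wpM2l (ltW dR) La_le) _.
  have -> : d%:R * (c4 * (C0%:R * (d%:R * l))) = c4 * (C0%:R * (d%:R ^+ 2 * l)) by ring.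
  apply: ler_wpM2l; first exact: le_trans ler01 c4g.
  apply: ler_wpM2l; first exact: ltW.
  by rewrite [d%:R ^+ 3]exprSr; apply: ler_wpM2l => //; apply: exprn_ge0; exact: ltW.
have := grid_size e0 (ltW dR) La0 Cd3 dLa.
move: (Num.truncn _).+1 => g /= [g1 g2]; rewrite -hc5 in g2.
exists La, g; split => //.
- have x0 : 0 < 3 * c5 * (C0%:R * d%:R ^+ 3) by rewrite mulr_gt0 // (lt_le_trans ltr01).
  apply: (net_exponent x0 g2); rewrite hlx.
  have := exponent_growth l3 lC00 l6 lh dl (ltW dR) hs.
  by rewrite [eps / 256 * _]mulrAC.
- have Cl2 : 1 <= C0%:R * l.
    have := ler_pM (ler0n R 2) (_ : 0 <= 2^-1) C2 lh.
    by rewrite mulfV ?pnatr_eq0 // => ->; rewrite ?invr_ge0.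
  split => //.
  + exact: mulr_ege1.
  + rewrite natrM natrX; apply: ler_wpM2l; first exact: ltW.
    by rewrite expr2; apply: ler_wpM2l => //; exact: ltW.
  + by rewrite mulrCA; apply: ler_peMr => //; exact: ltW.
- by rewrite -mulrA.
Qed.

End Constants.

(** * The embedding for the concrete pair of sketches *)

Section Core.
Context {R : realType}.

Definition first_sketch {r1 r2 : nat} {L : finType} n :=
  sk (fun o : column 'I_r1 'I_r2 L => o.1.1) (fun o => o.1.2) (fun=> tt) n (fun _ _ => 1 : R).
Definition second_sketch {r1 r2 : nat} {L : finType} (th : L -> R) n :=
  sk (fun o : column 'I_r1 'I_r2 L => o.2.1.1) (fun o => o.2.1.2) (fun o => o.2.2) n (fun=> th).

Lemma sparse_embedding (p eps : R) : 1 <= p -> p < 2 -> 0 < eps -> eps <= 1 ->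
  exists c C : R, [/\ 0 < c, 0 < C & forall d n : nat, (2 <= d)%N ->
  exists (r1 r2 : nat) (kappa : R) (o0 : column 'I_r1 'I_r2 (level (n + 3))),
  [/\ (0 < r1)%N /\ (0 < r2)%N, 0 < kappa, (r1 + r2)%:R <= C * d%:R ^+ 2 &
  forall A : nat -> nat -> R, exists F : (nat -> _) -> R,
  [/\ forall w, 0 <= F w, Ex o0 (cpr (levelp eps (N := n + 3))) n F <= 100^-1 &
  forall w, F w < 1 -> forall x : nat -> R,
    let y i := \sum_(j < d) A i j * x j in
    let N := kappa `^ p * rmass p (first_sketch n w y) +
             rmass p (second_sketch (levelv p (N := n + 3)) n w y) in
    c * pmass p n y <= N /\ N <= C * (d%:R * ln d%:R) * pmass p n y]]].
Proof.
move=> p1 p2 e0 e1; have p0 : 0 < p := lt_le_trans ltr01 p1.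
have [C0 [c3 [C0n c30 hpar]]] := parameters p1 p2 e0 e1.
have [M hM] : exists M : nat, 900 * 900 <= M%:R :> R.
  exists (Num.truncn (900 * 900 : R)).+1; exact: ltW (truncnS_gt _).
have M0 : (0 < M)%N.
  by rewrite -(ltr0n R); apply: lt_le_trans hM; rewrite mulr_gt0.
pose C : R := (320 + 10 * M%:R) * C0%:R + c3 + M%:R + 2 * C0%:R.
have c320 : 0 <= (320 + 10 * M%:R) * C0%:R :> R by rewrite mulr_ge0 // addr_ge0 // mulr_ge0.
exists (eps / 2048), C; split; first by rewrite divr_gt0.
  rewrite /C; apply: ltr_wpDr; first exact: mulr_ge0.
  by apply: ltr_wpDr => //; exact: ltr_wpDl.
move=> d n d2; have d0 : (0 < d)%N := ltnW d2.
have [La [g [hLa hg hnet [dl K1 Km dK] hLc]]] := hpar _ d2.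
set K := C0%:R * _ in hnet K1 Km dK.
have K0 : 0 < K := lt_le_trans ltr01 K1.
pose r1 := (M * d ^ 2)%N; pose m := (C0 * d ^ 2)%N; pose r2 := (2 * m)%N.
have m0 : (0 < m)%N by rewrite muln_gt0 C0n expn_gt0 d0.
have r10 : (0 < r1)%N by rewrite muln_gt0 M0 expn_gt0 d0.
have r20 : (0 < r2)%N by rewrite muln_gt0.
pose o0 : column 'I_r1 'I_r2 (level (n + 3)) :=
  ((Ordinal r10, true), ((Ordinal r20, true), None)).
have c1 : (0 < #|'I_r1|)%N by rewrite card_ord.
have c2 : (0 < #|'I_r2|)%N by rewrite card_ord.
have q0 := levelp_ge0 (N := n + 3) e0 e1.
have qs := sum_levelp eps (n + 3).
exists r1, r2, (K `^ ((1 - p / 2) / p)), o0; split => //.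
- exact: powR_gt0.
- have -> : (r1 + r2)%:R = (M%:R + 2 * C0%:R) * d%:R ^+ 2 :> R.
    by rewrite /r1 /r2 /m natrD !natrM; ring.
  apply: ler_wpM2r; first by rewrite exprn_ge0.
  by rewrite /C -addrA lerDr addr_ge0 // ltW.
move=> A.
have [F [F0 FE FP]] := embedding_event o0 p1 p2 (cpr_ge0 q0) (sum_cpr c1 c2 qs)
  (law_first c1 c2 qs) (law_second _ c1 c2) e0 e1 d0 (card_ord r1) (card_ord r2) m0 hM K1 Km dK hLa hg hnet A.
exists F; split => // w Fw x y N.
have -> : N = K `^ (1 - p / 2) * rmass p (first_sketch n w y) +
  rmass p (second_sketch (levelv p (N := n + 3)) n w y).
  by rewrite /N -powRrM divfK ?gt_eqF.
have [low up] := FP w Fw x; split => //.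
apply: le_trans up _; apply: ler_wpM2r; first exact: pmass_ge0.
have dl0 : 0 <= d%:R * ln d%:R :> R := le_trans ler01 dl.
apply: (@le_trans _ _ (((320 + 10 * M%:R) * C0%:R + c3) * (d%:R * ln d%:R))).
  by rewrite [leRHS]mulrDl; apply: lerD => //; rewrite /K mulrA.
apply: ler_wpM2r => //; by rewrite /C -[leRHS]addrA lerDl addr_ge0 // mulr_ge0.
Qed.

End Core.

(** * The probability space over the standard reals *)

Import Rstruct Rstruct_topology.

Lemma sum_ltn_le (K : realDomainType) r x : \sum_(k < r) ((k < x)%N%:R : K) <= x%:R.
Proof.
rewrite -natr_sum ler_nat; elim: r x => [|r IH] [|x]; rewrite ?big_ord0 //; first by rewrite big1.
rewrite big_ord_recl -[leqRHS]add1n; apply: leq_add => //; exact: IH.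
Qed.

Lemma levelp_nonzeros (K : realType) (eps : K) N : 0 < eps ->
  \sum_(t : level N) levelp eps t * (t != None).+1%:R <= 1 + eps.
Proof.
move=> e0; apply: (@le_trans _ _ (\sum_t levelp eps t + \sum_(k < N) levelp eps (Some k))).
  rewrite !sum_level -addrA; apply: lerD; first by rewrite mulr1.
  by rewrite -big_split; apply: ler_sum => k _; rewrite mulr2n mulrDr mulr1.
rewrite sum_levelp lerD2l; exact: levelp_active.
Qed.

Section FiniteProbability.
Context {O : finType} (o0 : O) (pr : O -> R).
Hypothesis pr0 : forall o, 0 <= pr o.
Hypothesis pr1 : \sum_o pr o = 1.

Lemma Un_cv_sum (I : Type) (e : seq I) (c : I -> R) (s : I -> nat -> R) (g : I -> R) :
  (forall i, Un_cv (s i) (g i)) ->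
  Un_cv (fun N => \sum_(i <- e) c i * s i N) (\sum_(i <- e) c i * g i).
Proof.
move=> h; elim: e => [|i e IH].
  by move=> x x0; exists 0%N => N _; rewrite !big_nil /Rdist Rminus_diag Rabs_R0.
rewrite big_cons; have -> : (fun N => \sum_(j <- i :: e) c j * s j N) =
   (fun N => Rplus (Rmult (c i) (s i N)) (\sum_(j <- e) c j * s j N)).
  by apply/funext => N; rewrite big_cons.
apply: CV_plus IH; apply: CV_mult (h i).
by move=> x x0; exists 0%N => N _; rewrite /Rdist Rminus_diag Rabs_R0.
Qed.

(** Expectation is a finite linear combination of point values, so pointwise limits pass through
    it. *)
Lemma Un_cv_Ex n (s : nat -> (nat -> O) -> R) (g : (nat -> O) -> R) :
  (forall w, Un_cv (fun N => s N w) (g w)) ->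
  Un_cv (fun N => Ex o0 pr n (s N)) (Ex o0 pr n g).
Proof.
elim: n s g => [|n IH] s g h /=; first exact: h.
apply: Un_cv_sum => o; exact: (IH (fun N w => s N (upd w n o)) (fun w => g (upd w n o))).
Qed.

Variable n : nat.
Definition Pr (E : (nat -> O) -> Prop) : R := Ex o0 pr n (fun w => `[< E w >]%:R).

Lemma Pr_ge0 E : True -> Rle 0 (Pr E).
Proof. by move=> _; apply/RleP/Ex_ge0. Qed.

Lemma Pr_full : Pr (fun=> True) = 1.
Proof.
rewrite /Pr -[RHS](Ex_cst o0 pr1 n); apply: eq_Ex => w.
by case: asboolP.
Qed.

Lemma Pr_sigma_add (F : nat -> (nat -> O) -> Prop) :
  (forall k : nat, True) ->
  (forall k l w, k <> l -> F k w -> F l w -> False) ->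
  infinite_sum (fun k => Pr (F k)) (Pr (fun w => exists k, F k w)).
Proof.
move=> _ disj.
suff : Un_cv (fun N => Ex o0 pr n (fun w => \sum_(0 <= k < N.+1) (`[< F k w >]%:R : R)))
   (Ex o0 pr n (fun w => `[< exists k, F k w >]%:R)).
  congr (Un_cv _ _); apply/funext => N; rewrite sum_f_R0E Ex_sum; exact: erefl.
(* By disjointness the partial sums at w are eventually constant, equal to the indicator of the
   union. *)
apply: Un_cv_Ex => w; case: asboolP => [[k0 Fk]|nF] x x0; last first.
  exists 0%N => N _; rewrite big1 => [|k _]; first by rewrite /Rdist Rminus_diag Rabs_R0.
  by case: asboolP => // Fk; case: nF; exists k.
exists k0 => N /ssrnat.leP kN; rewrite (bigD1_seq k0) ?mem_index_iota ?iota_uniq //=.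
rewrite big1 ?addr0 => [|k /eqP kk]; last first.
  by case: asboolP => // Fk'; case: (disj k k0 w kk Fk' Fk).
by case: asboolP => // _; rewrite /Rdist Rminus_diag Rabs_R0.
Qed.

(** The measure has finite support, namely sequences equal to [o0] from n on, so all sets can be
    declared measurable. *)
Definition product_space : prob_space (nat -> O) :=
  {| measurable := fun _ => True; prob := Pr;
     meas_full := I; meas_compl := fun _ _ => I; meas_cunion := fun _ _ => I;
     prob_nonneg := Pr_ge0; prob_full := Pr_full; prob_sigma_add := Pr_sigma_add |}.

Lemma rsumE m (f : nat -> R) : rsum m f = \sum_(i < m) f i.
Proof. by elim: m => [|m IH] /=; rewrite ?big_ord0 // big_ord_recr /= IH. Qed.

Lemma nat_expect_le r (X : (nat -> O) -> nat) :
  nat_expect product_space r X <= Ex o0 pr n (fun w => (X w)%:R).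
Proof.
rewrite /nat_expect rsumE /= /Pr -Ex_sum; apply: le_Ex => // w.
apply: (@le_trans _ _ (\sum_(k < r) (k < X w)%N%:R)).
  by apply: ler_sum => k _; case: asboolP => [/ssrnat.ltP ->//|_]; exact: ler0n.
exact: sum_ltn_le.
Qed.

End FiniteProbability.

(** * The explicit matrix and the translation of norms and counts *)

Section Bridge.

(** The two conventions at 0 agree for nonzero exponents only, since MathComp has 0 to the power 0
    equal to 1. *)
Lemma Defs_powRE x a : 0 <= x -> a != 0 -> Defs.powR x a = x `^ a.
Proof.
move=> x0 a0; rewrite /Defs.powR; case: Req_dec_T => [->|/eqP xn].
  by rewrite R0E powR0.
by rewrite /powR -R0E (negPf xn) /Rpower RexpE RlnE.
Qed.

Lemma pnormE p m y : 0 < p -> pnorm p m y = pmass p m y `^ p^-1.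
Proof.
move=> p0; rewrite /pnorm rsumE RdivE div1r.
have -> : \sum_(i < m) Defs.powR (Rabs (y i)) p = pmass p m y.
  by apply: eq_bigr => i _; rewrite RabsE Defs_powRE ?gt_eqF.
by rewrite Defs_powRE ?pmass_ge0 // gt_eqF // invr_gt0.
Qed.

Lemma mxvE k M x i : mxv k M x i = \sum_(j < k) M i j * x j.
Proof. exact: rsumE. Qed.

Lemma nnz_colE r M j : nnz_col r M j = (\sum_(i < r) (M i j != 0%R))%N.
Proof.
elim: r => [|r IH] /=; rewrite ?big_ord0 // big_ord_recr /= IH.
by case: Req_dec_T => /eqP h; rewrite ?h ?(negPf h).
Qed.

Context {r1 r2 N : nat} (kappa p : R).
Hypotheses (k0 : 0 < kappa) (p1 : 1 <= p).

Definition entry (o : column 'I_r1 'I_r2 (level N)) (i : nat) : R :=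
  if (i < r1)%N then (if val o.1.1 == i then kappa * sgn o.1.2 else 0)
  else if val o.2.1.1 == (i - r1)%N then sgn o.2.1.2 * levelv p o.2.2 else 0.

Lemma sgn_neq0 e : sgn e != 0 :> R.
Proof. by case: e; rewrite /sgn ?oppr_eq0 oner_eq0. Qed.

(** The first block always contributes one non-zero, as [kappa] is positive; the second contributes
    one exactly when the column is active. *)
Lemma count_entry o :
  (\sum_(i < r1 + r2) (entry o i != 0%R))%N = (o.2.2 != None).+1.
Proof.
rewrite big_split_ord /= (bigD1 o.1.1) //= big1 => [|i io]; last first.
  by move: io; rewrite eq_sym /entry ltn_ord val_eqE => /negPf ->; rewrite eqxx.
have kn : kappa * sgn o.1.2 != 0.
  by apply: mulf_neq0; [rewrite gt_eqF|exact: sgn_neq0].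
rewrite {1}/entry ltn_ord eqxx kn addn0 add1n; congr _.+1.
rewrite (bigD1 o.2.1.1) //= big1 => [|i io]; last first.
  by move: io; rewrite eq_sym /entry ltnNge leq_addr /= addKn val_eqE => /negPf ->; rewrite eqxx.
rewrite /entry ltnNge leq_addr /= addKn eqxx addn0 mulf_eq0 (negPf (sgn_neq0 _)) /=.
case: o.2.2 => [k|] /=; last by rewrite eqxx.
by rewrite gt_eqF // (levelv_gt0 p k).
Qed.

Lemma pmass_entry n w y :
  pmass p (r1 + r2) (mxv n (fun i j => entry (w j) i) y) =
  kappa `^ p * rmass p (first_sketch n w y) + rmass p (second_sketch (levelv p (N := N)) n w y).
Proof.
rewrite /pmass big_split_ord /=; congr (_ + _).
  have -> : kappa `^ p = `|kappa| `^ p by rewrite ger0_norm ?ltW.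
  rewrite -rmassZ; apply: eq_bigr => i _; congr (`| _ | `^ _).
  rewrite mxvE /first_sketch /sk mulr_sumr; apply: eq_bigr => j _.
  rewrite /entry ltn_ord /ent val_eqE; case: ifP => _; last by rewrite !mul0r mulr0.
  by rewrite mulr1 mulrA.
apply: eq_bigr => i _; congr (`| _ | `^ _); rewrite mxvE; apply: eq_bigr => j _.
by rewrite /entry ltnNge leq_addr /= addKn /ent val_eqE.
Qed.

End Bridge.

Local Open Scope R_scope.

Lemma embedding_theorem (p eps : R) :
  1 <= p < 2 -> 0 < eps < 1 ->
  exists c C : R, 0 < c /\ 0 < C /\
  forall d n : nat, le 2 d -> le 1 n ->
  exists r : nat, INR r <= C * (INR d) ^ 2 /\
  exists (Omega : Type) (PS : prob_space Omega)
         (Pi : Omega -> nat -> nat -> R),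
    (forall w j, lt j n -> le (nnz_col r (Pi w) j) 2) /\
    (forall j, lt j n ->
       (forall k, measurable PS (fun w => lt k (nnz_col r (Pi w) j))) /\
       nat_expect PS r (fun w => nnz_col r (Pi w) j) <= 1 + eps) /\
    (forall A : nat -> nat -> R,
       exists E : Omega -> Prop, measurable PS E /\ prob PS E >= 99 / 100 /\
       forall w, E w -> forall x : nat -> R,
         c * pnorm p n (mxv d A x)
           <= pnorm p r (mxv n (Pi w) (mxv d A x)) /\
         pnorm p r (mxv n (Pi w) (mxv d A x))
           <= C * Defs.powR (INR d * Rpower.ln (INR d)) (1 / p) * pnorm p n (mxv d A x)).
Proof.
case=> /RleP p1 /RltP p2 [/RltP e0 /RltP e1].
have [c [C [c0 C0 main]]] := sparse_embedding p1 p2 e0 (ltW e1).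
have p0 : (0 < p)%R := lt_le_trans ltr01 p1.
have pi0 : (0 <= p^-1)%R by rewrite invr_ge0 ltW.
(* The upper constant must serve the row count, which needs C, and the norm bound, which needs
   C^(1/p) after taking p-th roots; the sum dominates both. *)
exists (c `^ p^-1)%R, (C + C `^ p^-1)%R; split; first exact/RltP/powR_gt0.
split; first by apply/RltP; rewrite addr_gt0 // powR_gt0.
move=> d n /ssrnat.leP d2 _.
have [r1 [r2 [kappa [o0 [[r10 r20] k0 hr emb]]]]] := main d n d2.
have c1 : (0 < #|'I_r1|)%N by rewrite card_ord.
have c2 : (0 < #|'I_r2|)%N by rewrite card_ord.
have q0 := levelp_ge0 (N := n + 3) e0 (ltW e1).
have qs := sum_levelp eps (n + 3).
exists (r1 + r2)%N; split.
  apply/RleP; rewrite INRE RpowE INRE; apply: le_trans hr _.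
  by apply: ler_wpM2r; rewrite ?exprn_ge0 // lerDl powR_ge0.
exists _, (product_space o0 (cpr_ge0 (B1 := 'I_r1) (B2 := 'I_r2) q0) (sum_cpr c1 c2 qs) n),
  (fun w i j => entry kappa p (w j) i); split; last split.
- move=> w j _; rewrite nnz_colE count_entry //; apply/ssrnat.leP.
  by case: (_ != _).
- move=> j /ssrnat.ltP jn; split => //; apply/RleP.
  apply: le_trans (nat_expect_le _ _ _ _ _ _) _.
  have -> : (fun w : nat -> column 'I_r1 'I_r2 (level (n + 3)) =>
      (nnz_col (r1 + r2) (fun i j => entry kappa p (w j) i) j)%:R) =
      (fun w => ((w j).2.2 != None).+1%:R) :> (_ -> R).
    by apply/funext => w; rewrite nnz_colE count_entry.
  rewrite (Ex_coord o0 (sum_cpr c1 c2 qs) (fun o => (o.2.2 != None).+1%:R)) //.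
  rewrite (sum_cpr_level _ c1 c2 (fun t => (t != None).+1%:R)).
  exact: levelp_nonzeros e0.
move=> A; have [F [F0 FE FP]] := emb A.
exists (fun w => (F w < 1)%R); split => //; split.
  apply/Rle_ge/RleP; rewrite /= /Pr.
  (* Markov's inequality in pointwise form: 1 - F is at most the indicator of F < 1, since F >=
     0. *)
  apply: (@le_trans _ _ (1 - Ex o0 (cpr (levelp eps (N := n + 3))) n F)%R).
    rewrite RdivE (_ : IZR 99 / IZR 100 = 1 - 100^-1)%R; first by rewrite lerD2l lerN2.
    rewrite !IZRposE !INRE (_ : nat_of_pos 99 = 99%N) // (_ : nat_of_pos 100 = 100%N) //.
    by field.
  rewrite lerBlDr -[leLHS](Ex_cst o0 (sum_cpr c1 c2 qs) n) -ExD.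
  apply: le_Ex => [|w]; first exact: cpr_ge0.
  case: asboolP => h; first by rewrite lerDl.
  by rewrite add0r leNgt; apply/negP.
move=> w Fw x; have /= := FP w Fw x.
have -> : (fun i => \sum_(j < d) A i j * x j)%R = mxv d A x by apply/funext => i; rewrite mxvE.
rewrite -(pmass_entry p k0) => -[low up]; rewrite !pnormE //.
have M0 := pmass_ge0 p n (mxv d A x).
have dl0 : (0 <= d%:R * ln d%:R :> R)%R.
  by rewrite mulr_ge0 // ln_ge0 // ler1n ltnW.
have pm m y : (0 <= pmass p m y :> R)%R by exact: pmass_ge0.
have mono (u v : R) : (0 <= u)%R -> (u <= v)%R -> (u `^ p^-1 <= v `^ p^-1)%R.
  move=> u0 uv; apply: ge0_ler_powR; rewrite ?nnegrE //; exact: le_trans uv.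
split; apply/RleP.
  rewrite RmultE -powRM ?(ltW c0) //; apply: mono low.
  by rewrite mulr_ge0 // ltW.
rewrite !RmultE !INRE RlnE RdivE div1r Defs_powRE ?invr_eq0 ?gt_eqF //.
apply: le_trans (mono _ _ (pm _ _) up) _.
rewrite (powRM _ (mulr_ge0 (ltW C0) dl0) M0) (powRM _ (ltW C0) dl0).
apply: ler_wpM2r; first exact: powR_ge0.
apply: ler_wpM2r; first exact: powR_ge0.
by rewrite lerDr ltW.
Qed.

End SparseEmbedding.

Open Scope R_scope.

Theorem theorem8 (p eps : R) :
  1 <= p < 2 -> 0 < eps < 1 ->
  exists c C : R, 0 < c /\ 0 < C /\
  forall d n : nat, (2 <= d)%nat -> (1 <= n)%nat ->
  exists r : nat, INR r <= C * (INR d) ^ 2 /\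
  exists (Omega : Type) (PS : prob_space Omega)
         (Pi : Omega -> nat -> nat -> R),
    (* every matrix in the support: at most two non-zeros per column *)
    (forall w j, (j < n)%nat -> (nnz_col r (Pi w) j <= 2)%nat) /\
    (* expected number of non-zeros in each column at most 1 + eps *)
    (forall j, (j < n)%nat ->
       (forall k, measurable PS (fun w => (k < nnz_col r (Pi w) j)%nat)) /\
       nat_expect PS r (fun w => nnz_col r (Pi w) j) <= 1 + eps) /\
    (* for every fixed A (n x d), with probability >= 0.99, for all x *)
    (forall A : nat -> nat -> R,
       exists E : Omega -> Prop, measurable PS E /\ prob PS E >= 99 / 100 /\
       forall w, E w -> forall x : nat -> R,
         c * pnorm p n (mxv d A x)
           <= pnorm p r (mxv n (Pi w) (mxv d A x)) /\
         pnorm p r (mxv n (Pi w) (mxv d A x))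
           <= C * powR (INR d * ln (INR d)) (1 / p) * pnorm p n (mxv d A x)).
Proof. exact (@SparseEmbedding.embedding_theorem p eps). Qed.
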